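(* Let $a_n,b_n,c_n,d_n,e_n,f_n,g_n,h_n,k_n$ denote the numbers of vertices of type $A,B,C,D,E,F,G,H,K$, respectively, on level $n$ of the hyperbolic Pascal simplex based on the hypercube mosaic $\{4,3,3,5\}$, and let $s_n$ be the number of all its vertices on level $n$, so that $s_n=a_n+b_n+c_n+d_n+e_n+f_n+g_n+h_n+k_n+4$ for $n\ge1$. (1) Each of the ten sequences $\{a_n\},\{b_n\},\{c_n\},\{d_n\},\{e_n\},\{f_n\},\{g_n\},\{h_n\},\{k_n\},\{s_n\}$ satisfies, for all $n\ge 10$, the ninth order linear homogeneous recurrence $$x_n=128x_{n-1}-1795x_{n-2}+8837x_{n-3}-19239x_{n-4}+19239x_{n-5}-8837x_{n-6}+1795x_{n-7}-128x_{n-8}+x_{n-9},$$ with the following initial values for $n=1,\dots,9$: - $a_n$: $0, 6, 12, 24, 54, 132, 336, 870, 2268$; - $b_n$: $0, 0, 6, 24, 72, 198, 528, 1392, 3654$; - $c_n$: $0, 0, 4, 12, 36, 136, 696, 4512, 33004$; - $d_n$: $0, 0, 0, 12, 96, 708, 5388, 41868, 328116$; - $e_n$: $0, 0, 0, 12, 156, 1428, 11808, 94488, 747936$; - $f_n$: $0, 0, 0, 1, 4, 16, 86, 1111, 70970$; - $g_n$: $0, 0, 0, 0, 6, 72, 1702, 137462, 15061942$; - $h_n$: $0, 0, 0, 0, 12, 774, 79254, 8862504, 998747934$; - $k_n$: $0, 0, 0, 0, 94, 12228, 1395058, 157449038, 17755598218$; - $s_n$: $4, 10, 26, 89, 534,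 15696, 1494860, 166593249, 18770594046$. (2) Each of the sequences $\{a_n\},\{b_n\},\{c_n\},\{d_n\},\{e_n\}$ also satisfies $$x_n=12x_{n-1}-37x_{n-2}+37x_{n-3}-12x_{n-4}+x_{n-5}\qquad (n\ge 6).$$ (3) Each of the sequences $\{a_n\},\{b_n\}$ satisfies $$x_n=4x_{n-1}-4x_{n-2}+x_{n-3}\qquad (n\ge 4).$$
   Context: The mosaic $\{4,3,3,5\}$ is the regular tessellation of hyperbolic 4-space by 4-dimensional hypercubes $\{4,3,3\}$ with vertex figure the 600-cell $\{3,3,5\}$ (so 600 hypercubes and 120 edges meet at each vertex). Hyperbolic Pascal simplex. Fix a vertex $V_0$ of the mosaic. The value (sign) of a vertex is the number of shortest paths along mosaic edges from $V_0$ to that vertex (the value of $V_0$ is $1$). Define a convex part $\mathcal P$ of the mosaic as follows. Take one hypercube containing $V_0$ and let $V_1$ be its vertex opposite to $V_0$ (the vertex of this hypercube with the largest value, namely $24$). Next take all new hypercubes of the mosaic containing $V_1$, and in each of them the vertex with the largest value. Then take all hypercubes containing these vertices, and in each new one the vertex with the largest value, and so on without end. $\mathcal P$ is the set of all hypercubes obtained. The vertices and edges of $\mathcal P$, with each edge directed from its endpoint nearer to $V_0$ to its endpoint farther from $V_0$, form an infinite digraph called the hyperbolic Pascal simplex. Level $n$ is the set of its vertices whose edge-distance from $V_0$ along edges of $\mathcal P$ is $n$. An incoming edge of a vertex on level $n$ is an edge from a vertex on level $n-1$. Vertex types. The boundary of $\mathcal P$ has the combinatorial shape of an infinite simplicial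 cone with apex $V_0$: four boundary rays, six 2-dimensional faces and four 3-dimensional faces. - Type $1$: vertices on the boundary rays (value $1$). They have degree $5$ in $\mathcal P$, except $V_0$, which has degree $4$. There are four of them on each level $n\ge1$. - Types $A$, $B$: vertices in the interior of a 2-dimensional face (degree $7$ in $\mathcal P$), with exactly two (type $A$) or one (type $B$) incoming edges. - Types $C$, $D$, $E$: vertices in the interior of a 3-dimensional face (degree $13$ in $\mathcal P$), with exactly three (type $C$), two (type $D$) or one (type $E$) incoming edges. - Types $F$, $G$, $H$, $K$: vertices in the interior of $\mathcal P$ (degree $120$), with exactly four (type $F$), three (type $G$), two (type $H$) or one (type $K$) incoming edges.
   Formalization: The recipe for P alone reaches only 40 of the 600 hypercubes at a vertex with one incoming edge, contradicting degree 120; P is taken as the least family also closed under convexity: three of its hypercubes around a square force all five. *)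

(* Defs.v *)
From Stdlib Require Import ZArith List.
From mathcomp Require Import all_boot all_order all_algebra finmap.
From mathcomp Require Import all_classical all_reals all_analysis.

Set Implicit Arguments.
Unset Strict Implicit.
Unset Printing Implicit Defensive.

Import Order.TTheory GRing.Theory Num.Theory.

Local Open Scope classical_set_scope.
Local Open Scope ring_scope.

Definition schlafli : seq nat := [:: 4; 3; 3; 5]%N.

(* The mosaic is obtained by Wythoff's construction.  The entries are the inner
   products of the unit normals e_0, ..., e_4 of the walls of the characteristic
   orthoscheme: consecutive walls i and i + 1 meet at the angle pi / schlafli_i
   and all other pairs are orthogonal.  The form has signature (4,1); the points
   of hyperbolic 4-space are the time-like lines of R^5, and vectors are written
   in the basis (e_i). *)
Definition gram (R : realType) : 'M[R]_5 :=
  \matrix_(i, j)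
    if i == j then 1
    else if j == i.+1 :> nat then - cos (pi / (nth 0%N schlafli i)%:R)
    else if i == j.+1 :> nat then - cos (pi / (nth 0%N schlafli j)%:R)
    else 0.

Definition lorentz (R : realType) (x y : 'rV[R]_5) : R :=
  (x *m gram R *m y^T) 0 0.

Definition wall (R : realType) (i : 'I_5) : 'rV[R]_5 := delta_mx 0 i.

Definition reflection (R : realType) (i : 'I_5) (x : 'rV[R]_5) : 'rV[R]_5 :=
  x - (2 * lorentz x (wall R i)) *: wall R i.

(* The isometry r_(i_1), then r_(i_2), etc., for w = [:: i_1; i_2; etc.]. *)
Definition isometry_of (R : realType) (w : seq 'I_5) (x : 'rV[R]_5) :
  'rV[R]_5 :=
  foldl (fun y i => reflection i y) x w.

(* The vertex of the orthoscheme lying on the walls 1, 2, 3, 4: as a row of the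
   inverse Gram matrix it satisfies lorentz base_vertex e_j = (j == 0).  All
   vertices of the mosaic are images of it under isometries, hence lie on one
   hyperboloid and represent distinct points when they are distinct vectors. *)
Definition base_vertex (R : realType) : 'rV[R]_5 := row 0 (invmx (gram R)).

(* A k-dimensional face of the mosaic, given by the set of its vertices: the
   images under the full reflection group of the orbit of the base vertex under
   the subgroup generated by r_0, ..., r_(k-1). *)
Definition face (R : realType) (k : nat) (F : set 'rV[R]_5) : Prop :=
  exists w : seq 'I_5,
    F = [set isometry_of w (isometry_of t (base_vertex R)) |
          t in [set t : seq 'I_5 | all (fun i : 'I_5 => (i < k)%N) t]].

Definition square (R : realType) (S : set 'rV[R]_5) := face 2 S.
Definition hypercube (R : realType) (C : set 'rV[R]_5) := face 4 C.

Definition mosaic_edge (R : realType) (u v : 'rV[R]_5) : Prop :=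
  u <> v /\ face 1 [set u; v].

Definition walk (T : eqType) (e : T -> T -> Prop) (x y : T) (p : seq T) : Prop :=
  path (fun u v => `[< e u v >]) x p /\ last x p = y.

Definition shortest_walks (T : eqType) (e : T -> T -> Prop) (x y : T) :
  set (seq T) :=
  [set p | walk e x y p /\ forall q, walk e x y q -> (size p <= size q)%N].

(* 0 if the set is infinite. *)
Definition card_of (T : choiceType) (A : set T) : nat := #|` fset_set A |.

Definition value (R : realType) (V0 v : 'rV[R]_5) : nat :=
  card_of (shortest_walks (@mosaic_edge R) V0 v).

Definition largest_in (R : realType) (V0 : 'rV[R]_5) (C : set 'rV[R]_5)
    (v : 'rV[R]_5) : Prop :=
  C v /\ forall u, C u -> (value V0 u <= value V0 v)%N.

(* The convex part generated by C0: the least family of hypercubes that contains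
   C0, is closed under passing to all hypercubes through the vertex of largest
   value of a member, and is convex.

   Convexity enters as follows.  Five hypercubes meet around every square, each
   with dihedral angle 2 pi / 5, so a union of hypercubes that contains three or
   four of the five has a reflex angle (6 pi / 5 or 8 pi / 5) along the square,
   whereas one or two give an angle less than pi.  Convexity thus says that
   three hypercubes of the part around a square force all five.  The rule cannot
   be dropped: for a vertex v with a single incoming edge, most hypercubes that
   have v as nearest vertex to V0 contain no vertex of largest value of another
   hypercube, so the second rule alone would leave holes and interior vertices
   of degree less than 120. *)
Inductive in_part (R : realType) (V0 : 'rV[R]_5) (C0 : set 'rV[R]_5) :
    set 'rV[R]_5 -> Prop :=
| part_start : in_part V0 C0 C0
| part_step (C C' : set 'rV[R]_5) (v : 'rV[R]_5) :
    in_part V0 C0 C -> largest_in V0 C v ->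
    hypercube C' -> C' v -> in_part V0 C0 C'
| part_convex (S C1 C2 C3 C : set 'rV[R]_5) :
    square S -> in_part V0 C0 C1 -> in_part V0 C0 C2 -> in_part V0 C0 C3 ->
    C1 <> C2 -> C1 <> C3 -> C2 <> C3 ->
    S `<=` C1 -> S `<=` C2 -> S `<=` C3 ->
    hypercube C -> S `<=` C -> in_part V0 C0 C.

Definition part_edge (R : realType) (V0 : 'rV[R]_5) (C0 : set 'rV[R]_5)
    (u v : 'rV[R]_5) : Prop :=
  mosaic_edge u v /\ exists C, [/\ in_part V0 C0 C, C u & C v].

Definition level (R : realType) (V0 : 'rV[R]_5) (C0 : set 'rV[R]_5) (n : nat) :
  set 'rV[R]_5 :=
  [set v | exists2 p, shortest_walks (part_edge V0 C0) V0 v p & size p = n].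

Definition degree (R : realType) (V0 : 'rV[R]_5) (C0 : set 'rV[R]_5)
    (v : 'rV[R]_5) : nat :=
  card_of [set u | part_edge V0 C0 v u].

Definition incoming (R : realType) (V0 : 'rV[R]_5) (C0 : set 'rV[R]_5)
    (v : 'rV[R]_5) : nat :=
  card_of [set u | part_edge V0 C0 u v /\
    exists m, level V0 C0 m u /\ level V0 C0 m.+1 v].

(* The position of a vertex in the convex part is recorded by its degree:
   7, 13 and 120 for the interiors of the 2-dimensional faces, of the
   3-dimensional faces and of the part itself; the vertices on the boundary rays
   have degree 5, or 4 for V0. *)
Definition of_type (R : realType) (V0 : 'rV[R]_5) (C0 : set 'rV[R]_5)
    (d i n : nat) : set 'rV[R]_5 :=
  [set v | [/\ level V0 C0 n v, degree V0 C0 v = d & incoming V0 C0 v = i]].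

Definition number_of (R : realType) (A : set 'rV[R]_5) : Z :=
  Z.of_nat (card_of A).

(* Main.v *)
Require Import Defs.
From Stdlib Require Import ZArith List.
From mathcomp Require Import all_boot all_order all_algebra finmap.
From mathcomp Require Import all_classical all_reals all_analysis.
From mathcomp Require Import ring lra zify.

(* The midpoint hyperplanes of the edges of the mosaic are mirrors of its
   symmetry group, and any two of them are orthogonal or disjoint.  Hence the
   vertices of the mosaic are the elements of the right-angled Coxeter group
   whose generators are the 120 vertices of the 600-cell, two of them commuting
   if and only if they are adjacent, and the edge graph of the mosaic is its
   Cayley graph; the hypercubes are the cosets of the subgroups generated by the
   tetrahedra of the 600-cell.  In this group the incoming edges of an element
   are its descents, and they form a clique.

   Let J be the set of those of the four generators leading from V0 into C0 that
   do not occur in an element w.  The convex part consists of the elements that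
   are reached from the identity by steps within the star of the simplex J, and
   its hypercubes at w are the tetrahedra of this star.  A new hypercube at a
   farthest vertex has no restriction because there the descents form a
   tetrahedron, so that J is empty; conversely the two closure rules generate all
   tetrahedra of the star, by induction on the length of w.

   The degree of w depends only on the size of J, and the type of the neighbours
   of w only on the sizes of J and of the descent set, because the symmetry group
   of the 600-cell is transitive on its simplices of each dimension.  Counting the
   edges between two consecutive levels from both ends gives a linear recursion
   for the numbers of vertices of each type. *)

Set Implicit Arguments.
Unset Strict Implicit.
Unset Printing Implicit Defensive.

Import Order.TTheory GRing.Theory Num.Theory.

(** * The 600-cell *)

(** No general theory of Coxeter groups is invoked: reducedness is read off from signs. Two distinct
    normals at a vertex have Lorentz product 0 if their mirrors are orthogonal and at most -1
    otherwise, and this gap lets the sign of [side] decide descents by induction on words. Descents,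
    length and letters of a reduced word thus depend on the vertex only. The delicate rule is
    convexity. Seen from a vertex, squares are edges of the 600-cell and hypercubes are tetrahedra,
    so the rule completes the five tetrahedra around an edge once three are present. Whether this
    fills a star is a finite question; for the unrestricted star of all 600 tetrahedra it is settled
    by spreading from vertex to vertex. Transitivity moves such questions to the simplices {0, .., k
    - 1}, where computation decides them. The order nine also has a reason: the size of J never
    grows along an outgoing edge, so from level 1 on the recursion is block triangular with blocks
    of sizes 1, 2, 3 and 4. The blocks of sizes 1 and 3 share the eigenvalue 1, which has to be
    counted only once. *)

Section Data.
Import mathcomp.boot.fintype mathcomp.boot.finset.
Local Open Scope ring_scope.

(* The pair (a, b) stands for a + b phi, with phi the golden ratio, and the root
   (c1, c2, c3, c4) for the unit normal e_0 + sqrt 2 (c1 e_1 + .. + c4 e_4); the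
   orbit of e_0 under r_1, .., r_4 consists of 120 normals of this form. *)
Definition zphi : Type := int * int.
Definition zphi_add (x y : zphi) : zphi := (x.1 + y.1, x.2 + y.2).
Definition zphi_sub (x y : zphi) : zphi := (x.1 - y.1, x.2 - y.2).
Definition zphi_mul (x y : zphi) : zphi :=
  (x.1 * y.1 + x.2 * y.2, x.1 * y.2 + x.2 * y.1 + x.2 * y.2).
Definition zphi1 : zphi := (1, 0).
Definition zphi_gen : zphi := (0, 1).
Definition zphi_dbl (x : zphi) : zphi := zphi_add x x.

Definition root : Type := zphi * zphi * zphi * zphi.

(* sqrt 2 times the inner product of the root with e_i.  The last branch is
   i = 4; the value at i = 0 is never used. *)
Definition root_pairing (i : nat) (r : root) : zphi :=
  let: (c1, c2, c3, c4) := r in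
  match i with
  | 1 => zphi_sub (zphi_sub (zphi_dbl c1) zphi1) c2
  | 2 => zphi_sub (zphi_sub (zphi_dbl c2) c1) c3
  | 3 => zphi_sub (zphi_sub (zphi_dbl c3) c2) (zphi_mul zphi_gen c4)
  | _ => zphi_sub (zphi_dbl c4) (zphi_mul zphi_gen c3)
  end.

Definition root_refl (i : nat) (r : root) : root :=
  let: (c1, c2, c3, c4) := r in
  let x := root_pairing i r in
  match i with
  | 1 => (zphi_sub c1 x, c2, c3, c4)
  | 2 => (c1, zphi_sub c2 x, c3, c4)
  | 3 => (c1, c2, zphi_sub c3 x, c4)
  | _ => (c1, c2, c3, zphi_sub c4 x)
  end.

(** Expansion of [r'] over the walls. Its e_0-term contributes [1 - d1], because e_0 meets only e_1
    non-orthogonally, with product - sqrt 2 / 2. *)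
Definition root_gram (r r' : root) : zphi :=
  let: (c1, c2, c3, c4) := r' in
  let: (d1, _, _, _) := r in
  zphi_add (zphi_sub zphi1 d1)
   (zphi_add (zphi_add (zphi_mul c1 (root_pairing 1 r))
                       (zphi_mul c2 (root_pairing 2 r)))
             (zphi_add (zphi_mul c3 (root_pairing 3 r))
                       (zphi_mul c4 (root_pairing 4 r)))).

Definition root0 : root := ((0, 0), (0, 0), (0, 0), (0, 0)).

(** Breadth-first, with [found] as the queue and [d] the number of reflections used. The order
    matters later: indices 1, 2, 3 arise from 0, 1, 2 by the walls 1, 2, 3, so the first four roots
    form a tetrahedron. *)
Fixpoint orbit_search (n k : nat) (found : seq (root * nat)) :=
  if n isn't n'.+1 then found else
  let: (r, d) := nth (root0, 0%N) found k in
  let add l i :=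
    let r' := root_refl i r in
    if r' \in unzip1 l then l else rcons l (r', d.+1) in
  orbit_search n' k.+1 (foldl add found [:: 1; 2; 3; 4]%N).

Definition orbit := Eval vm_compute in orbit_search 120 0 [:: (root0, 0%N)].
Definition roots := Eval vm_compute in unzip1 orbit.
Definition depths := Eval vm_compute in unzip2 orbit.

Definition rootn (s : nat) : root := nth root0 roots s.
Definition depth (s : nat) : nat := nth 0%N depths s.

(** Row 0 takes the default branch and repeats the permutation of [r_4]; rows 1 to 4 carry the
    geometric meaning. *)
Definition perm_table := Eval vm_compute in
  [seq [seq index (root_refl i r) roots | r <- roots] | i <- iota 0 5].
Definition wall_perm_nat (i s : nat) : nat := nth 0%N (nth [::] perm_table i) s.

Definition adj_table := Eval vm_compute in
  [seq [seq root_gram r r' == (0, 0) | r' <- roots] | r <- roots].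
Definition adjn (s t : nat) : bool := nth false (nth [::] adj_table s) t.

(** * Adjacency and symmetries on the indices of the 600-cell *)

Definition adj (s t : 'I_120) : bool := adjn s t.
Definition wall_perm (i : 'I_5) (s : 'I_120) : 'I_120 := inord (wall_perm_nat i s).
Definition act (h : seq 'I_5) (s : 'I_120) : 'I_120 := foldr wall_perm s h.

Lemma all_ordP n (P : pred nat) : all P (iota 0 n) -> forall s : 'I_n, P s.
Proof. by move=> /allP H s; apply: H; rewrite mem_iota /=. Qed.

Lemma all_ord2P n m (P : nat -> nat -> bool) :
  all (fun s => all (P s) (iota 0 m)) (iota 0 n) ->
  forall (s : 'I_n) (t : 'I_m), P s t.
Proof. by move=> /all_ordP H s; apply/all_ordP/H. Qed.

Lemma wall_perm_nat_lt (i : 'I_5) (s : 'I_120) : (wall_perm_nat i s < 120)%N.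
Proof.
by apply: (all_ord2P (P := fun i s => wall_perm_nat i s < 120)%N); vm_compute.
Qed.

Lemma val_wall_perm i s : wall_perm i s = wall_perm_nat i s :> nat.
Proof. by rewrite inordK // wall_perm_nat_lt. Qed.

Lemma wall_permK i : involutive (wall_perm i).
Proof.
move=> s; apply/val_inj/eqP; rewrite /= !val_wall_perm.
by apply: (all_ord2P (P := fun i s => wall_perm_nat i (wall_perm_nat i s) == s)); vm_compute.
Qed.

Lemma adjC s t : adj s t = adj t s.
Proof.
apply/eqP.
by apply: (all_ord2P (P := fun s t => adjn s t == adjn t s)); vm_compute.
Qed.

Lemma adj_irr s : adj s s = false.
Proof.
apply/negbTE.
by apply: (all_ordP (P := fun s => ~~ adjn s s)); vm_compute.
Qed.

Lemma adj_wall_perm i s t : adj (wall_perm i s) (wall_perm i t) = adj s t.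
Proof.
rewrite /adj !val_wall_perm.
have H : all (fun i => all (fun s => let s' := wall_perm_nat i s in
    all (fun t => adjn s' (wall_perm_nat i t) == adjn s t) (iota 0 120)) (iota 0 120))
  (iota 0 5) by vm_compute.
by apply/eqP; move/all_ord2P: H => /(_ i s)/all_ordP.
Qed.

Lemma act_inj h : injective (act h).
Proof. by elim: h => //= i h IH s t /(can_inj (wall_permK i))/IH. Qed.

Lemma adj_act h s t : adj (act h s) (act h t) = adj s t.
Proof. by elim: h => //= i h IH; rewrite adj_wall_perm. Qed.

Lemma act_cat h h' s : act (h ++ h') s = act h (act h' s).
Proof. by rewrite /act foldr_cat. Qed.

Lemma actK h : cancel (act h) (act (rev h)).
Proof.
elim: h => //= i h IH s.
by rewrite rev_cons -cats1 act_cat /= wall_permK IH.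
Qed.

Lemma rootn_wall_perm (i : 'I_5) (s : 'I_120) : (0 < i)%N -> rootn (wall_perm i s) = root_refl i (rootn s).
Proof.
move=> i0; rewrite val_wall_perm; apply/eqP.
have : (0 < i)%N ==> (rootn (wall_perm_nat i s) == root_refl i (rootn s)).
  apply: (all_ord2P (P := fun i s => (0 < i)%N ==>
    (rootn (wall_perm_nat i s) == root_refl i (rootn s)))).
  by vm_compute.
by rewrite i0.
Qed.

(** * Cliques and the transitivity of the symmetry group on them *)

Definition clique (A : {set 'I_120}) :=
  [forall s in A, forall t in A, (s != t) ==> adj s t].

Lemma cliqueP (A : {set 'I_120}) :
  reflect {in A &, forall s t, s != t -> adj s t} (clique A).
Proof.
apply: (iffP forall_inP) => [H s t sA tA st|H s sA].
  by have /forall_inP/(_ t tA) := H s sA; rewrite st.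
by apply/forall_inP => t tA; apply/implyP => st; apply: H.
Qed.

Lemma clique_sub (A B : {set 'I_120}) : A \subset B -> clique B -> clique A.
Proof.
move=> /subsetP AB /cliqueP H.
by apply/cliqueP => s t /AB sB /AB tB; apply: H.
Qed.

Lemma clique_act h (A : {set 'I_120}) : clique (act h @: A) = clique A.
Proof.
apply/cliqueP/cliqueP => H s t.
  move=> sA tA st; rewrite -(adj_act h); apply: H; rewrite ?imset_f //.
  by rewrite (inj_eq (@act_inj h)).
move=> /imsetP[s' sA ->] /imsetP[t' tA ->].
by rewrite (inj_eq (@act_inj h)) adj_act; apply: H.
Qed.

Definition initial (k : nat) : {set 'I_120} := [set s : 'I_120 | (s < k)%N].

Definition list_of (A : {set 'I_120}) : seq nat := map val (enum A).

Lemma size_list_of A : size (list_of A) = #|A|.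
Proof. by rewrite size_map cardE. Qed.

Lemma mem_list_of A (s : 'I_120) : (val s \in list_of A) = (s \in A).
Proof. by rewrite mem_map ?mem_enum //; apply: val_inj. Qed.

Definition ltadj (s t : nat) := (s < t)%N && adjn s t.

Definition indices := iota 0 120.

Definition lower_table := Eval vm_compute in
  [seq [seq s <- iota 0 t | adjn s t] | t <- indices].

Lemma lower_tableP (s t : 'I_120) :
  ltadj s t -> val s \in nth [::] lower_table t.
Proof.
apply/implyP.
apply: (all_ord2P (P := fun s t => ltadj s t ==> (s \in nth [::] lower_table t))).
by vm_compute.
Qed.

Definition candidates (l : seq nat) :=
  if l is t :: _ then nth [::] lower_table t else indices.

(** A clique is grown at the front by ever smaller vertices, so it is listed in increasing order;
    the candidates are the lower neighbours of the current head. *)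
Fixpoint cliques (k : nat) (l : seq nat) : seq (seq nat) :=
  if k is k'.+1 then
    flatten [seq cliques k' (s :: l) | s <- [seq s <- candidates l | all (ltadj s) l]]
  else [:: l].

Lemma mem_cliques k l l' : size l' = k ->
  pairwise ltadj (l' ++ l) -> all (fun s => s < 120)%N (l' ++ l) ->
  l' ++ l \in cliques k l.
Proof.
elim: k l l' => [|k IH] l l'; first by move=> /size0nil -> /=; rewrite inE.
elim/last_ind: l' => // l' s _.
rewrite size_rcons -cats1 -catA cat1s => -[sl'] pw lt120.
apply/flatten_mapP; exists s; last exact: IH.
have : all (ltadj s) l.
  by move: pw; rewrite pairwise_cat /= => /and3P[_ _ /andP[]].
rewrite mem_filter => sl; rewrite sl /=.
have s120 : (s < 120)%N by apply: (allP lt120); rewrite mem_cat mem_head orbT.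
case: l sl lt120 {pw} => [|t l] /= => [_ _|]; first by rewrite /indices mem_iota.
case/andP => st _ lt120.
have t120 : (t < 120)%N.
  by apply: (allP lt120); rewrite mem_cat !inE eqxx !orbT.
exact: (lower_tableP (s := Ordinal s120) (t := Ordinal t120)).
Qed.

Lemma pairwise_list_of (A : {set 'I_120}) :
  clique A -> pairwise ltadj (list_of A).
Proof.
move=> /cliqueP cA.
have sl : pairwise ltn (list_of A).
  rewrite -(sorted_pairwise ltn_trans) /list_of.
  apply: (subseq_sorted ltn_trans (s2 := iota 0 120)); last exact: iota_ltn_sorted.
  by rewrite -val_enum_ord map_subseq // enumT /enum_mem filter_subseq.
move: sl; rewrite /list_of !pairwise_map.
apply: (@sub_in_pairwise _ [in A]); last first.
  by apply/allP => s; rewrite mem_enum.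
move=> s t sA tA /= st; rewrite /ltadj; apply/andP; split=> //.
by apply: cA => //; apply: contraTneq st => ->; rewrite ltnn.
Qed.

Lemma list_of_clique k (A : {set 'I_120}) :
  clique A -> #|A| = k -> list_of A \in cliques k [::].
Proof.
move=> cA kA; rewrite -[list_of A]cats0; apply: mem_cliques.
- by rewrite size_list_of.
- by rewrite cats0 pairwise_list_of.
- by rewrite cats0; apply/allP => s /mapP[t _ ->] /=.
Qed.

Definition depth_sum (l : seq nat) := sumn (map depth l).

(* Transitivity on cliques is proved by descent: some wall reflection lowers the
   total depth of any clique other than {0, .., k - 1}. *)
Definition reducible (k : nat) (l : seq nat) :=
  (l == iota 0 k) ||
  has (fun i => depth_sum (map (wall_perm_nat i) l) < depth_sum l)%N [:: 1; 2; 3; 4]%N.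

Definition tetrahedra := Eval vm_compute in cliques 4 [::].

Lemma tetrahedraE : cliques 4 [::] = tetrahedra.
Proof. by vm_compute. Qed.

Lemma reducible_small :
  all (fun k => all (reducible k) (cliques k [::])) (iota 0 4).
Proof. by vm_compute. Qed.

Lemma reducible_tetrahedra : all (reducible 4) tetrahedra.
Proof. by vm_compute. Qed.

Lemma reducible_cliques k : (k <= 4)%N -> all (reducible k) (cliques k [::]).
Proof.
rewrite leq_eqVlt => /predU1P[->|k4].
  by rewrite tetrahedraE reducible_tetrahedra.
exact: (all_ordP reducible_small (Ordinal k4)).
Qed.

Lemma depth_sumE A : depth_sum (list_of A) = \sum_(s in A) depth s.
Proof. by rewrite /depth_sum -map_comp sumnE big_map big_enum. Qed.

Lemma depth_sum_wall_perm (i : 'I_5) (A : {set 'I_120}) :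
  depth_sum (map (wall_perm_nat i) (list_of A)) = \sum_(s in wall_perm i @: A) depth s.
Proof.
rewrite /depth_sum -!map_comp sumnE big_map big_enum /=.
rewrite big_imset /=; last by move=> s t _ _; apply/(can_inj (wall_permK i)).
by apply: eq_bigr => s _; rewrite val_wall_perm.
Qed.

(** The walls 1 to 4 pass through the base vertex, so normalising a clique by such a word does not
    move that vertex. *)
Definition fixing_letters (h : seq 'I_5) := all (fun i : 'I_5 => 0 < i)%N h.

Lemma clique_transitive (A : {set 'I_120}) : clique A -> (#|A| <= 4)%N ->
  exists2 h, fixing_letters h & A = act h @: initial #|A|.
Proof.
move=> cA A4.
have [n] := ubnP (\sum_(s in A) depth s).
elim: n A cA A4 => // n IH A cA A4 ltn.
have /allP/(_ _ (list_of_clique cA erefl)) := reducible_cliques A4.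
case/orP => [/eqP lA | /hasP[i i14]].
  exists [::] => //; apply/setP => s.
  rewrite -mem_list_of lA mem_iota /= add0n.
  apply/idP/imsetP => [sA | [t tA ->]]; last by move: tA; rewrite inE.
  by exists s; rewrite ?inE.
have i5 : (i < 5)%N by move: i14; rewrite !inE => /or4P[] /eqP ->.
have i0 : (0 < i)%N by move: i14; rewrite !inE => /or4P[] /eqP ->.
rewrite depth_sumE (depth_sum_wall_perm (Ordinal i5)) => lt_i.
have ri : injective (wall_perm (Ordinal i5)) by apply/(can_inj (wall_permK _)).
have [|||h hh] := IH (wall_perm (Ordinal i5) @: A).
- by rewrite -[_ @: _]/(act [:: Ordinal i5] @: A) clique_act.
- by rewrite card_imset.
- exact: leq_trans lt_i _.
rewrite card_imset // => hA; exists (Ordinal i5 :: h); first by rewrite /= i0.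
rewrite /= -[LHS](imset_id A) (imset_comp (wall_perm _) (act h)) -hA -imset_comp.
by apply: eq_imset => s /=; rewrite wall_permK.
Qed.

Lemma card_initial k : (k <= 120)%N -> #|initial k| = k.
Proof.
move=> k120.
have -> : initial k = widen_ord k120 @: [set: 'I_k].
  apply/setP => s; rewrite inE.
  apply/idP/imsetP => [sk|[t _ ->]]; last exact: (ltn_ord t).
  by exists (Ordinal sk); rewrite ?inE //; apply: val_inj.
rewrite card_imset ?cardsT ?card_ord // => s t /(congr1 val) /= st.
exact: val_inj.
Qed.

Lemma clique_initial (A : {set 'I_120}) k : clique A -> #|A| = k -> (k <= 4)%N ->
  exists2 h, fixing_letters h & A = act h @: initial k.
Proof. by move=> cA <-; apply: clique_transitive. Qed.

Definition neighbors (s : 'I_120) : {set 'I_120} := [set t | adj s t].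

Lemma initial4_maximal (s : 'I_120) :
  ~~ all (fun t => adjn s t) [:: 0; 1; 2; 3]%N.
Proof.
by apply: (all_ordP (P := fun s => ~~ all (fun t => adjn s t) [:: 0; 1; 2; 3]%N));
  vm_compute.
Qed.

Lemma mem_initial k (s : 'I_120) : (s \in initial k) = (s < k)%N.
Proof. by rewrite inE. Qed.

Lemma initial_clique k : (k <= 4)%N -> clique (initial k).
Proof.
move=> k4; apply: (@clique_sub _ (initial 4)).
  by apply/subsetP => s; rewrite !mem_initial => /leq_trans; apply.
apply/cliqueP => s t; rewrite !mem_initial => s4 t4 st.
have : (s != t)%N ==> adj s t.
  apply: (all_ord2P (n := 4) (m := 4)
    (P := fun s t => (s != t) ==> adjn s t) _ (Ordinal s4) (Ordinal t4)).
  by vm_compute.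
by rewrite -val_eqE st.
Qed.

Lemma clique_card (A : {set 'I_120}) : clique A -> (#|A| <= 4)%N.
Proof.
move=> cA; rewrite leqNgt; apply/negP => A4.
(* Four vertices of a 5-clique can be moved to {0, 1, 2, 3}; the fifth would then be a common
   neighbour of these, against [initial4_maximal]. *)
have /card_gt0P[B] : (0 < #|[set B : {set 'I_120} | B \subset A & #|B| == 5]|)%N.
  by rewrite cards_draws bin_gt0.
rewrite inE => /andP[BA /eqP B5]; have {}cA := clique_sub BA cA.
have [s sB] : exists s, s \in B by apply/card_gt0P; rewrite B5.
have B's : #|B :\ s| = 4 by move: B5; rewrite (cardsD1 s) sB => -[].
have [||h _ hB] := clique_initial (A := B :\ s) _ B's.
- exact: clique_sub (subsetDl _ _) cA.
- by [].
have := initial4_maximal (act (rev h) s).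
rewrite -[_ :: _]/(iota 0 4) => /allPn[t]; rewrite mem_iota /= => t4 /negP[].
have t120 : (t < 120)%N by apply: ltn_trans t4 _.
have {t4}ht : act h (Ordinal t120) \in B :\ s.
  by rewrite hB imset_f // mem_initial.
rewrite -[adjn _ _]/(adj _ (Ordinal t120)) -(adj_act h).
rewrite -{1}[h]revK actK.
by move: ht; rewrite !inE => /andP[ts tB]; apply: (cliqueP _ cA); rewrite // eq_sym.
Qed.

Lemma clique_extends (A : {set 'I_120}) : clique A ->
  exists B : {set 'I_120}, [/\ A \subset B, clique B & #|B| = 4].
Proof.
move=> cA; have A4 := clique_card cA.
have [h _ hA] := clique_transitive cA A4.
exists (act h @: initial 4); rewrite clique_act initial_clique //.
rewrite card_imset ?card_initial //; last exact: act_inj.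
split=> //; rewrite hA imsetS //.
by apply/subsetP => s; rewrite !mem_initial => /leq_trans; apply.
Qed.

(* [s] belongs to the star of the simplex [J]. *)
Definition enabled (J : {set 'I_120}) (s : 'I_120) : bool :=
  [forall j in J, (j == s) || adj j s].

Lemma enabledP (J : {set 'I_120}) s :
  reflect {in J, forall j, j != s -> adj j s} (enabled J s).
Proof.
apply: (iffP forall_inP) => H j jJ.
  by have /orP[/eqP->|//] := H j jJ; rewrite eqxx.
by case: eqVneq => //= js; apply: H.
Qed.

Lemma enabled_act h (J : {set 'I_120}) s : enabled (act h @: J) (act h s) = enabled J s.
Proof.
apply/enabledP/enabledP => H j.
  move=> jJ js; rewrite -(adj_act h); apply: H; rewrite ?imset_f //.
  by rewrite (inj_eq (@act_inj h)).
move=> /imsetP[k kJ ->]; rewrite (inj_eq (@act_inj h)) adj_act; exact: H.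
Qed.

Definition enabled_list (J : seq nat) (s : nat) := all (fun j => (j == s) || adjn j s) J.

Lemma enabled_list_of (J : {set 'I_120}) (s : 'I_120) : enabled_list (list_of J) s = enabled J s.
Proof.
apply/allP/forall_inP => [H j jJ|H j /mapP[k]].
  by have := H _ (etrans (mem_list_of _ _) jJ).
by rewrite mem_enum => kJ ->; apply: H.
Qed.

Lemma list_of_initial k : (k <= 120)%N -> list_of (initial k) = iota 0 k.
Proof.
move=> k120; rewrite /list_of /enum_mem.
have -> : iota 0 k = [seq s <- iota 0 120 | (s < k)%N].
  rewrite -(subnKC k120) iotaD filter_cat.
  rewrite (eq_in_filter (a2 := predT)) ?filter_predT; last first.
    by move=> s; rewrite mem_iota.
  rewrite (eq_in_filter (a2 := pred0)) ?filter_pred0 ?cats0 //.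
  by move=> s; rewrite mem_iota /= => /andP[ks _]; rewrite ltnNge ks.
rewrite -[iota 0 120]val_enum_ord filter_map enumT; congr map.
by apply: eq_filter => s; rewrite /= [s \in _]mem_initial.
Qed.

(** * The five tetrahedra around an edge *)

Definition tetrahedra01 := Eval vm_compute in
  [seq l <- tetrahedra | (0%N \in l) && (1%N \in l)].

Lemma tetrahedra01E :
  [seq l <- tetrahedra | (0%N \in l) && (1%N \in l)] = tetrahedra01.
Proof. by vm_compute. Qed.

Definition clique4 (A : {set 'I_120}) := clique A && (#|A| == 4%N).

Lemma clique4_act h (A : {set 'I_120}) : clique4 (act h @: A) = clique4 A.
Proof. by rewrite /clique4 clique_act card_imset //; apply: act_inj. Qed.

Lemma list_of_inj : injective list_of.
Proof. by move=> A B AB; apply/setP => s; rewrite -!mem_list_of AB. Qed.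

Lemma list_of_tetrahedra (A : {set 'I_120}) : clique4 A -> list_of A \in tetrahedra.
Proof. by case/andP => cA /eqP A4; rewrite -tetrahedraE list_of_clique. Qed.

Lemma clique1 (s : 'I_120) : clique [set s].
Proof.
by apply/cliqueP => u v; rewrite !inE => /eqP -> /eqP ->; rewrite eqxx.
Qed.

Lemma clique2 (x y : 'I_120) : adj x y -> clique [set x; y].
Proof.
move=> xy; apply/cliqueP => s t.
by rewrite !inE => /orP[]/eqP-> /orP[]/eqP->; rewrite ?eqxx // adjC.
Qed.

(** If [j] is 0 or 1, all five tetrahedra lie in its star. If it is a vertex of the pentagon linking
    the edge, only the two that contain it do, and for any other [j] none does. *)
Lemma three_tetrahedra01 (j : 'I_120) :
  (3 <= count (all (enabled_list [:: val j])) tetrahedra01)%N ->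
  all (all (enabled_list [:: val j])) tetrahedra01.
Proof.
apply/implyP; move: j.
apply: (all_ordP (P := fun j => (3 <= count (all (enabled_list [:: j])) tetrahedra01)%N ==>
   all (all (enabled_list [:: j])) tetrahedra01)).
by vm_compute.
Qed.

(* Five tetrahedra surround an edge; if three of them lie in a vertex star,
   then so does the edge's whole pentagonal link. *)
Lemma three_tetrahedra (J : {set 'I_120}) x y (A1 A2 A3 A : {set 'I_120}) :
  adj x y -> A1 != A2 -> A1 != A3 -> A2 != A3 ->
  (forall B, B \in [:: A1; A2; A3; A] ->
    [/\ clique4 B, x \in B & y \in B]) ->
  (forall B, B \in [:: A1; A2; A3] -> {in B, forall s, enabled J s}) ->
  {in A, forall s, enabled J s}.
Proof.
(* The star of [J] is the intersection of the stars of its vertices, so a single [j] is treated at a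
   time, after moving the edge to {0, 1}. *)
move=> xy A12 A13 A23 HB HJ s sA; apply/forall_inP => j jJ.
have xNy : x != y by apply: contraTneq xy => ->; rewrite adj_irr.
have [||h _ hxy] := clique_initial (clique2 xy) (k := 2).
- by rewrite cards2 xNy.
- by [].
pose g := act (rev h); have gK : cancel (act h) g by apply: actK.
have gxy : g @: [set x; y] = initial 2.
  rewrite hxy -imset_comp -[RHS]imset_id.
  by apply: eq_imset => t; rewrite /= gK.
have mem01 B : B \in [:: A1; A2; A3; A] -> list_of (g @: B) \in tetrahedra01.
  move=> /HB[cB xB yB]; rewrite -tetrahedra01E mem_filter.
  rewrite list_of_tetrahedra ?clique4_act // andbT.
  have sub : initial 2 \subset g @: B.
    by rewrite -gxy imsetS // subUset !sub1set xB.
  have i0 : (0 < 120)%N by []. have i1 : (1 < 120)%N by [].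
  rewrite (mem_list_of _ (Ordinal i0)) (mem_list_of _ (Ordinal i1)).
  by rewrite !(subsetP sub) ?mem_initial.
have enB (B : {set 'I_120}) : {in B, forall s, enabled J s} ->
    all (enabled_list [:: val (g j)]) (list_of (g @: B)).
  move=> BJ; apply/allP => t /mapP[t']; rewrite mem_enum => /imsetP[u uB ->] ->.
  rewrite /enabled_list /= andbT -[adjn _ _]/(adj _ _) adj_act.
  have /forall_inP/(_ j jJ) := BJ u uB.
  by case/orP => [/eqP ->|->]; rewrite ?eqxx ?orbT.
pose f (B : {set 'I_120}) := list_of (g @: B).
have finj : injective f.
  by move=> B C /list_of_inj/imset_inj; apply; apply: act_inj.
have H : all (all (enabled_list [:: val (g j)])) tetrahedra01.
  apply: three_tetrahedra01; rewrite -size_filter.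
  pose l := map f [:: A1; A2; A3].
  apply: (@leq_trans (size l)) => //; apply: uniq_leq_size.
    by rewrite map_inj_uniq //= !inE negb_or A12 A13 A23.
  move=> _ /mapP[B B3 ->]; rewrite mem_filter enB; last exact: HJ.
  by apply: mem01; move: B3; rewrite !inE => /or3P[]->; rewrite ?orbT.
have {H} := allP H _ (mem01 A _).
rewrite !inE eqxx !orbT => /(_ isT)/allP/(_ (val (g s))).
rewrite mem_list_of imset_f // => /(_ isT).
rewrite /enabled_list /= andbT -[adjn _ _]/(adj _ _) adj_act.
by case/orP => [/eqP/val_inj/(@act_inj _) ->|->]; rewrite ?eqxx ?orbT.
Qed.

End Data.

(** * Closure of a set of tetrahedra under the three-of-five rule *)

Section Closure.
Import mathcomp.boot.fintype mathcomp.boot.finset.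

Definition set_of_list (l : seq nat) : {set 'I_120} := [set s | val s \in l].

Lemma list_ofK : cancel list_of set_of_list.
Proof. by move=> A; apply/setP => s; rewrite inE mem_list_of. Qed.

Definition is_clique4 (l : seq nat) :=
  [&& size l == 4%N, all (fun s => s < 120)%N l, uniq l &
      all (fun s => all (fun t => (s == t) || adjn s t) l) l].

Lemma tetrahedra_clique4 : all is_clique4 tetrahedra.
Proof. by vm_compute. Qed.

Lemma set_of_list_clique4 l : l \in tetrahedra -> clique4 (set_of_list l).
Proof.
move/(allP tetrahedra_clique4) => /and4P[/eqP l4 l120 ul adjl].
apply/andP; split.
  apply/cliqueP => s t; rewrite !inE => sl tl st.
  by have := allP (allP adjl _ sl) _ tl; rewrite val_eqE (negbTE st).
apply/eqP; transitivity (size [seq (inord s : 'I_120) | s <- l]).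
  rewrite -(card_uniqP _); last first.
    rewrite map_inj_in_uniq //.
    move=> s t /(allP l120) s120 /(allP l120) t120 /(congr1 val).
    by rewrite /= !inordK.
  apply/eq_card => s; rewrite inE.
  apply/idP/mapP => [sl|[t tl ->]]; last by rewrite /= inordK // (allP l120).
  by exists (val s); rewrite // inord_val.
by rewrite size_map.
Qed.

Lemma sorted_tetrahedra : all (pairwise ltn) tetrahedra.
Proof. by vm_compute. Qed.

Lemma set_of_list_inj l l' :
  l \in tetrahedra -> l' \in tetrahedra -> set_of_list l = set_of_list l' ->
  l = l'.
Proof.
move=> lT l'T ll'.
have sl := allP sorted_tetrahedra _ lT; have sl' := allP sorted_tetrahedra _ l'T.
have l120 := allP tetrahedra_clique4 _ lT; have l'120 := allP tetrahedra_clique4 _ l'T.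
apply: (irr_sorted_eq ltn_trans ltnn); rewrite ?sorted_pairwise //; try exact: ltn_trans.
case/and4P: l120 => _ /allP l120 _ _; case/and4P: l'120 => _ /allP l'120 _ _.
move=> s; apply/idP/idP => sl0.
  have := l120 _ sl0 => s120.
  have : Ordinal s120 \in set_of_list l by rewrite inE.
  by rewrite ll' inE.
have := l'120 _ sl0 => s120.
have : Ordinal s120 \in set_of_list l' by rewrite inE.
by rewrite -ll' inE.
Qed.

(** The convexity rule seen from one vertex: the edge {x, y} is a square there and the tetrahedra
    are hypercubes. *)
Definition edge_closed (K : {set 'I_120} -> Prop) : Prop :=
  forall x y (A1 A2 A3 A : {set 'I_120}),
  adj x y -> A1 != A2 -> A1 != A3 -> A2 != A3 ->
  (forall B, B \in [:: A1; A2; A3; A] ->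
    [/\ clique4 B, x \in B & y \in B]) ->
  K A1 -> K A2 -> K A3 -> K A.

Lemma edge_closed_act h K :
  edge_closed K -> edge_closed (fun A => K (act h @: A)).
Proof.
move=> HK x y A1 A2 A3 A xy A12 A13 A23 HB.
pose f (A : {set 'I_120}) := act h @: A.
have ainj : injective f.
  by apply: imset_inj; apply: act_inj.
apply: (HK (act h x) (act h y)).
- by rewrite adj_act.
- by rewrite (inj_eq ainj).
- by rewrite (inj_eq ainj).
- by rewrite (inj_eq ainj).
move=> B; rewrite -[[:: _; _; _; _]]/(map f [:: A1; A2; A3; A]).
case/mapP => C /HB[cC xC yC] ->.
by rewrite clique4_act /f !imset_f.
Qed.

Definition closure_step (T known : seq (seq nat)) (e : nat * nat) :=
  let around := [seq l <- T | (e.1 \in l) && (e.2 \in l)] in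
  if adjn e.1 e.2 && (3 <= count (mem known) around)%N then
    [seq l <- around | l \notin known] ++ known
  else known.

Definition edges_of (T : seq (seq nat)) : seq (nat * nat) :=
  undup (flatten
    [seq [seq (x, y) | x <- l, y <- [seq y <- l | (x < y)%N]] | l <- T]).

(** Three sweeps over the edges suffice in every case tested below. Soundness holds for any list of
    edges, which is why [closes_sound] generalises it. *)
Definition closes (T start : seq (seq nat)) : bool :=
  let E := edges_of T in
  all (mem (foldl (closure_step T) start (E ++ E ++ E))) T.

Lemma three_elements (T : eqType) (l : seq T) : uniq l -> (3 <= size l)%N ->
  exists x y z, [/\ x != y, x != z, y != z & {subset [:: x; y; z] <= l}].
Proof.
case: l => [|x [|y [|z l]]] //= /and4P[]; rewrite !inE !negb_or.
move=> /and3P[xy xz _] /andP[yz _] _ _ _; exists x, y, z; split=> // t.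
by rewrite !inE => /or3P[]->; rewrite ?orbT.
Qed.

Lemma closes_sound (K : {set 'I_120} -> Prop) (T start : seq (seq nat)) :
  edge_closed K -> closes T start ->
  {subset T <= tetrahedra} -> uniq T ->
  {in start, forall l, K (set_of_list l)} -> {in T, forall l, K (set_of_list l)}.
Proof.
move=> HK /allP cT Ttet uT Hstart l /cT /=; move: (_ ++ _) => E {cT}.
elim: E start Hstart l => //= e E IH start Hstart l; apply: IH => {}l.
rewrite /closure_step; case: ifP => [/andP[e12]|_]; last exact: Hstart.
rewrite -size_filter => sz; rewrite mem_cat => /orP[|/Hstart //].
rewrite !mem_filter => /and3P[_ /andP[e1l e2l] lT].
have [|l1 [l2 [l3 [l12 l13 l23 Hl]]]] := three_elements _ sz.
  by rewrite !filter_uniq.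
have Hl' l' : l' \in [:: l1; l2; l3] ->
    [/\ l' \in tetrahedra, l' \in start, e.1 \in l' & e.2 \in l'].
  move/Hl; rewrite !mem_filter => /andP[ls /andP[/andP[el1 el2] l'T]].
  by split=> //; apply: Ttet.
have lt120 s : s \in l -> (s < 120)%N.
  by have /and4P[_ /allP H _ _] := allP tetrahedra_clique4 _ (Ttet _ lT); apply: H.
have neq l' l'' : l' \in tetrahedra -> l'' \in tetrahedra -> l' != l'' ->
    set_of_list l' != set_of_list l''.
  by move=> t' t''; apply: contraNneq => /set_of_list_inj ->.
have [t1 s1 _ _] := Hl' l1 (mem_head _ _).
have [t2 s2 _ _] := Hl' l2 ltac:(by rewrite !inE eqxx orbT).
have [t3 s3 _ _] := Hl' l3 ltac:(by rewrite !inE eqxx !orbT).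
apply: (HK (Ordinal (lt120 _ e1l)) (Ordinal (lt120 _ e2l))
  (set_of_list l1) (set_of_list l2) (set_of_list l3)); rewrite ?neq //;
  try exact: Hstart.
move=> B; rewrite -[[:: _; _; _; _]]/(map set_of_list [:: l1; l2; l3; l]).
case/mapP => l' l'4 ->; rewrite !inE.
have [/Hl'[]|] := boolP (l' \in [:: l1; l2; l3]).
  by move=> t' _ -> ->; rewrite set_of_list_clique4.
move=> l'3; have -> : l' = l.
  by apply/eqP; move: l'4 l'3; rewrite !inE; case: eqP => //=; case: eqP => //=;
     case: eqP => //=; case: eqP.
by rewrite set_of_list_clique4 ?e1l ?e2l //; apply: Ttet.
Qed.

(** * Closure computations in stars *)

Definition star_tetrahedra (J : seq nat) := [seq l <- tetrahedra | all (enabled_list J) l].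

Lemma mem_star_tetrahedra J l :
  (l \in star_tetrahedra J) = all (enabled_list J) l && (l \in tetrahedra).
Proof. exact: mem_filter. Qed.

(** The tetrahedra supplied by the later hypotheses [K_in] (those through [d]) and [K_near] (those
    containing the face opposite to [d] of such a one). *)
Definition star_start (T : seq (seq nat)) (d : nat) : seq (seq nat) :=
  let T0 := [seq l <- T | d \in l] in
  T0 ++ [seq l <- T | has (fun l' => all (fun x => (x == d) || (x \in l)) l') T0].

Definition star_closes (J : seq nat) (d : nat) : bool :=
  closes (star_tetrahedra J) (star_start (star_tetrahedra J) d).

Lemma star_closesE J d : star_closes J d =
  closes (star_tetrahedra J) (star_start (star_tetrahedra J) d).
Proof. by []. Qed.

(** Here J has r - 1 > 0 elements, so its star consists of 20, 5 or 2 tetrahedra. *)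
Lemma star_closes_initial :
  all (fun r => all (fun d => star_closes (rem d (iota 0 r)) d) (iota 0 r))
  [:: 2; 3; 4]%N.
Proof. by vm_compute. Qed.

Definition through (x : nat) := [seq l <- tetrahedra | x \in l].

(** In the link of [x], an icosahedron, these are the triangles touching at least one of two
    adjacent vertices. *)
Definition through_start (T : seq (seq nat)) (x : nat) :=
  [seq l <- T | has (mem l) (rem x (iota 0 3))].

Lemma through_closes :
  all (fun x => closes (through x) (through_start (through x) x)) (iota 0 3).
Proof. by vm_compute. Qed.

(** Supplies the induction on indices in [interior_known]: two smaller adjacent neighbours are what
    [full_triangle] requires. *)
Lemma lower_triangle (s : 'I_120) : (1 < s)%N ->
  has (fun a => has (adjn a) (nth [::] lower_table s)) (nth [::] lower_table s).
Proof.
apply/implyP; move: s; apply: (all_ordP (P := fun s => (1 < s)%N ==>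
  has (fun a => has (adjn a) (nth [::] lower_table s)) (nth [::] lower_table s))).
by vm_compute.
Qed.

Lemma lower_ltadj (s : 'I_120) :
  all (fun t => ltadj t s) (nth [::] lower_table s).
Proof.
move: s; apply: (all_ordP (P := fun s => all (fun t => ltadj t s) (nth [::] lower_table s))).
by vm_compute.
Qed.

Lemma list_of_D1 (A : {set 'I_120}) (x : 'I_120) :
  list_of (A :\ x) = rem (val x) (list_of A).
Proof.
rewrite rem_filter; last by rewrite map_inj_uniq ?enum_uniq //; apply: val_inj.
rewrite /list_of filter_map /enum_mem -filter_predI; congr (map _ _).
by apply: eq_filter => s /=; exact: in_setD1.
Qed.

Lemma uniq_tetrahedra : uniq tetrahedra.
Proof. by vm_compute. Qed.

Lemma act_revK h : cancel (act (rev h)) (act h).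
Proof. by move=> s; rewrite -{1}[h]revK actK. Qed.

Lemma imset_actK h (A : {set 'I_120}) : act h @: (act (rev h) @: A) = A.
Proof.
by rewrite -imset_comp -[RHS]imset_id; apply: eq_imset => s /=; rewrite act_revK.
Qed.

Lemma imset_act_revK h (A : {set 'I_120}) : act (rev h) @: (act h @: A) = A.
Proof.
by rewrite -imset_comp -[RHS]imset_id; apply: eq_imset => s /=; rewrite actK.
Qed.

Lemma mem_imset_act h (A : {set 'I_120}) s : (act h s \in act h @: A) = (s \in A).
Proof. by rewrite mem_imset //; apply: act_inj. Qed.

(* [K_near] is the effect of passing to the farthest vertex of a hypercube that
   contains the incoming edge [d]. *)
Section Star.
Variables (K : {set 'I_120} -> Prop) (J : {set 'I_120}) (d : 'I_120).
Hypotheses (K_edge : edge_closed K) (dJ : clique (d |: J)) (d_notin : d \notin J).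
Hypothesis K_in : forall A, clique4 A -> {in A, forall s, enabled J s} ->
  d \in A -> K A.
Hypothesis K_near : forall A B, clique4 A -> {in A, forall s, enabled J s} ->
  d \in A -> clique4 B -> {in B, forall s, enabled J s} -> A :\ d \subset B -> K B.

(** A symmetry moves [d |: J] to {0, .., r - 1}, where [star_closes_initial] applies; [J != set0]
    gives r >= 2. *)
Lemma star_known A : J != set0 -> clique4 A -> {in A, forall s, enabled J s} -> K A.
Proof.
move=> J0 cA AJ.
have r4 := clique_card dJ.
have [h _ hJ] := clique_initial dJ erefl r4; set r := #|d |: J| in r4 hJ.
have r2 : (1 < r)%N by rewrite /r cardsU1 d_notin ltnS card_gt0.
pose d' := act (rev h) d; pose J' := act (rev h) @: J.
have dE : d = act h d' by rewrite /d' act_revK.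
have JE : J = act h @: J' by rewrite /J' imset_actK.
have dr : d' \in initial r by rewrite -(mem_imset_act h) -hJ -dE setU11.
have J'E : list_of J' = rem (val d') (iota 0 r).
  rewrite -(list_of_initial (leq_trans r4 _)) // -list_of_D1; congr list_of.
  apply/setP => s; rewrite !inE -(mem_imset_act h) -JE.
  rewrite -[(s < r)%N]mem_initial -(mem_imset_act h) -hJ.
  rewrite -(inj_eq (@act_inj h)) -dE !inE.
  by have [->|] := eqVneq (act h s) d; rewrite ?(negbTE d_notin).
have {}cl : star_closes (list_of J') d'.
  rewrite J'E; apply: (allP (allP star_closes_initial r _) (val d')).
    by rewrite !inE; move: r2 r4; case: (r) => [|[|[|[|[|]]]]].
  by rewrite mem_iota -mem_initial.
move: cl; rewrite star_closesE.
have mT := mem_star_tetrahedra (list_of J').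
have uT : uniq (star_tetrahedra (list_of J')).
  by rewrite filter_uniq ?uniq_tetrahedra.
move: (star_tetrahedra _) mT uT => T mT uT cl.
have T_tet : {subset T <= tetrahedra} by move=> l; rewrite mT => /andP[].
have TP l : l \in T -> clique4 (act h @: set_of_list l) /\
    {in act h @: set_of_list l, forall s, enabled J s}.
  rewrite mT => /andP[lJ lt].
  rewrite clique4_act set_of_list_clique4 //; split=> // _ /imsetP[s sl ->].
  by rewrite JE enabled_act -enabled_list_of; apply: (allP lJ); rewrite inE in sl.
have dP l : val d' \in l -> d \in act h @: set_of_list l.
  by move=> dl; rewrite dE mem_imset_act inE.
have AT : list_of (act (rev h) @: A) \in T.
  rewrite mT list_of_tetrahedra ?clique4_act // andbT.
  apply/allP => _ /mapP[s + ->]; rewrite mem_enum => sA.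
  rewrite enabled_list_of -(enabled_act h) -JE; apply: AJ.
  by rewrite -[A](imset_actK h) mem_imset_act.
suff : K (act h @: set_of_list (list_of (act (rev h) @: A))).
  by rewrite list_ofK imset_actK.
move: (list_of _) AT; apply: (closes_sound (edge_closed_act (h := h) K_edge) cl T_tet).
  by [].
move=> l; rewrite /star_start mem_cat => /orP[].
  rewrite mem_filter => /andP[dl /TP[cl4 clJ]]; exact: K_in (dP _ dl).
rewrite mem_filter => /andP[/hasP[l']]; rewrite mem_filter => /andP[dl' l'T].
move=> /allP sub lT; have [c4 cJ] := TP _ lT; have [c4' cJ'] := TP _ l'T.
apply: (K_near c4' cJ' (dP _ dl')) => //.
apply/subsetP => s; rewrite !inE => /andP[sd] /imsetP[t tl' st].
move: sd tl'; rewrite {}st => sd; rewrite mem_imset_act !inE => /sub.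
by case/predU1P => [/val_inj td|//]; rewrite td -dE eqxx in sd.
Qed.

End Star.

(** In the icosahedron linking [x], the triangles touching [a] or [b] are known, and the
    three-of-five rule around its vertices spreads them to all twenty. *)
Lemma full_triangle (K : {set 'I_120} -> Prop) (a b x : 'I_120) :
  edge_closed K -> adj a b -> adj a x -> adj b x ->
  (forall A, clique4 A -> x \in A -> (a \in A) || (b \in A) -> K A) ->
  forall A, clique4 A -> x \in A -> K A.
Proof.
move=> K_edge ab ax bx Kab A cA xA.
have neq s t : adj s t -> (s == t) = false.
  by move=> st; apply: contraTF st => /eqP ->; rewrite adj_irr.
have c3 : clique [set a; b; x].
  apply/cliqueP => s t; rewrite !inE => /orP[/orP[]|]/eqP-> /orP[/orP[]|]/eqP->;
  by rewrite ?eqxx // adjC.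
have n3 : #|[set a; b; x]| = 3%N.
  by rewrite setUC cardsU1 cards2 !inE !(eq_sym x) !neq.
have [//|h _ hB] := clique_initial c3 n3.
pose x' := act (rev h) x.
have xE : x = act h x' by rewrite /x' act_revK.
have x3 : x' \in initial 3.
  by rewrite -(mem_imset_act h) -hB -xE !inE eqxx !orbT.
have := allP through_closes (val x').
rewrite mem_iota -mem_initial x3 => /(_ isT).
have mT l : (l \in through (val x')) = (val x' \in l) && (l \in tetrahedra).
  exact: mem_filter.
have uT : uniq (through (val x')) by rewrite filter_uniq ?uniq_tetrahedra.
move: (through _) mT uT => T mT uT cl.
have AT : list_of (act (rev h) @: A) \in T.
  rewrite mT list_of_tetrahedra ?clique4_act // andbT mem_list_of.
  by rewrite mem_imset_act.
have T_tet : {subset T <= tetrahedra} by move=> l; rewrite mT => /andP[].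
suff : K (act h @: set_of_list (list_of (act (rev h) @: A))).
  by rewrite list_ofK imset_actK.
move: (list_of _) AT; apply: (closes_sound (edge_closed_act (h := h) K_edge) cl T_tet uT).
move=> l; rewrite mem_filter mT => /and3P[/hasP[y yx yl] xl lt].
apply: Kab; first by rewrite clique4_act set_of_list_clique4.
  by rewrite xE mem_imset_act inE.
move: yx; rewrite mem_rem_uniq ?iota_uniq // inE mem_iota => /andP[yNx y3].
have y120 : (y < 120)%N by apply: ltn_trans y3 _.
have yB : act h (Ordinal y120) \in [set a; b; x].
  by rewrite hB mem_imset_act mem_initial.
have yA : act h (Ordinal y120) \in act h @: set_of_list l.
  by rewrite mem_imset_act inE.
move: yB; rewrite !inE => /orP[/orP[]|] /eqP yE.
- by rewrite -yE yA.
- by rewrite -yE yA orbT.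
- by move: yNx; rewrite /x' -yE actK eqxx.
Qed.

Section Interior.
Variables (K : {set 'I_120} -> Prop) (d : 'I_120).
Hypothesis K_edge : edge_closed K.
Hypothesis K_in : forall A, clique4 A -> d \in A -> K A.
Hypothesis K_near : forall A B, clique4 A -> d \in A -> clique4 B ->
  A :\ d \subset B -> K B.

Let full s := forall A, clique4 A -> s \in A -> K A.

(** The tetrahedra through [s] lie in the star of {s}, so the restricted case applies with J =
    {s}. *)
Lemma full_adjacent s : adj d s -> full s.
Proof.
move=> ds A cA sA.
have star B : clique4 B -> s \in B -> {in B, forall t, enabled [set s] t}.
  case/andP => /cliqueP cB _ sB t tB.
  by apply/enabledP => j; rewrite inE => /eqP -> st; apply: cB.
apply: (@star_known K [set s] d) => //.
- rewrite -[_ |: _]/[set d; s]; exact: clique2.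
- by rewrite inE; apply: contraTneq ds => ->; rewrite adj_irr.
- by move=> B cB _ dB; apply: K_in.
- by move=> B C cB _ dB cC _; apply: K_near.
- by apply/set0Pn; exists s; rewrite inE.
- exact: star.
Qed.

(** With [d] moved to index 0, the vertices become full in the order of their indices: 0 by [K_in],
    1 as a neighbour of 0, and every later one through a triangle with two smaller vertices. *)
Lemma interior_known A : clique4 A -> K A.
Proof.
move=> cA; have [s sA] : exists s, s \in A.
  by apply/card_gt0P; case/andP: cA => _ /eqP ->.
have [//|h _ h1] := @clique_initial [set d] 1 (clique1 d) (cards1 d).
have i0 : (0 < 120)%N by [].
have i1 : (1 < 120)%N by [].
have dE : d = act h (Ordinal i0).
  by apply/esym/set1P; rewrite h1 mem_imset_act mem_initial.
suff full_act (t : 'I_120) : full (act h t).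
  by apply: (full_act (act (rev h) s)) => //; rewrite act_revK.
have [n] := ubnP (val t); elim: n t => // n IH t tn.
have lowerP a : a \in nth [::] lower_table t ->
    exists2 a' : 'I_120, a = val a' & adj a' t /\ full (act h a').
  move=> /(allP (lower_ltadj t)) /andP[at_ adjat].
  exists (Ordinal (ltn_trans at_ (ltn_ord t))) => //; split=> //.
  by apply: IH; apply: leq_trans at_ _; rewrite -ltnS.
have [t1|] := ltnP 1 t.
  have /hasP[a /lowerP[{}a -> [at_ fa]] /hasP[b /lowerP[{}b -> [bt fb]] ab]] :=
    lower_triangle t1.
  move=> B cB tB; apply: (@full_triangle K (act h a) (act h b) (act h t)) => //;
    rewrite ?adj_act // => C cC tC /orP[]; [exact: fa | exact: fb].
rewrite leq_eqVlt => /predU1P[t1|].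
  have -> : t = Ordinal i1 by apply: val_inj.
  by apply: full_adjacent; rewrite dE adj_act.
rewrite ltnS leqn0 => /eqP t0; have -> : t = Ordinal i0 by apply: val_inj.
by rewrite -dE => B; apply: K_in.
Qed.

End Interior.

End Closure.

(** * Steps from a vertex of given type *)

Section Transitions.
Import mathcomp.boot.fintype mathcomp.boot.finset.

(* A vertex has type (j, i) if j of the four generators at [V0] do not occur in
   it and it has i incoming edges.  In this order: 1, A, B, C, D, E, F, G, H, K. *)
Definition vertex_types : seq (nat * nat) :=
  [:: (3, 1); (2, 2); (2, 1); (1, 3); (1, 2); (1, 1);
      (0, 4); (0, 3); (0, 2); (0, 1)]%N.

(** After the step [s] the descents are [s] itself and the old descents adjacent to it, hence the
    successor in the test on [i]. *)
Definition transition_list (J D : seq nat) (j i : nat) : nat :=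
  count (fun s => [&& enabled_list J s, s \notin D, size (rem s J) == j &
                      (count (adjn s) D).+1 == i]) indices.

Definition transition_number (j0 i0 j i : nat) : nat :=
  transition_list (iota 0 j0) (iota j0 i0) j i.

Fixpoint splits (l : seq nat) : seq (seq nat * seq nat) :=
  if l is x :: l' then
    map (fun p => (x :: p.1, p.2)) (splits l') ++
    map (fun p => (p.1, x :: p.2)) (splits l')
  else [:: ([::], [::])].

Lemma mem_splits (p : pred nat) l :
  ([seq x <- l | p x], [seq x <- l | ~~ p x]) \in splits l.
Proof.
elim: l => //= x l IH; rewrite mem_cat; case: (p x) => /=.
  by rewrite (map_f (fun p => (x :: p.1, p.2)) IH).
by rewrite (map_f (fun p => (p.1, x :: p.2)) IH) orbT.
Qed.

(** Symmetry only brings the union of J and D to {0, .., r - 1} and does not control which elements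
    fall into J. So every partition is compared with the standard one of the same sizes. *)
Lemma transition_splits :
  all (fun r => all (fun JD => all (fun ji =>
    transition_list JD.1 JD.2 ji.1 ji.2 ==
    transition_number (size JD.1) (size JD.2) ji.1 ji.2) vertex_types)
    (splits (iota 0 r))) (iota 0 5).
Proof. by vm_compute. Qed.

Lemma transition_split (r : nat) (J D : seq nat) (j i : nat) : (r <= 4)%N ->
  (J, D) \in splits (iota 0 r) -> (j, i) \in vertex_types ->
  transition_list J D j i = transition_number (size J) (size D) j i.
Proof.
move=> r4 JD ji; have r5 : r \in iota 0 5 by rewrite mem_iota.
by have /allP/(_ _ JD)/allP/(_ _ ji)/eqP := allP transition_splits r r5.
Qed.

Definition transitions (J D : {set 'I_120}) (j i : nat) : {set 'I_120} :=
  [set s | [&& enabled J s, s \notin D, #|J :\ s| == j &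
               #|s |: (D :&: neighbors s)| == i]].

Lemma list_of_sub (A B : {set 'I_120}) : A \subset B ->
  list_of A = [seq s <- list_of B | inord s \in A].
Proof.
move=> /subsetP AB; rewrite /list_of filter_map /enum_mem -filter_predI.
congr (map _ _); apply: eq_filter => s /=; rewrite inord_val.
apply/idP/andP => [sA|[] //]; split=> //; exact: AB.
Qed.

Lemma card_indices (p : pred nat) : #|[set s : 'I_120 | p s]| = count p indices.
Proof.
rewrite cardsE cardE /enum_mem size_filter -enumT /indices -val_enum_ord.
by rewrite count_map.
Qed.

Lemma card_neighbors (D : {set 'I_120}) (s : 'I_120) :
  #|D :&: neighbors s| = count (adjn s) (list_of D).
Proof.
rewrite count_map -size_filter /enum_mem -filter_predI -/(enum_mem _).
rewrite cardE /enum_mem; congr size; apply: eq_filter => t /=.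
by rewrite inE /= andbC; congr (_ && _); rewrite inE.
Qed.

Lemma card_transitions_list (J D : {set 'I_120}) j i :
  #|transitions J D j i| = transition_list (list_of J) (list_of D) j i.
Proof.
rewrite /transition_list -card_indices; apply: eq_card => s; rewrite !inE.
rewrite -enabled_list_of -mem_list_of -size_list_of list_of_D1 -card_neighbors.
case: (boolP (val s \in list_of D)); rewrite ?andbF //= => sD.
by rewrite cardsU1 !inE adj_irr andbF.
Qed.

Lemma transitions_act h (J D : {set 'I_120}) j i :
  transitions (act h @: J) (act h @: D) j i = act h @: transitions J D j i.
Proof.
have ainj := @act_inj h.
have imD1 (A : {set 'I_120}) s : act h @: A :\ act h s = act h @: (A :\ s).
  apply/setP => t; rewrite -[t](act_revK h) mem_imset_act !inE mem_imset_act.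
  by rewrite (inj_eq ainj).
have imN (A : {set 'I_120}) s :
    act h s |: (act h @: A :&: neighbors (act h s)) =
    act h @: (s |: (A :&: neighbors s)).
  rewrite imsetU1; congr (_ |: _); apply/setP => t; rewrite inE.
  rewrite -[t](act_revK h) !mem_imset_act !inE; congr (_ && _).
  by rewrite adj_act.
apply/setP => s; rewrite -[s](act_revK h) mem_imset_act; move: (act _ s) => {}s.
by rewrite !inE enabled_act mem_imset_act imD1 imN !card_imset.
Qed.

Lemma card_transitions (J D : {set 'I_120}) j i :
  clique (J :|: D) -> [disjoint J & D] -> (j, i) \in vertex_types ->
  #|transitions J D j i| = transition_number #|J| #|D| j i.
Proof.
move=> cJD dJD ji.
have r4 := clique_card cJD; set r := #|_| in r4.
have [h _ hJD] := clique_initial cJD erefl r4.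
pose J' := act (rev h) @: J; pose D' := act (rev h) @: D.
have JE : J = act h @: J' by rewrite /J' imset_actK.
have DE : D = act h @: D' by rewrite /D' imset_actK.
have JD' : J' :|: D' = initial r.
  by rewrite -imsetU hJD imset_act_revK.
have J'r : J' \subset initial r by rewrite -JD' subsetUl.
have D'r : D' \subset initial r by rewrite -JD' subsetUr.
have cardJ : #|J| = size (list_of J').
  by rewrite size_list_of JE card_imset //; apply: act_inj.
have cardD : #|D| = size (list_of D').
  by rewrite size_list_of DE card_imset //; apply: act_inj.
rewrite [in LHS]JE [in LHS]DE transitions_act card_imset; last exact: act_inj.
rewrite card_transitions_list cardJ cardD.
have r120 : (r <= 120)%N by apply: leq_trans r4 _.
have listD : list_of D' = [seq s <- iota 0 r | inord s \notin J'].
  rewrite (list_of_sub D'r) list_of_initial //; apply: eq_in_filter => s.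
  rewrite mem_iota /= => sr.
  have s120 : (s < 120)%N by apply: leq_trans sr _.
  have : inord s \in J' :|: D' by rewrite JD' mem_initial inordK.
  have : ~~ ((inord s \in J') && (inord s \in D')).
    apply/negP => /andP[/imsetP[x xJ ->]].
    rewrite mem_imset_act => xD; have /pred0P/(_ x) := dJD.
    by rewrite /= xJ xD.
  by rewrite inE; do 2 case: (_ \in _).
apply: (transition_split r4) => //.
rewrite listD (list_of_sub J'r) (list_of_initial r120).
exact: (mem_splits (fun s => inord s \in J')).
Qed.

(** The j vertices of a simplex plus those of its link: for j > 0 the link is an icosahedron, a
    pentagon, two points, or empty. *)
Definition star_size (j : nat) : nat := nth 0%N [:: 120; 13; 7; 5; 4]%N j.

Lemma star_size_initial :
  all (fun j => count (enabled_list (iota 0 j)) indices == star_size j) (iota 0 5).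
Proof. by vm_compute. Qed.

Lemma card_enabled (J : {set 'I_120}) : clique J ->
  #|[set s | enabled J s]| = star_size #|J|.
Proof.
move=> cJ; have r4 := clique_card cJ; set r := #|J| in r4 *.
have [h _ hJ] := clique_initial cJ erefl r4.
have -> : [set s | enabled J s] = act h @: [set s | enabled (initial r) s].
  apply/setP => s; rewrite -[s](act_revK h) mem_imset_act !inE hJ.
  by rewrite enabled_act.
rewrite card_imset; last exact: act_inj.
have r120 : (r <= 120)%N by apply: leq_trans r4 _.
have -> : [set s | enabled (initial r) s] = [set s : 'I_120 | enabled_list (iota 0 r) s].
  by apply/setP => s; rewrite !inE -enabled_list_of list_of_initial.
rewrite card_indices; apply/eqP; apply: (allP star_size_initial).
by rewrite mem_iota.
Qed.

End Transitions.

(** * The reflections in the Lorentz space *)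

Section Lorentz.
Local Open Scope ring_scope.
Variable R : realType.

Definition phi : R := 2 * cos (pi / 5).
Definition sqrt_two : R := 2 * cos (pi / 4).

Lemma cos_double (x : R) : cos (x *+ 2) = 2 * cos x ^+ 2 - 1.
Proof. by rewrite mulr2n cosD; have := cos2Dsin2 x; lra. Qed.

Lemma cos_triple (x : R) : cos (x *+ 3) = 4 * cos x ^+ 3 - 3 * cos x.
Proof.
rewrite mulrS cosD cos_double mulr2n sinD.
transitivity (cos x * (2 * cos x ^+ 2 - 1) - 2 * cos x * (sin x ^+ 2)).
  by ring.
have -> : sin x ^+ 2 = 1 - cos x ^+ 2 by have := cos2Dsin2 x; lra.
by ring.
Qed.

Lemma cos_pi_div_gt0 (n : nat) : (2 < n)%N -> 0 < cos (pi / n%:R : R).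
Proof.
move=> n2; apply: cos_gt0_pihalf; have pi0 := pi_gt0 R.
have n0 : 0 < n%:R :> R by rewrite ltr0n (leq_trans _ n2).
apply/andP; split.
  by apply: (@lt_trans _ _ 0); rewrite ?oppr_lt0 divr_gt0.
by rewrite ltr_pM2l // ltf_pV2 ?posrE // ltr_nat.
Qed.

Lemma cos_pi3 : cos (pi / 3 : R) = 1 / 2.
Proof.
have c0 : 0 < cos (pi / 3 : R) := @cos_pi_div_gt0 3 isT.
have := cos_triple (pi / 3 : R).
have -> : (pi / 3 : R) *+ 3 = pi by rewrite -mulr_natr; field.
rewrite cospi; move: (cos _) c0 => c c0 c3.
have : (c + 1) * (2 * c - 1) ^+ 2 = 0.
  by transitivity (4 * c ^+ 3 - 3 * c + 1); [ring|rewrite -c3; ring].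
move/eqP; rewrite mulf_eq0 sqrf_eq0 => /orP[]/eqP; lra.
Qed.

Lemma sqrt_two_sq : sqrt_two ^+ 2 = 2.
Proof.
have := cos_double (pi / 4 : R).
have -> : (pi / 4 : R) *+ 2 = pi / 2 by rewrite -mulr_natr; field.
by rewrite cos_pihalf /sqrt_two exprMn => c; lra.
Qed.

Lemma phi_gt0 : 0 < phi.
Proof. by rewrite mulr_gt0 // (@cos_pi_div_gt0 5). Qed.

Lemma phi_sq : phi ^+ 2 = phi + 1.
Proof.
have := phi_gt0; rewrite /phi.
(* The two angles add up to pi. Expanding both sides gives a cubic in the cosine with the spurious
   root -1. *)
have : cos ((pi / 5 : R) *+ 2) = - cos ((pi / 5 : R) *+ 3).
  rewrite -[cos (_ *+ 3)]cosN -cosDpi.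
  by congr cos; rewrite -[_ *+ 2]mulr_natr -[_ *+ 3]mulr_natr; field.
rewrite cos_double cos_triple; move: (cos _) => c c23 c0.
have : (c + 1) * ((2 * c) ^+ 2 - (2 * c + 1)) = 0.
  transitivity (4 * c ^+ 3 - 3 * c + (2 * c ^+ 2 - 1)); first by ring.
  by rewrite c23; ring.
by move/eqP; rewrite mulf_eq0 => /orP[]/eqP; lra.
Qed.

Lemma phi_ge1 : 1 <= phi.
Proof. have := phi_gt0; have := phi_sq; nra. Qed.

Definition ord5 (k : nat) : 'I_5 := inord k.

Lemma val_ord5 k : (k < 5)%N -> ord5 k = k :> nat.
Proof. exact: inordK. Qed.

Lemma sum5 (V : nmodType) (F : 'I_5 -> V) :
  \sum_i F i = F (ord5 0) + (F (ord5 1) + (F (ord5 2) + (F (ord5 3) + F (ord5 4)))).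
Proof.
rewrite !big_ord_recl big_ord0 addr0.
by do 4 (congr (_ + _); first by congr F; apply: val_inj; rewrite /= val_ord5);
  congr F; apply: val_inj; rewrite /= val_ord5.
Qed.

Definition gram_entry (i j : nat) : R :=
  if i == j then 1
  else if j == i.+1 then - nth 0 [:: sqrt_two / 2; 1 / 2; 1 / 2; phi / 2] i
  else if i == j.+1 then - nth 0 [:: sqrt_two / 2; 1 / 2; 1 / 2; phi / 2] j
  else 0.

Lemma cos_schlafli (i : nat) : (i < 4)%N ->
  cos (pi / (nth 0%N schlafli i)%:R) =
  nth 0 [:: sqrt_two / 2; 1 / 2; 1 / 2; phi / 2] i.
Proof.
by case: i => [|[|[|[|]]]] //= _; rewrite ?cos_pi3 // /sqrt_two /phi; field.
Qed.

Lemma gramE i j : (i < 5)%N -> (j < 5)%N ->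
  gram R (ord5 i) (ord5 j) = gram_entry i j.
Proof.
move=> i5 j5; rewrite mxE /gram_entry -val_eqE /= !val_ord5 //.
case: ifP => // _; case: eqP => [ji|_]; first by rewrite cos_schlafli // -ltnS -ji.
by case: eqP => // ij; rewrite cos_schlafli // -ltnS -ij.
Qed.

Lemma lorentzE (x y : 'rV[R]_5) : lorentz x y =
  x 0 (ord5 0) * y 0 (ord5 0) + x 0 (ord5 1) * y 0 (ord5 1) + x 0 (ord5 2) * y 0 (ord5 2)
  + x 0 (ord5 3) * y 0 (ord5 3) + x 0 (ord5 4) * y 0 (ord5 4)
  - sqrt_two / 2 * (x 0 (ord5 0) * y 0 (ord5 1) + x 0 (ord5 1) * y 0 (ord5 0))
  - 1 / 2 * (x 0 (ord5 1) * y 0 (ord5 2) + x 0 (ord5 2) * y 0 (ord5 1))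
  - 1 / 2 * (x 0 (ord5 2) * y 0 (ord5 3) + x 0 (ord5 3) * y 0 (ord5 2))
  - phi / 2 * (x 0 (ord5 3) * y 0 (ord5 4) + x 0 (ord5 4) * y 0 (ord5 3)).
Proof.
rewrite /lorentz mxE sum5 !mxE !sum5 !gramE // /gram_entry /=.
by ring.
Qed.

Lemma lorentzC (x y : 'rV[R]_5) : lorentz x y = lorentz y x.
Proof. by rewrite !lorentzE; ring. Qed.

Lemma lorentz_linear (a : R) (x y z : 'rV[R]_5) :
  lorentz (a *: x + y) z = a * lorentz x z + lorentz y z.
Proof. by rewrite /lorentz !mulmxDl -!scalemxAl !mxE. Qed.

Lemma lorentzBZl (a : R) (x y z : 'rV[R]_5) :
  lorentz (x - a *: y) z = lorentz x z - a * lorentz y z.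
Proof. by rewrite addrC -scaleNr lorentz_linear mulNr addrC. Qed.

Lemma lorentzBZr (a : R) (x y z : 'rV[R]_5) :
  lorentz x (y - a *: z) = lorentz x y - a * lorentz x z.
Proof. by rewrite lorentzC lorentzBZl !(lorentzC x). Qed.

Lemma lorentzZl (a : R) (x z : 'rV[R]_5) : lorentz (a *: x) z = a * lorentz x z.
Proof. by rewrite /lorentz -!scalemxAl mxE. Qed.

Lemma wallE i j : (i < 5)%N -> (j < 5)%N ->
  wall R (ord5 i) 0 (ord5 j) = (i == j)%:R.
Proof.
move=> i5 j5; rewrite mxE eqxx /= -val_eqE /= !val_ord5 //.
by rewrite eq_sym.
Qed.

Lemma row5P (x y : 'rV[R]_5) :
  (forall k, (k < 5)%N -> x 0 (ord5 k) = y 0 (ord5 k)) -> x = y.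
Proof.
move=> H; apply/rowP => j; have -> : j = ord5 j by rewrite /ord5 inord_val.
exact: H.
Qed.

(** For a kernel vector, the equations of the walls 0, 1, 2 and 4 express all coordinates through
    one of them, and wall 3 then says that phi - 1 annihilates it; phi = 1 contradicts [phi_sq]. *)
Lemma gram_unit : gram R \in unitmx.
Proof.
rewrite -row_free_unit -kermx_eq0; apply/eqP/row_matrixP => i; rewrite row0.
have : row i (kermx (gram R)) *m gram R = 0 by rewrite -row_mul mulmx_ker row0.
move: (row i _) => x x0.
have xw k : (k < 5)%N -> lorentz x (wall R (ord5 k)) = 0.
  by rewrite /lorentz x0 mul0mx mxE.
move: (xw 0%N isT) (xw 1%N isT) (xw 2%N isT) (xw 3%N isT) (xw 4%N isT).
rewrite !lorentzE !wallE //= {xw x0} => e0 e1 e2 e3 e4.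
have sq := sqrt_two_sq; have ph := phi_sq; have ph1 := phi_ge1.
have e0' : x 0 (ord5 0) = sqrt_two / 2 * x 0 (ord5 1) by lra.
have e4' : x 0 (ord5 4) = phi / 2 * x 0 (ord5 3) by lra.
have e12 : x 0 (ord5 1) = x 0 (ord5 2).
  have : sqrt_two / 2 * x 0 (ord5 0) = x 0 (ord5 1) / 2.
    by rewrite e0' mulrA -mulrA; transitivity (sqrt_two ^+ 2 / 4 * x 0 (ord5 1)); [field|rewrite sq; field].
  by lra.
have e13 : x 0 (ord5 1) = x 0 (ord5 3) by lra.
have e3' : 2 * x 0 (ord5 1) = phi ^+ 2 * x 0 (ord5 1).
  rewrite [RHS](_ : _ = 2 * (phi * x 0 (ord5 4))); first by lra.
  by rewrite e4' -e13; field.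
have x1 : x 0 (ord5 1) = 0.
  have : (phi - 1) * x 0 (ord5 1) = 0 by move: e3'; rewrite ph; lra.
  move/eqP; rewrite mulf_eq0 subr_eq0 => /orP[|]/eqP // p1.
  by move: ph; rewrite p1 expr1n; lra.
apply: row5P => -[|[|[|[|[|]]]]] // _; rewrite mxE.
- by rewrite e0' x1 mulr0.
- by [].
- by rewrite -e12.
- by rewrite -e13.
- by rewrite e4' -e13 x1 mulr0.
Qed.

Lemma base_vertex_wall k : (k < 5)%N ->
  lorentz (base_vertex R) (wall R (ord5 k)) = (k == 0)%:R.
Proof.
move=> k5; rewrite /lorentz /base_vertex /wall trmx_delta -row_mul.
rewrite mulVmx ?gram_unit // -colE !mxE -val_eqE /= val_ord5 //.
by rewrite eq_sym.
Qed.

(** * Reflections and isometries as matrices acting on rows *)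

Definition refl_mx (n : 'rV[R]_5) : 'M[R]_5 := 1%:M - 2 *: (gram R *m n^T *m n).

Lemma mul_refl_mx (x n : 'rV[R]_5) :
  x *m refl_mx n = x - (2 * lorentz x n) *: n.
Proof.
rewrite /refl_mx mulmxBr mulmx1 -scalemxAr !mulmxA -scalerA.
congr (_ - _ *: _).
by rewrite [x *m _ *m _]mx11_scalar mul_scalar_mx.
Qed.

Definition isometry (A : 'M[R]_5) : Prop :=
  forall x y, lorentz (x *m A) (y *m A) = lorentz x y.

Lemma eq_row_mul (A B : 'M[R]_5) :
  (forall x : 'rV[R]_5, x *m A = x *m B) -> A = B.
Proof. by move=> AB; apply/row_matrixP => i; rewrite !rowE AB. Qed.

Lemma isometry_mul (A B : 'M[R]_5) : isometry A -> isometry B -> isometry (A *m B).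
Proof. by move=> iA iB x y; rewrite !mulmxA iB iA. Qed.

Lemma isometry1 : isometry 1%:M.
Proof. by move=> x y; rewrite !mulmx1. Qed.

Lemma isometry_refl (n : 'rV[R]_5) : lorentz n n = 1 -> isometry (refl_mx n).
Proof.
move=> nn x y; rewrite !mul_refl_mx lorentzBZl !lorentzBZr nn (lorentzC n y).
by ring.
Qed.

Lemma refl_mxK (n : 'rV[R]_5) : lorentz n n = 1 -> refl_mx n *m refl_mx n = 1%:M.
Proof.
move=> nn; apply: eq_row_mul => x; rewrite mulmxA !mul_refl_mx lorentzBZl nn.
by rewrite mulmx1 -addrA -opprD -scalerDl; set a := (X in X *: _);
  rewrite (_ : a = 0) ?scale0r ?subr0 // /a; ring.
Qed.

Lemma refl_conj (A : 'M[R]_5) (n : 'rV[R]_5) : isometry A -> A *m refl_mx (n *m A) = refl_mx n *m A.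
Proof.
move=> iA; apply: eq_row_mul => x.
by rewrite !mulmxA !mul_refl_mx mulmxBl -scalemxAl iA.
Qed.

Definition wall_mx (i : 'I_5) : 'M[R]_5 := refl_mx (wall R i).

Lemma wall_norm i : lorentz (wall R i) (wall R i) = 1.
Proof.
have -> : i = ord5 i by rewrite /ord5 inord_val.
move: (nat_of_ord i) (ltn_ord i) => {}i.
by case: i => [|[|[|[|[|]]]]] // _; rewrite lorentzE !wallE //=; ring.
Qed.

Lemma wall_isometry i : isometry (wall_mx i).
Proof. exact/isometry_refl/wall_norm. Qed.

Lemma wall_mxK i : wall_mx i *m wall_mx i = 1%:M.
Proof. exact/refl_mxK/wall_norm. Qed.

Definition word_mx (w : seq 'I_5) : 'M[R]_5 :=
  foldl (fun A i => A *m wall_mx i) 1%:M w.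

Lemma foldl_wall (A : 'M[R]_5) w :
  foldl (fun A i => A *m wall_mx i) A w = A *m word_mx w.
Proof.
rewrite /word_mx; elim: w A => [|i w IH] A /=; first by rewrite mulmx1.
by rewrite IH [in RHS]IH mul1mx mulmxA.
Qed.

Lemma word_mx_cat w w' : word_mx (w ++ w') = word_mx w *m word_mx w'.
Proof. by rewrite {1}/word_mx foldl_cat foldl_wall. Qed.

Lemma word_mx_cons i w : word_mx (i :: w) = wall_mx i *m word_mx w.
Proof. by rewrite {1}/word_mx /= foldl_wall mul1mx. Qed.

Lemma word_mx_rcons w i : word_mx (rcons w i) = word_mx w *m wall_mx i.
Proof. by rewrite -cats1 word_mx_cat word_mx_cons mulmx1. Qed.

Lemma isometry_ofE w (x : 'rV[R]_5) : isometry_of w x = x *m word_mx w.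
Proof.
elim: w x => [|i w IH] x /=; first by rewrite mulmx1.
by rewrite IH word_mx_cons mulmxA mul_refl_mx.
Qed.

Lemma word_isometry w : isometry (word_mx w).
Proof.
elim/last_ind: w => [|w i IH]; first exact: isometry1.
by rewrite word_mx_rcons; apply: isometry_mul => //; apply: wall_isometry.
Qed.

Lemma word_mx_revK w : word_mx w *m word_mx (rev w) = 1%:M.
Proof.
elim/last_ind: w => [|w i IH]; first by rewrite mulmx1.
rewrite rev_rcons word_mx_rcons word_mx_cons -mulmxA (mulmxA (wall_mx i)).
by rewrite wall_mxK mul1mx.
Qed.

Lemma base_vertex_fixed (i : 'I_5) : (0 < i)%N ->
  base_vertex R *m wall_mx i = base_vertex R.
Proof.
move=> i0; rewrite mul_refl_mx.
have -> : i = ord5 i by rewrite /ord5 inord_val.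
by rewrite base_vertex_wall // gtn_eqF // mulr0 scale0r subr0.
Qed.

(** * From the table of roots to real normals *)

Definition of_zphi (x : zphi) : R := x.1%:~R + x.2%:~R * phi.

Lemma of_zphi_add x y : of_zphi (zphi_add x y) = of_zphi x + of_zphi y.
Proof. by rewrite /of_zphi /= !intrD; ring. Qed.

Lemma of_zphi_sub x y : of_zphi (zphi_sub x y) = of_zphi x - of_zphi y.
Proof. by rewrite /of_zphi /= !intrB; ring. Qed.

Lemma of_zphi_mul x y : of_zphi (zphi_mul x y) = of_zphi x * of_zphi y.
Proof.
rewrite /of_zphi /= !intrD !intrM; have ph := phi_sq.
by ring: ph.
Qed.

Lemma of_zphi_dbl x : of_zphi (zphi_dbl x) = 2 * of_zphi x.
Proof. by rewrite of_zphi_add; ring. Qed.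

Lemma of_zphi1 : of_zphi zphi1 = 1.
Proof. by rewrite /of_zphi mul0r addr0. Qed.

Lemma of_zphi_gen : of_zphi zphi_gen = phi.
Proof. by rewrite /of_zphi add0r mul1r. Qed.

Definition of_zphiE :=
  (of_zphi_dbl, of_zphi_sub, of_zphi_add, of_zphi_mul, of_zphi1, of_zphi_gen).

(* The factor [sqrt_two] makes all normals expressible over Z[phi]. *)
Definition root_vec (r : root) : 'rV[R]_5 :=
  let: (c1, c2, c3, c4) := r in
  \row_j nth 0 [:: 1; sqrt_two * of_zphi c1; sqrt_two * of_zphi c2;
                   sqrt_two * of_zphi c3; sqrt_two * of_zphi c4] j.

(** Every normal has e_0-coefficient 1 and the base vertex is orthogonal to the other walls, so it
    is equidistant from the 120 mirrors. *)
Lemma root_vec_base r : lorentz (base_vertex R) (root_vec r) = 1.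
Proof.
case: r => [[[c1 c2] c3] c4] /=.
set v := \row_j _.
have -> : v = 1 *: wall R (ord5 0) + (v 0 (ord5 1) *: wall R (ord5 1) +
   (v 0 (ord5 2) *: wall R (ord5 2) + (v 0 (ord5 3) *: wall R (ord5 3) +
   v 0 (ord5 4) *: wall R (ord5 4)))).
  apply: row5P => k k5; rewrite [in RHS]mxE [in RHS]mxE.
  move: k k5; case=> [|[|[|[|[|]]]]] // _;
  by rewrite ![in RHS]mxE -!val_eqE /= !val_ord5 //= mxE val_ord5 //=; ring.
rewrite lorentzC !lorentz_linear lorentzZl !(lorentzC _ (base_vertex R)).
by rewrite !base_vertex_wall //=; ring.
Qed.

Lemma lorentz_root_vec r r' :
  lorentz (root_vec r) (root_vec r') = of_zphi (root_gram r r').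
Proof.
case: r => [[[c1 c2] c3] c4]; case: r' => [[[d1 d2] d3] d4].
rewrite lorentzE !mxE !val_ord5 //= !of_zphiE.
have sq := sqrt_two_sq.
move: (of_zphi c1) (of_zphi c2) (of_zphi c3) (of_zphi c4) => {}c1 {}c2 {}c3 {}c4.
move: (of_zphi d1) (of_zphi d2) (of_zphi d3) (of_zphi d4) => {}d1 {}d2 {}d3 {}d4.
by field: sq.
Qed.

Lemma root_vec_refl (i : 'I_5) r : (0 < i)%N ->
  root_vec r *m wall_mx i = root_vec (root_refl i r).
Proof.
move=> i0; rewrite mul_refl_mx; have sq := sqrt_two_sq.
have -> : i = ord5 i by rewrite /ord5 inord_val.
rewrite val_ord5 //; move: (nat_of_ord i) i0 (ltn_ord i) => {}i.
case: r => [[[c1 c2] c3] c4]; case: i => [|[|[|[|[|]]]]] // _ _;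
  apply: row5P => -[|[|[|[|[|]]]]] // _;
  rewrite lorentzE !mxE -!val_eqE /= !val_ord5 //= ?of_zphiE; by field: sq.
Qed.

End Lorentz.

(** * The right-angled Coxeter group of the 600-cell *)

Section Generators.
Import mathcomp.boot.fintype mathcomp.boot.finset.
Local Open Scope ring_scope.
Variable R : realType.

Definition normal (s : 'I_120) : 'rV[R]_5 := root_vec R (rootn s).
Definition gen (s : 'I_120) : 'M[R]_5 := refl_mx (normal s).

Lemma base_vertex_normal s : lorentz (base_vertex R) (normal s) = 1.
Proof. exact: root_vec_base. Qed.

Lemma normal_wall_perm (i : 'I_5) s :
  (0 < i)%N -> normal (wall_perm i s) = normal s *m wall_mx R i.
Proof. by move=> i0; rewrite root_vec_refl // -rootn_wall_perm. Qed.

Lemma normal_act h s :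
  fixing_letters h -> normal (act h s) = normal s *m word_mx R (rev h).
Proof.
elim: h => [|i h IH] /=; first by rewrite mulmx1.
by case/andP=> i0 /IH {}IH; rewrite normal_wall_perm // IH rev_cons word_mx_rcons mulmxA.
Qed.

(** The integer inequalities imply g.1 + g.2 phi <= -1 because phi >= 1. Row 0 represents all rows,
    since symmetries move any generator to index 0. *)
Definition first_row_gram (t : nat) : bool :=
  let g := root_gram (rootn 0) (rootn t) in
  if t == 0%N then g == (1, 0) else
  if adjn 0 t then g == (0, 0) else (g.1 + g.2 <= -1) && (g.2 <= 0).

Lemma first_row_gramT (t : 'I_120) : first_row_gram t.
Proof. by apply: (all_ordP (P := first_row_gram)); vm_compute. Qed.

Lemma normal_transport s t : exists h (t' : 'I_120),
  [/\ t = act h t', s = act h ord0 &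
      lorentz (normal s) (normal t) =
      of_zphi R (root_gram (rootn 0) (rootn t'))].
Proof.
have [//|h hh h1] := @clique_initial [set s] 1 (clique1 s) (cards1 s).
have sE : s = act h ord0 by apply/esym/set1P; rewrite h1 mem_imset_act mem_initial.
exists h, (act (rev h) t); rewrite act_revK; split=> //.
rewrite sE -{1}[t](act_revK h) !(normal_act _ hh) word_isometry.
exact: lorentz_root_vec.
Qed.

Lemma normal_norm s : lorentz (normal s) (normal s) = 1.
Proof.
have [h [t [sE s0 ->]]] := normal_transport s s.
have <- : ord0 = t by apply/(@act_inj h); rewrite -s0.
by have /eqP -> := first_row_gramT ord0; rewrite /of_zphi mul0r addr0.
Qed.

Lemma normal_adj s t : adj s t -> lorentz (normal s) (normal t) = 0.
Proof.
have [h [u [-> -> ->]]] := normal_transport s t; rewrite adj_act => u0.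
have := first_row_gramT u; rewrite /first_row_gram -[adjn _ _]/(adj ord0 u) u0.
case: eqP => [u0'|_ /eqP ->]; last by rewrite /of_zphi !mul0r addr0.
by move: u0; rewrite (_ : u = ord0) ?adj_irr //; apply: val_inj.
Qed.

Lemma normal_far s t :
  s != t -> ~~ adj s t -> lorentz (normal s) (normal t) <= -1.
Proof.
have [h [u [-> -> ->]]] := normal_transport s t; rewrite adj_act => st u0.
have := first_row_gramT u.
rewrite /first_row_gram -[adjn _ _]/(adj ord0 u) (negbTE u0).
case: eqP => [u0'|_ /andP[]].
  by move: st; rewrite (_ : u = ord0) ?eqxx //; apply: val_inj.
case: root_gram => a c /=; rewrite /of_zphi /=.
move=> ac c0.
have {}ac : a%:~R + c%:~R <= -1 :> R by rewrite -intrD -(intrN _ 1) ler_int.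
have {}c0 : c%:~R <= 0 :> R by rewrite -(ler_int R) in c0.
have := phi_ge1 R; move: ac c0.
by move: (a%:~R) (c%:~R : R) => {}a {}c; nra.
Qed.

Lemma gen_isometry s : isometry (gen s).
Proof. exact/isometry_refl/normal_norm. Qed.

Lemma genK s : gen s *m gen s = 1%:M.
Proof. exact/refl_mxK/normal_norm. Qed.

Lemma gen_wall_perm (i : 'I_5) s :
  (0 < i)%N -> wall_mx R i *m gen (wall_perm i s) = gen s *m wall_mx R i.
Proof.
by move=> i0; rewrite /gen normal_wall_perm // refl_conj //; apply: wall_isometry.
Qed.

Lemma mul_normal_gen s t :
  normal t *m gen s = normal t - (2 * lorentz (normal t) (normal s)) *: normal s.
Proof. exact: mul_refl_mx. Qed.

Lemma gen_adjC s t : adj s t -> gen s *m gen t = gen t *m gen s.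
Proof.
move=> st; have := refl_conj (normal s) (gen_isometry t).
by rewrite mul_normal_gen normal_adj // mulr0 scale0r subr0 => ->.
Qed.

(** The head of a word is its last step. Multiplying by [gen s] on the left means stepping in
    direction [s] of the frame carried along, so labels always name directions seen from the current
    vertex. *)
Definition mat (G : 'M[R]_5) (p : seq 'I_120) : 'M[R]_5 :=
  foldr (fun s A => gen s *m A) G p.

Lemma mat_cons G s p : mat G (s :: p) = gen s *m mat G p.
Proof. by []. Qed.

Lemma mat_cat G p q : mat G (p ++ q) = mat 1%:M p *m mat G q.
Proof. by elim: p => /= [|s p ->]; rewrite ?mul1mx ?mulmxA. Qed.

Lemma matE G p : mat G p = mat 1%:M p *m G.
Proof. by rewrite -[p in LHS]cats0 mat_cat. Qed.

Lemma mat_revK p : mat 1%:M p *m mat 1%:M (rev p) = 1%:M.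
Proof.
elim: p => [|s p IH]; first by rewrite mulmx1.
rewrite rev_cons -cats1 mat_cat /= mulmx1 !mulmxA -(mulmxA (gen s)) IH.
by rewrite mulmx1 genK.
Qed.

(** For a reduced word: the letters that commutations can bring to the head. *)
Fixpoint descents (p : seq 'I_120) : {set 'I_120} :=
  if p is s :: p' then s |: (descents p' :&: neighbors s) else set0.

Definition remaining (J : {set 'I_120}) (p : seq 'I_120) : {set 'I_120} :=
  [set s in J | s \notin p].

(* For [J = set0] the admissible words are the reduced words of the right-angled
   Coxeter group, read from right to left. *)
Fixpoint admissible (J : {set 'I_120}) (p : seq 'I_120) : bool :=
  if p is s :: p' then
    [&& s \notin descents p', enabled (remaining J p') s & admissible J p']
  else true.

Definition reduced := admissible set0.

Lemma enabled0 s : enabled set0 s.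
Proof. by apply/enabledP => j; rewrite inE. Qed.

Lemma remaining0 p : remaining set0 p = set0.
Proof. by apply/setP => s; rewrite !inE. Qed.

Lemma reduced_cons s p : reduced (s :: p) = (s \notin descents p) && reduced p.
Proof. by rewrite /reduced /= remaining0 enabled0. Qed.

Lemma admissible_reduced J p : admissible J p -> reduced p.
Proof. by elim: p => // s p IH; rewrite reduced_cons /= => /and3P[-> _ /IH]. Qed.

Lemma head_descent s p : s \in descents (s :: p).
Proof. by rewrite /= !inE eqxx. Qed.

Lemma descents_sub p : {subset descents p <= p}.
Proof.
elim: p => [|s p IH] t; first by rewrite inE.
by rewrite !inE => /predU1P[->|/andP[/IH ->]]; rewrite ?eqxx ?orbT.
Qed.

Section Signs.
Variable G : 'M[R]_5.
Hypothesis isoG : isometry G.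

(* Positive if [V0] and the vertex of [A] lie on the same side of the mirror
   between this vertex and its neighbour [s]. *)
Definition side (s : 'I_120) (A : 'M[R]_5) : R :=
  lorentz (base_vertex R *m G) (normal s *m A).

Lemma side_gen s t A : side t (gen s *m A) =
  side t A - 2 * lorentz (normal t) (normal s) * side s A.
Proof.
by rewrite /side mulmxA mul_normal_gen mulmxBl -scalemxAl lorentzBZr.
Qed.

Lemma sideG s : side s G = 1.
Proof. by rewrite /side isoG base_vertex_normal. Qed.

Lemma side_gen_same s A : side s (gen s *m A) = - side s A.
Proof. by rewrite side_gen normal_norm; ring. Qed.

Lemma side_gen_adj s t A : adj s t -> side t (gen s *m A) = side t A.
Proof. by move=> st; rewrite side_gen normal_adj 1?adjC //; ring. Qed.

(* The last clause carries the induction: after a step through [s], a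
   non-adjacent [t] satisfies side t > side t + side s > 0. *)
Definition signs (p : seq 'I_120) : Prop :=
  [/\ forall s, s \in descents p -> side s (mat G p) < 0,
      forall s, s \notin descents p -> 0 < side s (mat G p) &
      forall s t, s != t -> ~~ adj s t ->
        0 < side s (mat G p) + side t (mat G p)].

(** A step through [s] negates the side of [s], keeps the sides of its neighbours and raises every
    other side by at least twice the positive side of [s]. *)
Lemma reduced_signs p : reduced p -> signs p.
Proof.
elim: p => [|s p IH].
  by split=> [u|u _|u v _ _]; rewrite ?inE // ?sideG //=; rewrite ?ltr01.
rewrite reduced_cons => /andP[sp /IH[neg pos pair]].
have s0 := pos _ sp.
have far t : t != s -> ~~ adj t s ->
    side t (mat G p) + 2 * side s (mat G p) <= side t (mat G (s :: p)).
  move=> ts nts; rewrite mat_cons side_gen; have := normal_far ts nts.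
  by move: s0; move: (lorentz _ _) (side _ _) (side _ _) => a u v; nra.
have near t : adj t s -> side t (mat G (s :: p)) = side t (mat G p).
  by move=> ts; rewrite mat_cons side_gen_adj 1?adjC.
have same : side s (mat G (s :: p)) = - side s (mat G p).
  by rewrite mat_cons side_gen_same.
split=> [t|t|t u tu ntu].
- rewrite !inE => /predU1P[->|/andP[/neg tp st]]; first by rewrite same oppr_lt0.
  by rewrite near // adjC.
- rewrite !inE negb_or negb_and => /andP[ts tp].
  case: (boolP (adj t s)) => tas.
    by rewrite near // pos //; rewrite adjC tas orbF in tp.
  have := pair _ _ ts tas; have := far _ ts tas; lra.
- have [ts|ts] := eqVneq t s.
    have us : u != s by rewrite eq_sym -ts.
    have nus : ~~ adj u s by rewrite -ts adjC.
    have := pair _ _ us nus; have := far _ us nus; rewrite ts same; lra.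
  have [us|us] := eqVneq u s.
    rewrite us in ntu tu *; have := pair _ _ ts ntu; have := far _ ts ntu.
    by rewrite same; lra.
  have [tas|tas] := boolP (adj t s); have [uas|uas] := boolP (adj u s).
  + by rewrite !near // pair.
  + have := pair _ _ tu ntu; have := far _ us uas; rewrite (near t) //; lra.
  + have := pair _ _ tu ntu; have := far _ ts tas; rewrite (near u) //; lra.
  + have := pair _ _ tu ntu; have := far _ us uas; have := far _ ts tas; lra.
Qed.

(** The right-hand side involves only the matrix, which makes descents independent of the reduced
    word. *)
Lemma descents_side p s : reduced p -> (s \in descents p) = (side s (mat G p) < 0).
Proof.
move=> /reduced_signs[neg pos _].
by case: (boolP (s \in _)) => [/neg|/pos]; [move->|move/ltW; rewrite leNgt => /negbTE].
Qed.

Lemma descents_eq p q : reduced p -> reduced q -> mat G p = mat G q ->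
  descents p = descents q.
Proof.
by move=> rp rq pq; apply/setP => s; rewrite !descents_side // pq.
Qed.

End Signs.

(** * Reduced and admissible words of one element *)

Lemma remaining_cons J s p : remaining J (s :: p) = remaining J p :\ s.
Proof. by apply/setP => t; rewrite !inE negb_or andbCA. Qed.

Lemma remaining_perm J p q : perm_eq p q -> remaining J p = remaining J q.
Proof. by move=> pq; apply/setP => s; rewrite !inE (perm_mem pq). Qed.

Lemma enabled_sub (J J' : {set 'I_120}) s : J' \subset J -> enabled J s -> enabled J' s.
Proof. by move=> /subsetP JJ' /enabledP H; apply/enabledP => j /JJ'; apply: H. Qed.

Lemma enabled_D1 (J : {set 'I_120}) s t : adj s t -> enabled (J :\ s) t -> enabled J t.
Proof.
move=> st /enabledP H; apply/enabledP => j jJ jt; have [->//|js] := eqVneq j s.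
by apply: H; rewrite // !inE js.
Qed.

(** The descent [d] is adjacent to all letters ahead of it and commutes past them. Admissibility
    survives: returning [d] to the remaining set does not restrict a letter adjacent to [d]. *)
Lemma exchange J p d : admissible J p -> d \in descents p ->
  exists q, [/\ admissible J (d :: q), perm_eq (d :: q) p &
               mat 1%:M (d :: q) = mat 1%:M p].
Proof.
elim: p d => [|t p IH] d; first by rewrite inE.
rewrite [admissible _ _]/= => /and3P[tp et ap].
have [-> _|dt] := eqVneq d t; first by exists p; rewrite /= tp et ap.
rewrite !inE (negbTE dt) => /andP[dp td].
have [q [/= /and3P[dq ed aq] pq mq]] := IH d ap dp.
have rp := admissible_reduced ap; have rq := admissible_reduced aq.
(* [d :: q] is another reduced word of the same element. *)
have dE : descents p = d |: (descents q :&: neighbors d).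
  apply: (descents_eq (@isometry1 R) (q := d :: q)) => //.
  by rewrite reduced_cons dq.
have tq : t \notin descents q.
  by apply: contra tp => tq; rewrite dE !inE tq adjC td orbT.
exists (t :: q); split.
- rewrite /= !inE negb_or dt negb_and dq /= tq aq andbT; apply/andP; split.
    by rewrite remaining_cons (enabled_sub _ ed) ?subsetDl.
  have dt' : adj d t by rewrite adjC.
  by apply: (enabled_D1 dt'); rewrite -remaining_cons (remaining_perm J pq).
- rewrite (perm_trans (y := [:: t, d & q])) ?perm_cons //.
  by rewrite -[[:: d, t & q]]/([:: d] ++ [:: t] ++ q) perm_catCA.
- by rewrite /= mulmxA -(gen_adjC td) -mulmxA mq.
Qed.

Lemma mat_eqG G p q : mat 1%:M p = mat 1%:M q -> mat G p = mat G q.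
Proof. by rewrite !(matE G) => ->. Qed.

Lemma mat_gen_inj G s p q : mat G (s :: p) = mat G (s :: q) -> mat G p = mat G q.
Proof.
by move/(congr1 (mulmx (gen s))); rewrite !mat_cons !mulmxA genK !mul1mx.
Qed.

(** The head of one word is a descent of the other and can be exchanged to its head. Hence length
    and remaining generators are invariants of the vertex. *)
Lemma admissible_perm J G p q : isometry G -> admissible J p -> admissible J q ->
  mat G p = mat G q -> perm_eq p q.
Proof.
move=> iG; elim: p q => [|s p IH] q ap aq pq.
  case: q aq pq => // s q /admissible_reduced rq sq.
  have := descents_side iG s rq; rewrite -sq sideG // head_descent.
  by rewrite ltNge ler01.
have sq : s \in descents q.
  rewrite -(descents_eq iG (admissible_reduced ap) (admissible_reduced aq) pq).
  exact: head_descent.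
have [r [asr prq /(mat_eqG G) mrq]] := exchange aq sq.
apply: perm_trans prq; rewrite perm_cons; apply: IH.
- by case/and3P: ap.
- by case/and3P: asr.
- by apply: (mat_gen_inj (s := s)); rewrite pq mrq.
Qed.

Lemma reduce_word p : exists q, [/\ reduced q, mat 1%:M q = mat 1%:M p,
  {subset q <= p} & (size q <= size p)%N].
Proof.
elim: p => [|s p [q [rq mq sq szq]]]; first by exists [::].
have [sd|sd] := boolP (s \in descents q); last first.
  exists (s :: q); split; rewrite ?reduced_cons ?sd ?mat_cons ?mq //.
  by move=> t; rewrite !inE => /predU1P[->|/sq ->]; rewrite ?eqxx ?orbT.
have [r [asr prq mrq]] := exchange rq sd; exists r; split.
- by move: asr; rewrite -/reduced => /admissible_reduced; rewrite reduced_cons => /andP[].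
- by rewrite mat_cons -mq -mrq mat_cons mulmxA genK mul1mx.
- move=> t tr; rewrite inE; apply/orP; right; apply: sq.
  by rewrite -(perm_mem prq) inE tr orbT.
- have /= sz := perm_size prq; apply: (@leq_trans (size q)).
    by rewrite -sz leqnSn.
  exact: leqW.
Qed.

Definition vertex_of (G : 'M[R]_5) (p : seq 'I_120) : 'rV[R]_5 :=
  base_vertex R *m mat G p.

Lemma isometry_unit (G : 'M[R]_5) : isometry G -> G \in unitmx.
Proof.
move=> iG; rewrite -row_free_unit -kermx_eq0; apply/eqP/row_matrixP => i.
rewrite row0; set x := row i _.
have xG : x *m G = 0 by rewrite -row_mul mulmx_ker row0.
have xg : x *m gram R = 0.
  apply/rowP => j; rewrite [RHS]mxE.
  have := iG x (wall R j); rewrite xG /lorentz mul0mx mul0mx mxE.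
  by rewrite /wall trmx_delta -colE mxE => <-.
by rewrite -[x](mulmxK (gram_unit R)) xg mul0mx.
Qed.

(** An element fixing the base vertex has all sides equal to 1, whereas a nonempty reduced word has
    a negative side at its head; so the stabiliser is trivial. *)
Lemma vertex_inj (G : 'M[R]_5) p q : isometry G -> vertex_of G p = vertex_of G q ->
  mat 1%:M p = mat 1%:M q.
Proof.
move=> iG; rewrite /vertex_of !(matE G) !mulmxA.
move/(congr1 (mulmxr (invmx G))); rewrite /= !mulmxK ?isometry_unit //.
move/(congr1 (mulmxr (mat 1%:M (rev q)))) => /=.
rewrite -!mulmxA mat_revK mulmx1 -mat_cat.
have [r [rr mr _ _]] := reduce_word (p ++ rev q).
rewrite -mr => br; case: r rr mr br => [_ mr _|s r rr _ br].
  have : mat 1%:M (p ++ rev q) *m mat 1%:M q = mat 1%:M q.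
    by rewrite -mr mul1mx.
  rewrite mat_cat -mulmxA -{2}[q]revK mat_revK mulmx1.
  by [].
have := descents_side (@isometry1 R) s rr; rewrite head_descent /side mulmx1.
rewrite -{1}br.
have iso_mat p' : isometry (mat 1%:M p').
  elim: p' => [|t p' IH]; first exact: isometry1.
  by apply: isometry_mul => //; apply: gen_isometry.
by rewrite iso_mat base_vertex_normal ltNge ler01.
Qed.

End Generators.

(** * Faces of the mosaic as cosets *)

Section Faces.
Import mathcomp.boot.fintype mathcomp.boot.finset.
Local Open Scope ring_scope.
Variable R : realType.
Local Notation mat := (@mat R).
Local Notation mat1 := (mat 1%:M).
Local Notation b := (base_vertex R).

Definition letters_below (k : nat) (t : seq 'I_5) := all (fun i : 'I_5 => i < k)%N t.

Lemma mat_wall q (i : 'I_5) : (0 < i)%N ->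
  mat1 q *m wall_mx R i = wall_mx R i *m mat1 (map (wall_perm i) q).
Proof.
move=> i0; elim: q => [|s q IH] /=; first by rewrite mul1mx mulmx1.
by rewrite -mulmxA IH !mulmxA gen_wall_perm.
Qed.

Lemma mat_word_mx q h : fixing_letters h ->
  mat1 q *m word_mx R h = word_mx R h *m mat1 (map (act (rev h)) q).
Proof.
elim: h q => [|i h IH] q /=; first by rewrite mul1mx mulmx1 map_id.
case/andP=> i0 hh; rewrite word_mx_cons mulmxA mat_wall // -!mulmxA IH //.
congr (_ *m (_ *m mat1 _)); rewrite -map_comp; apply: eq_map => s /=.
by rewrite rev_cons -cats1 act_cat.
Qed.

Lemma base_word_mx h : fixing_letters h -> b *m word_mx R h = b.
Proof.
elim: h => [|i h IH] /=; first by rewrite mulmx1.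
by case/andP=> i0 /IH hh; rewrite word_mx_cons mulmxA base_vertex_fixed.
Qed.

Lemma word_mx_Krev w : word_mx R (rev w) *m word_mx R w = 1%:M.
Proof. by rewrite -{2}[w]revK word_mx_revK. Qed.

Lemma gen0 : gen R ord0 = wall_mx R ord0.
Proof.
rewrite /gen /wall_mx; congr refl_mx; apply: row5P => k k5.
rewrite -[ord0 : 'I_5](_ : ord5 0 = _); last by apply: val_inj; rewrite /= val_ord5.
rewrite wallE // mxE val_ord5 //.
by move: k k5 => [|[|[|[|[|]]]]] //= _; rewrite /of_zphi ?mul0r ?addr0 ?mulr0.
Qed.

Lemma mat_rcons q s : mat1 (rcons q s) = mat1 q *m gen R s.
Proof. by rewrite -cats1 mat_cat /= mulmx1. Qed.

(** The walls through the base vertex permute the generators by conjugation, so they can be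
    collected on the left; each letter 0 leaves the generator [gen R ord0]. *)
Lemma word_split (k : nat) (A : {set 'I_120}) t :
  letters_below k t -> ord0 \in A ->
  (forall (i : 'I_5) s, (0 < i < k)%N -> s \in A -> wall_perm i s \in A) ->
  exists h q, [/\ fixing_letters h, {subset q <= A} &
                  word_mx R t = word_mx R h *m mat1 q].
Proof.
move=> tk A0 Aref; elim/last_ind: t tk => [_|t i IH].
  by exists [::], [::]; split=> //; rewrite mulmx1.
rewrite /letters_below all_rcons => /andP[ik /IH[h [q [hh qA tE]]]].
rewrite word_mx_rcons tE; have [i0|i0] := posnP i.
  have -> : i = ord0 by apply: val_inj.
  exists h, (rcons q ord0); split=> //; last by rewrite mat_rcons mulmxA gen0.
  by move=> s; rewrite mem_rcons inE => /predU1P[->|/qA].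
exists (rcons h i), (map (wall_perm i) q); split.
- by rewrite /fixing_letters all_rcons i0.
- by move=> _ /mapP[s /qA sA ->]; apply: Aref; rewrite ?i0.
- by rewrite word_mx_rcons -mulmxA mat_wall // mulmxA.
Qed.

(** On the standard simplex, wall i acts as the transposition of the indices i - 1 and i. *)
Lemma initial_wall_perm (k : nat) (i : 'I_5) s : (k <= 4)%N -> (0 < i < k)%N ->
  s \in initial k -> wall_perm i s \in initial k.
Proof.
move=> k4 /andP[i0 ik]; rewrite !mem_initial val_wall_perm => sk.
have check : all (fun i => all (fun k => all (fun s =>
    [&& 0 < i, i < k & s < k]%N ==> (wall_perm_nat i s < k)%N)
    (iota 0 4)) (iota 0 5)) (iota 0 4) by vm_compute.
have i4 : (i < 4)%N by apply: leq_trans ik k4.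
have s4 : (s < 4)%N by apply: leq_trans sk k4.
have := all_ord2P check (Ordinal i4) (Ordinal (k4 : (k < 5)%N)).
by move/all_ordP/(_ (Ordinal s4)); rewrite /= i0 ik sk.
Qed.

Lemma gen_word_initial k (s : 'I_120) : (k <= 4)%N -> s \in initial k ->
  exists2 t, letters_below k t & word_mx R t = gen R s.
Proof.
move=> k4; rewrite mem_initial => sk.
suff H n (u : 'I_120) : val u = n -> (n < k)%N ->
    exists2 t, letters_below k t & word_mx R t = gen R u by exact: (H (val s)).
elim: n u => [|n IH] {sk}s sE sk.
  exists [:: ord0]; first by rewrite /letters_below /= andbT.
  rewrite word_mx_cons mulmx1 -gen0; congr gen; exact: val_inj.
have n120 : (n < 120)%N by apply: ltn_trans (ltn_ord s); rewrite sE.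
have [t tk tE] := IH (Ordinal n120) erefl (ltnW sk).
have n5 : (n.+1 < 5)%N by apply: leq_trans (leqW k4).
pose i : 'I_5 := Ordinal n5.
(* By the numbering of the orbit, wall n + 1 carries index n to n + 1, so the new generator is a
   conjugate of the previous one. *)
have si : s = wall_perm i (Ordinal n120).
  apply: val_inj; rewrite /= val_wall_perm sE /=.
  have : (n < 3)%N by have := leq_trans sk k4; rewrite ltnS.
  by case: (n) => [|[|[|]]].
exists (i :: rcons t i).
  by rewrite /letters_below /= all_rcons sk.
rewrite word_mx_cons word_mx_rcons tE si -(@gen_wall_perm R i (Ordinal n120)) //.
by rewrite mulmxA wall_mxK mul1mx.
Qed.

Lemma gen_word (s : 'I_120) : exists t, word_mx R t = gen R s.
Proof.
have [//|h hh h1] := @clique_initial [set s] 1 (clique1 s) (cards1 s).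
have -> : s = act h ord0 by apply/esym/set1P; rewrite h1 mem_imset_act mem_initial.
exists (h ++ ord0 :: rev h); rewrite word_mx_cat word_mx_cons -gen0.
rewrite /gen normal_act // -refl_conj; last exact: word_isometry.
by rewrite mulmxA word_mx_revK mul1mx.
Qed.

Lemma mat_word_initial k q : (k <= 4)%N -> {subset q <= initial k} ->
  exists2 t, letters_below k t & word_mx R t = mat1 q.
Proof.
move=> k4; elim: q => [|s q IH] qk; first by exists [::].
have [|t tk tE] := IH; first by move=> u uq; apply: qk; rewrite inE uq orbT.
have [|t' tk' tE'] := @gen_word_initial k s k4; first by apply: qk; rewrite mem_head.
exists (t' ++ t); first by rewrite /letters_below all_cat; apply/andP.
by rewrite word_mx_cat tE tE'.
Qed.

Lemma mat_word q : exists t, word_mx R t = mat1 q.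
Proof.
elim: q => [|s q [t tE]]; first by exists [::].
by have [t' tE'] := gen_word s; exists (t' ++ t); rewrite word_mx_cat tE tE'.
Qed.

Lemma initial_orbit k (v : 'rV[R]_5) : (0 < k <= 4)%N ->
  (exists2 t, letters_below k t & v = b *m word_mx R t) <->
  (exists2 q, {subset q <= initial k} & v = b *m mat1 q).
Proof.
case/andP=> k0 k4; split=> [[t tk ->]|[q qk ->]].
  have [||h [q [hh qk ->]]] := @word_split k (initial k) t tk.
  - by rewrite mem_initial.
  - by move=> i s ik; apply: initial_wall_perm.
  by exists q; rewrite // mulmxA base_word_mx.
by have [t tk <-] := mat_word_initial k4 qk; exists t.
Qed.

Lemma faceP k (F : set 'rV[R]_5) : face k F <-> exists w, forall v,
  F v <-> exists2 t, letters_below k t & v = b *m word_mx R t *m word_mx R w.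
Proof.
split=> [[w ->]|[w Fw]]; exists w.
  move=> v; split=> [[t tk <-]|[t tk ->]]; exists t => //;
  by rewrite !isometry_ofE.
apply/seteqP; split=> [v /Fw[t tk ->]|v [t tk <-]]; last first.
  by apply/Fw; exists t; rewrite ?isometry_ofE.
by exists t; rewrite ?isometry_ofE.
Qed.

(** * Cells as cosets relative to a frame *)

Section Cells.
Variable g : seq 'I_5.
Let G : 'M[R]_5 := word_mx R g.
Local Notation vertex := (vertex_of G).
Let isoG : isometry G := word_isometry g.

Definition cell (p : seq 'I_120) (A : {set 'I_120}) : set 'rV[R]_5 :=
  fun v => exists2 q, {subset q <= A} & v = vertex (q ++ p).

Lemma vertex_eq p q : vertex p = vertex q <-> mat1 p = mat1 q.
Proof.
split; first exact: vertex_inj.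
by move=> pq; rewrite /vertex_of (matE _ p) pq -matE.
Qed.

(** A symmetry fixing the base vertex makes the clique standard; it is split off from the word of
    the face in one direction and absorbed into it in the other. *)
Lemma face_cell k F : (0 < k <= 4)%N ->
  face k F <-> exists p A, [/\ clique A, #|A| = k & F = cell p A].
Proof.
move=> k14; have /andP[k0 k4] := k14; rewrite faceP; split.
  move=> [w Fw].
  (* The bound 5 admits all walls. Appending [rev g] expresses the face relative to the frame
     [G]. *)
  have [|||h [p [hh _ wE]]] := @word_split 5 setT (w ++ rev g).
  - by apply/allP => i _; apply: ltn_ord.
  - by rewrite inE.
  - by move=> i s _ _; rewrite inE.
  have {}wE : word_mx R w = word_mx R h *m mat G p.
    rewrite matE mulmxA -wE word_mx_cat -mulmxA word_mx_Krev mulmx1.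
    by [].
  exists p, (act (rev h) @: initial k); split.
  - by rewrite clique_act initial_clique.
  - rewrite card_imset; last exact: act_inj.
    by rewrite card_initial // (leq_trans k4).
  apply/seteqP; split=> v.
    move=> /Fw[t tk ->].
    have /(initial_orbit _ k14)[q qk ->] :
      exists2 t', letters_below k t' & b *m word_mx R t = b *m word_mx R t'.
      by exists t.
    exists (map (act (rev h)) q).
      by move=> _ /mapP[s /qk sk ->]; rewrite mem_imset_act.
    rewrite /vertex_of mat_cat wE !mulmxA; congr (_ *m _).
    by rewrite -(mulmxA b) mat_word_mx // mulmxA base_word_mx.
  case=> q qA ->; apply/Fw.
  pose q' := map (act h) q.
  have qE : q = map (act (rev h)) q'.
    by rewrite -map_comp -[LHS]map_id; apply: eq_map => s /=; rewrite actK.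
  have q'k : {subset q' <= initial k}.
    move=> _ /mapP[s /qA sA ->]; rewrite -(mem_imset_act (rev h)).
    by rewrite actK.
  have /(initial_orbit _ k14)[t tk tE] :
    exists2 q, {subset q <= initial k} & b *m mat1 q' = b *m mat1 q by exists q'.
  exists t; rewrite // -tE wE /vertex_of mat_cat !mulmxA; congr (_ *m _).
  by rewrite -(mulmxA b) mat_word_mx // mulmxA base_word_mx // -qE.
move=> [p [A [cA kA ->]]].
have [h hh hA] := clique_initial cA kA k4.
have hr : fixing_letters (rev h) by rewrite /fixing_letters all_rev.
have [t tE] := mat_word p.
exists (rev h ++ t ++ g) => v; rewrite !word_mx_cat tE.
have conj q : b *m mat1 q *m (word_mx R (rev h) *m (mat1 p *m word_mx R g)) =
    vertex (map (act h) q ++ p).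
  rewrite /vertex_of mat_cat (matE G p) !mulmxA -(mulmxA b) mat_word_mx // revK.
  by rewrite !mulmxA base_word_mx.
split=> [[q qA ->]|[u uk ->]].
  pose q' := map (act (rev h)) q.
  have q'k : {subset q' <= initial k}.
    move=> _ /mapP[s /qA sA ->]; rewrite -(mem_imset_act h) act_revK.
    by rewrite -hA.
  have /(initial_orbit _ k14)[u uk uE] :
    exists2 q, {subset q <= initial k} & b *m mat1 q' = b *m mat1 q by exists q'.
  exists u; rewrite // -uE conj -map_comp; congr (vertex (_ ++ p)).
  by rewrite -[LHS]map_id; apply: eq_map => s /=; rewrite act_revK.
have /(initial_orbit _ k14)[q qk ->] :
  exists2 t', letters_below k t' & b *m word_mx R u = b *m word_mx R t'.
  by exists u.
exists (map (act h) q); rewrite ?conj //.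
by move=> _ /mapP[s /qk sk ->]; rewrite hA mem_imset_act.
Qed.

Lemma cell_mem p A : cell p A (vertex p).
Proof. by exists [::]. Qed.

Lemma cell_eq p p' A : mat1 p = mat1 p' -> cell p A = cell p' A.
Proof.
move=> pp'; apply/seteqP; split=> v [q qA ->]; exists q => //;
  by apply/vertex_eq; rewrite !mat_cat pp'.
Qed.

Lemma cell_move p q (A : {set 'I_120}) : {subset q <= A} -> cell (q ++ p) A = cell p A.
Proof.
move=> qA; apply/seteqP; split=> v [r rA ->].
  exists (r ++ q); last by rewrite catA.
  by move=> s; rewrite mem_cat => /orP[/rA|/qA].
exists (r ++ rev q).
  by move=> s; rewrite mem_cat mem_rev => /orP[/rA|/qA].
apply/vertex_eq; rewrite catA -(catA r) !mat_cat -!mulmxA; congr (_ *m _).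
by rewrite mulmxA -{2}[q]revK mat_revK mul1mx.
Qed.

(** Reducing [q] yields a word over [A] with the same descents as the one-letter word [s], so [s]
    occurs in it. *)
Lemma cell_gen p (s : 'I_120) (A : {set 'I_120}) : cell p A (vertex (s :: p)) -> s \in A.
Proof.
case=> q qA /vertex_eq; rewrite -cat1s !mat_cat.
move/(congr1 (mulmxr (mat1 (rev p)))); rewrite /= -!mulmxA mat_revK !mulmx1 => sq.
have [r [rr mr rq _]] := reduce_word R q.
have rs : reduced [:: s] by rewrite reduced_cons inE.
have := descents_eq (@isometry1 R) rs rr; rewrite mr -sq => /(_ (mulmx1 _)) ds.
by apply/qA/rq/descents_sub; rewrite -ds head_descent.
Qed.

Lemma cell_gen_mem p (s : 'I_120) (A : {set 'I_120}) : s \in A -> cell p A (vertex (s :: p)).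
Proof. by move=> sA; exists [:: s] => // t; rewrite inE => /eqP ->. Qed.

Lemma cell_inj p (A B : {set 'I_120}) : cell p A = cell p B -> A = B.
Proof.
move=> AB; apply/setP => s; apply/idP/idP => sA; apply: (cell_gen (p := p)).
  by rewrite -AB; apply: cell_gen_mem.
by rewrite AB; apply: cell_gen_mem.
Qed.

Lemma mat1_cons2 s p : mat1 (s :: s :: p) = mat1 p.
Proof. by rewrite !mat_cons mulmxA genK mul1mx. Qed.

Lemma vertex_neq s p : vertex (s :: p) <> vertex p.
Proof.
move/vertex_eq; rewrite -cat1s mat_cat /= mulmx1.
move/(congr1 (mulmxr (mat1 (rev p)))); rewrite /= -mulmxA mat_revK mulmx1 => s1.
have := mul_normal_gen R s s; rewrite s1 mulmx1 normal_norm => ns.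
have := base_vertex_normal R s; rewrite ns lorentzBZr base_vertex_normal; lra.
Qed.

Lemma cell1 p s v : cell p [set s] v <-> v = vertex p \/ v = vertex (s :: p).
Proof.
split=> [[q qs ->]|[->|->]]; last 2 first.
- exact: cell_mem.
- by apply: cell_gen_mem; rewrite inE.
elim: q qs => [|t q IH] qs; first by left.
have /set1P -> := qs t (mem_head _ _).
case: IH => [u uq|/vertex_eq e|/vertex_eq e].
- by apply: qs; rewrite inE uq orbT.
- by right; apply/vertex_eq; rewrite cat_cons !mat_cons e.
- by left; apply/vertex_eq; rewrite cat_cons mat_cons e -mat_cons mat1_cons2.
Qed.

Lemma mosaic_edgeP p v :
  mosaic_edge (vertex p) v <-> exists s, v = vertex (s :: p).
Proof.
split=> [[uv /face_cell[//|q [A [_ /eqP/cards1P[s ->] uvE]]]]|[s ->]]; last first.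
  split; first by move=> /esym/vertex_neq.
  apply/face_cell => //; exists p, [set s]; rewrite clique1 cards1; split=> //.
  by apply/seteqP; split=> w; rewrite cell1.
have /cell1 up : cell q [set s] (vertex p) by rewrite -uvE; left.
have /cell1 vp : cell q [set s] v by rewrite -uvE; right.
exists s; case: up => [/vertex_eq pq|/vertex_eq pq].
  case: vp => [vq|->]; first by case: uv; rewrite vq; apply/vertex_eq.
  by apply/vertex_eq; rewrite !mat_cons pq.
case: vp => [->|vq]; last by case: uv; rewrite vq; apply/vertex_eq.
by apply/vertex_eq; rewrite mat_cons pq -mat_cons mat1_cons2.
Qed.

End Cells.
End Faces.

(** * Cardinalities of finite sets *)

Section CardOf.
Local Open Scope classical_set_scope.

Lemma card_of_sub (T : choiceType) (A B : set T) :
  finite_set B -> A `<=` B -> (card_of A <= card_of B)%N.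
Proof.
move=> fB AB; apply: fsubset_leq_card.
by rewrite -fset_set_sub //; apply: sub_finite_set AB fB.
Qed.

Lemma card_of_image (T U : choiceType) (f : T -> U) (A : set T) :
  finite_set A -> injective f -> card_of (f @` A) = card_of A.
Proof. by move=> fA fi; rewrite /card_of fset_set_image // card_imfset. Qed.

Lemma card_of_setU1 (T : choiceType) (x : T) (A : set T) :
  finite_set A -> ~ A x -> card_of (x |` A) = (card_of A).+1.
Proof.
move=> fA Ax; rewrite /card_of fset_setU1 // cardfsU1 in_fset_set //.
by rewrite memNset.
Qed.

Lemma card_of_finset (T : finType) (U : choiceType) (f : T -> U) (A : {set T}) :
  injective f -> card_of [set u | exists2 t, t \in A & u = f t] = #|A|.
Proof.
move=> fi; rewrite /card_of.
have -> : [set u | exists2 t, t \in A & u = f t] = f @` [set` A].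
  by apply/seteqP; split=> u [t tA]; [move=>->|move=> <-]; exists t.
rewrite fset_set_image // card_imfset //.
have -> : fset_set [set` A] = [fset x in A]%fset.
  by apply/fsetP => x; rewrite in_fset_set // !inE; apply/idP/idP; rewrite inE.
by rewrite card_imfset //= -cardE.
Qed.

End CardOf.

(** * Shortest paths and farthest vertices *)

Section Values.
Import mathcomp.boot.fintype mathcomp.boot.finset.
Local Open Scope ring_scope.
Variables (R : realType) (g : seq 'I_5).
Let G : 'M[R]_5 := word_mx R g.
Let isoG : isometry G := word_isometry g.
Local Notation vertex := (vertex_of G).
Local Notation cell := (@cell R g).
Local Notation mat1 := (@mat R 1%:M).
Local Notation V0 := (vertex [::]).
Local Notation edge := (@mosaic_edge R).
Local Notation edgeb := (fun u v : 'rV[R]_5 => `[< edge u v >]).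

(** [w] lists the steps in walking order, whereas words carry the last step first; hence the
    reversals below. *)
Fixpoint trace (p w : seq 'I_120) : seq 'rV[R]_5 :=
  if w is s :: w' then vertex (s :: p) :: trace (s :: p) w' else [::].

Lemma size_trace p w : size (trace p w) = size w.
Proof. by elim: w p => //= s w IH p; rewrite IH. Qed.

Lemma last_trace p w : last (vertex p) (trace p w) = vertex (catrev w p).
Proof. by elim: w p => //= s w IH p; rewrite IH. Qed.

Lemma path_trace p w : path edgeb (vertex p) (trace p w).
Proof.
elim: w p => //= s w IH p; rewrite IH andbT; apply/asboolP.
by apply/mosaic_edgeP; exists s.
Qed.

Lemma path_traceP p l : path edgeb (vertex p) l -> exists w, l = trace p w.
Proof.
elim: l p => [|v l IH] p /=; first by exists [::].
case/andP=> /asboolP/mosaic_edgeP[s ->] /IH[w ->].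
by exists (s :: w).
Qed.

Lemma walk_size p l : reduced p -> walk edge V0 (vertex p) l -> (size p <= size l)%N.
Proof.
move=> rp [/path_traceP[w ->]]; rewrite last_trace size_trace => /vertex_eq wp.
have [r [rr mr _ szr]] := reduce_word R (catrev w [::]).
have -> : size p = size r.
  by apply/perm_size/(admissible_perm (@isometry1 R) rp rr); rewrite mr.
by move: szr; rewrite catrevE cats0 size_rev.
Qed.

Lemma walk_trace p : walk edge V0 (vertex p) (trace [::] (rev p)).
Proof.
split; first exact: path_trace.
by rewrite last_trace catrevE revK cats0.
Qed.

Lemma shortest_walksP p l : reduced p ->
  shortest_walks edge V0 (vertex p) l <->
  walk edge V0 (vertex p) l /\ size l = size p.
Proof.
move=> rp; split=> [[wl minl]|[wl szl]]; split=> //.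
  apply/eqP; rewrite eqn_leq walk_size // andbT.
  by have := minl _ (walk_trace p); rewrite size_trace size_rev.
by move=> q /(walk_size rp); rewrite szl.
Qed.

Lemma finite_words n : finite_set [set w : seq 'I_120 | size w = n]%classic.
Proof.
apply: (@sub_finite_set _ _ (range (val : n.-tuple 'I_120 -> seq 'I_120))).
  move=> w /= /eqP wn; exists (Tuple wn) => //.
exact: finite_image.
Qed.

Lemma finite_shortest_walks p :
  reduced p -> finite_set (shortest_walks edge V0 (vertex p)).
Proof.
move=> rp; apply: (@sub_finite_set _ _
  (trace [::] @` [set w : seq 'I_120 | size w = size p])%classic); last first.
  exact/finite_image/finite_words.
move=> l /(shortest_walksP _ rp)[[/path_traceP[w ->] _]].
by rewrite size_trace => wp; exists w.
Qed.

Lemma shortest_walks_rcons p s l : reduced (s :: p) ->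
  shortest_walks edge V0 (vertex p) l ->
  shortest_walks edge V0 (vertex (s :: p)) (rcons l (vertex (s :: p))).
Proof.
move=> rsp; have rp : reduced p by move: rsp; rewrite reduced_cons => /andP[].
move=> /(shortest_walksP _ rp)[[pl ll] szl]; apply/shortest_walksP => //.
split; last by rewrite size_rcons szl.
split; last by rewrite last_rcons.
rewrite rcons_path pl ll /=; apply/asboolP/mosaic_edgeP.
by exists s.
Qed.

Lemma value_le s p : reduced (s :: p) ->
  (value V0 (vertex p) <= value V0 (vertex (s :: p)))%N.
Proof.
move=> rsp; have rp : reduced p by move: rsp; rewrite reduced_cons => /andP[].
pose f l := rcons l (vertex (s :: p)).
have fi : injective f by move=> l l' /rcons_inj[].
rewrite /value -(card_of_image (finite_shortest_walks rp) fi).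
apply: card_of_sub; first exact: finite_shortest_walks.
by move=> _ [l sl <-]; apply: shortest_walks_rcons.
Qed.

Lemma value_lt s p d : reduced (s :: p) -> d \in descents (s :: p) -> d != s ->
  (value V0 (vertex p) < value V0 (vertex (s :: p)))%N.
Proof.
move=> rsp dsp ds; have rp : reduced p by move: rsp; rewrite reduced_cons => /andP[].
have [q [rdq pdq mdq]] := exchange R rsp dsp.
have rq : reduced q by move: rdq; rewrite -/reduced => /admissible_reduced; rewrite reduced_cons => /andP[].
have vdq : vertex (d :: q) = vertex (s :: p) by apply/vertex_eq.
pose f l := rcons l (vertex (s :: p)).
have fi : injective f by move=> l l' /rcons_inj[].
rewrite /value -(card_of_image (finite_shortest_walks rp) fi).
(* This shortest path arrives from the predecessor in direction [d]; the extended ones arrive from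
   that in direction [s]. *)
pose l0 := f (trace [::] (rev q)).
rewrite -(@card_of_setU1 _ l0); last 2 first.
- exact/finite_image/finite_shortest_walks.
- move=> [l /(shortest_walksP _ rp)[[_ ll] _] /fi lq].
  have [_ lastq] := walk_trace q.
  have pq : perm_eq p q.
    apply: (admissible_perm isoG rp rq).
    by apply/mat_eqG/(vertex_eq R g); rewrite -lastq -ll lq.
  (* If the two predecessors agreed, [p] and [q] would contain [d] equally often, and so could not
     [d :: q] and [s :: p]. *)
  have := permP pdq (pred1 d); rewrite /= eqxx eq_sym (negbTE ds).
  by rewrite (permP pq) => /eqP; rewrite add0n -[X in _ == X]add0n eqn_add2r.
apply: card_of_sub; first exact: finite_shortest_walks.
move=> _ [->|[l sl <-]]; last exact: shortest_walks_rcons.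
rewrite /l0 /f -vdq; apply: shortest_walks_rcons; first exact: admissible_reduced rdq.
apply/shortest_walksP => //; split; first exact: walk_trace.
by rewrite size_trace size_rev.
Qed.

(** A step through a missing element of [A] keeps the descents already in the clique, so the number
    of missing ones drops while the value never decreases. *)
Lemma climb J (A : {set 'I_120}) p : clique A -> (1 < #|A|)%N -> admissible J p ->
  {in A, forall s, enabled (remaining J p) s} ->
  exists w, [/\ {subset w <= A :\: descents p}, admissible J (w ++ p),
    A \subset descents (w ++ p) &
    w = [::] \/ (value V0 (vertex p) < value V0 (vertex (w ++ p)))%N].
Proof.
move=> cA A2; have [n] := ubnP #|A :\: descents p|.
elim: n p => // n IH p An ap eA.
have [/eqP Ap|[s]] := set_0Vmem (A :\: descents p).
  exists [::]; split=> //; last by left.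
  by rewrite -setD_eq0.
rewrite inE => /andP[sp sA].
have asp : admissible J (s :: p) by rewrite /= sp eA.
have adjA t : t \in A -> t != s -> adj t s.
  by move=> tA ts; apply: (cliqueP _ cA).
have dsp : A :\: descents (s :: p) \subset A :\: descents p.
  apply/subsetP => t; rewrite !inE negb_or negb_and => /andP[/andP[ts tp] tA].
  by rewrite tA andbT; move: tp; rewrite adjC adjA // orbF.
have [|||w [wA aw Aw vw]] := IH (s :: p).
- apply: (@leq_trans #|A :\: descents p|); last by rewrite -ltnS.
  apply: proper_card; rewrite properE dsp /=.
  apply/subsetPn; exists s; rewrite ?in_setD ?head_descent // sp.
  by [].
- by [].
- move=> t tA; rewrite remaining_cons; apply: enabled_sub (eA t tA); exact: subsetDl.
have rsp := admissible_reduced asp.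
exists (rcons w s); rewrite cat_rcons; split=> //.
  move=> t; rewrite mem_rcons inE => /predU1P[->|/wA].
    by rewrite inE sp.
  exact: (subsetP dsp).
right; case: vw => [w0|]; last by apply: leq_ltn_trans; apply: value_le.
rewrite w0 in Aw *.
(* The climb was the single step [s]; a second element of [A], also a descent at the end, makes the
   value grow strictly. *)
have [d dA ds] : exists2 d, d \in A & d != s.
  have : (0 < #|A :\ s|)%N by move: A2; rewrite (cardsD1 s) sA.
  by move/card_gt0P => [d]; rewrite !inE => /andP[ds dA]; exists d.
by apply: (value_lt (d := d)) => //; apply: (subsetP Aw).
Qed.

Lemma descents_clique_word (A : {set 'I_120}) q : clique A -> {subset q <= A} ->
  reduced q -> {subset q <= descents q}.
Proof.
move=> cA; elim: q => // s q IH qA; rewrite reduced_cons => /andP[sq rq] t.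
have qA' : {subset q <= A} by move=> u uq; apply: qA; rewrite inE uq orbT.
rewrite /= !inE => /predU1P[->|tq]; first by rewrite eqxx.
have {}tq := IH qA' rq t tq; rewrite tq /= orbC.
have [-> //|ts] := eqVneq t s; first by rewrite orbT.
rewrite adjC (cliqueP _ cA) //; apply: qA; rewrite ?mem_head //.
by rewrite inE (descents_sub tq) orbT.
Qed.

Lemma side_word s q (A : 'M[R]_5) : {in q, forall t, adj t s} ->
  side G s (mat A q) = side G s A.
Proof.
elim: q => // t q IH qs; rewrite mat_cons side_gen_adj; last first.
  by apply: qs; rewrite mem_head.
by apply: IH => u uq; apply: qs; rewrite inE uq orbT.
Qed.

(** If the reduced quotient had a head [s], its other letters would be adjacent to [s] and preserve
    its side. The sides of [s] at the two ends would then be opposite, yet both are negative. *)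
Lemma top_unique (A : {set 'I_120}) q r1 r2 : clique A -> {subset q <= A} ->
  reduced r1 -> reduced r2 -> A \subset descents r1 -> A \subset descents r2 ->
  vertex r1 = vertex (q ++ r2) -> vertex r1 = vertex r2.
Proof.
move=> cA qA rr1 rr2 Ar1 Ar2 e.
have [q' [rq' mq' q'q _]] := reduce_word R q.
have {qA q'q} q'A : {subset q' <= A} by move=> t /q'q/qA.
have {q mq'}e : vertex r1 = vertex (q' ++ r2).
  by rewrite e; apply/vertex_eq; rewrite !mat_cat mq'.
rewrite e; case: q' rq' q'A e => // s q rsq sqA e.
have qA : {subset q <= A} by move=> u uq; apply: sqA; rewrite inE uq orbT.
have sA : s \in A by apply: sqA; rewrite mem_head.
have /andP[sq rq] : (s \notin descents q) && reduced q by rewrite -reduced_cons.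
have adjq : {in q, forall t, adj t s}.
  move=> t tq; apply: (cliqueP _ cA) => //; first exact: qA.
  by apply: contraNneq sq => <-; apply: (descents_clique_word cA qA rq).
have s1 : side G s (mat G r1) < 0.
  by rewrite -(descents_side isoG) //; apply: (subsetP Ar1).
have s2 : side G s (mat G r2) < 0.
  by rewrite -(descents_side isoG) //; apply: (subsetP Ar2).
have /(mat_eqG G) m : mat1 r1 = mat1 (s :: q ++ r2) by apply/(vertex_eq R g).
move: s1; rewrite m mat_cons side_gen_same.
have -> : mat G (q ++ r2) = mat (mat G r2) q by rewrite /mat foldr_cat.
rewrite side_word // oppr_lt0 => s1.
by have := lt_trans s1 s2; rewrite ltxx.
Qed.

Lemma reduced_representative p : exists2 r, reduced r & mat1 r = mat1 p.
Proof. by have [r [rr mr _ _]] := reduce_word R p; exists r. Qed.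

(** Were some element of [A] not a descent, [climb] would reach a larger value inside the cell. *)
Lemma largest_in_top (A : {set 'I_120}) p v : clique A -> (1 < #|A|)%N ->
  largest_in V0 (cell p A) v ->
  exists r, [/\ reduced r, v = vertex r, A \subset descents r &
                cell r A = cell p A].
Proof.
move=> cA A2 [[q qA vE] vmax].
have [r rr mr] := reduced_representative (q ++ p).
have vr : v = vertex r by rewrite vE; apply/vertex_eq.
have cr : cell r A = cell p A by rewrite (cell_eq _ _ mr) cell_move.
have [|w [wA aw Aw [w0|lt]]] := @climb set0 A r cA A2 rr.
- by move=> s _; rewrite remaining0 enabled0.
- by exists r; split=> //; rewrite w0 in Aw.
have wA' : {subset w <= A} by move=> t /wA; rewrite inE => /andP[].
have : cell p A (vertex (w ++ r)) by rewrite -cr; exists w.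
by move=> /vmax; rewrite vr leqNgt lt.
Qed.

(** By [top_unique], climbing from any vertex of the cell ends at this one. *)
Lemma top_largest_in (A : {set 'I_120}) r : clique A -> (1 < #|A|)%N ->
  reduced r -> A \subset descents r -> largest_in V0 (cell r A) (vertex r).
Proof.
move=> cA A2 rr Ar; split=> [|u [q qA ->]]; first exact: cell_mem.
have [p rp mp] := reduced_representative (q ++ r).
have -> : vertex (q ++ r) = vertex p by apply/vertex_eq.
have [|w [wA aw Aw vw]] := @climb set0 A p cA A2 rp.
- by move=> s _; rewrite remaining0 enabled0.
have <- : vertex (w ++ p) = vertex r.
  apply: (@top_unique A (w ++ q)) => //.
    move=> t; rewrite mem_cat => /orP[/wA|/qA //]; by rewrite inE => /andP[].
  by apply/vertex_eq; rewrite -catA !mat_cat mp mat_cat.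
by case: vw => [->//|/ltnW].
Qed.

End Values.

(** * The convex part *)

Section Part.
Import mathcomp.boot.fintype mathcomp.boot.finset.
Local Open Scope ring_scope.
Variables (R : realType) (g : seq 'I_5).
Let G : 'M[R]_5 := word_mx R g.
Let isoG : isometry G := word_isometry g.
Local Notation vertex := (vertex_of G).
Local Notation cell := (@cell R g).
Local Notation mat1 := (@mat R 1%:M).
Local Notation V0 := (vertex [::]).
Local Notation C0 := (cell [::] (initial 4)).
Local Notation adm := (admissible (initial 4)).
Local Notation left_ := (remaining (initial 4)).
Local Notation in_part := (in_part V0 C0).
Local Notation part_edge := (part_edge V0 C0).
Local Notation vertex_eq := (vertex_eq R g).

Lemma remaining_nil J : remaining J [::] = J.
Proof. by apply/setP => s; rewrite !inE andbT. Qed.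

(** A new letter is adjacent to the other remaining generators because it is enabled, and to the
    surviving descents by their definition. The sizes of both sets therefore add up to at most 4,
    which limits the types. *)
Lemma admissible_clique p : adm p ->
  clique (left_ p :|: descents p) /\ [disjoint left_ p & descents p].
Proof.
elim: p => [_|s p IH /= /and3P[sp es /IH[cp dp]]].
  rewrite remaining_nil setU0 initial_clique // disjoint_sym.
  by split=> //; apply/pred0P => s; rewrite /= inE.
have rs : left_ (s :: p) = left_ p :\ s by apply: remaining_cons.
split.
  have sJ v : v != s -> v \in left_ p -> adj v s.
    by move=> vs vJ; apply: (enabledP _ _ es).
  have inJ v : v \in left_ p -> v \in left_ p :|: descents p.
    by rewrite in_setU => ->.
  have inD v : v \in descents p -> v \in left_ p :|: descents p.
    by rewrite in_setU orbC => ->.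
  have nb v : v \in neighbors s = adj s v by rewrite inE.
  apply/cliqueP => t u; rewrite rs !in_setU !in_setD1 /= !in_set1 !in_setI !nb.
  case/or3P => [/andP[ts tJ]|/eqP ->|/andP[tD st]];
    case/or3P => [/andP[us uJ]|/eqP ->|/andP[uD su]] tu.
  - by apply: (cliqueP _ cp) => //; apply: inJ.
  - exact: sJ.
  - by apply: (cliqueP _ cp) => //; [apply: inJ|apply: inD].
  - by rewrite adjC; apply: sJ.
  - by rewrite eqxx in tu.
  - by [].
  - by apply: (cliqueP _ cp) => //; [apply: inD|apply: inJ].
  - by rewrite adjC.
  - by apply: (cliqueP _ cp) => //; apply: inD.
rewrite rs; apply/pred0P => t; rewrite /= !in_setD1 in_setU1 in_setI.
have := pred0P dp t; rewrite /=.
by case: (t == s); case: (t \in left_ p); case: (t \in descents p).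
Qed.

Definition part_cell (C : set 'rV[R]_5) : Prop := exists p A,
  [/\ adm p, clique4 A, {in A, forall s, enabled (left_ p) s} & C = cell p A].

(** Allows every vertex of a hypercube of the part to serve as the base point of its description. *)
Lemma adm_move p (A : {set 'I_120}) q : adm p -> clique4 A ->
  {in A, forall s, enabled (left_ p) s} -> {subset q <= A} ->
  exists p', [/\ adm p', mat1 p' = mat1 (q ++ p) &
                 {in A, forall s, enabled (left_ p') s}].
Proof.
move=> ap /andP[cA _] eA; elim: q => [|s q IH] qA; first by exists p.
have [|p' [ap' mp' ep']] := IH; first by move=> t tq; apply: qA; rewrite inE tq orbT.
have sA : s \in A by apply: qA; rewrite mem_head.
have [sd|sd] := boolP (s \in descents p'); last first.
  exists (s :: p'); split; first by rewrite /= sd ep'.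
    by rewrite cat_cons !mat_cons mp'.
  move=> t tA; rewrite remaining_cons; apply: enabled_sub (ep' t tA).
  exact: subsetDl.
(* A step through a descent removes this letter, which may thereby return to the remaining set; the
   rest of [A] is adjacent to it and stays enabled. *)
have [r [asr psr msr]] := exchange R ap' sd; exists r; split.
- by case/and3P: asr.
- by rewrite cat_cons mat_cons -mp' -msr -mat_cons mat1_cons2.
move=> t tA; have := ep' t tA; rewrite -(remaining_perm _ psr) remaining_cons.
have [->|ts] := eqVneq t s; first by case/and3P: asr.
by apply: enabled_D1; rewrite adjC; apply: (cliqueP _ cA).
Qed.

Lemma part_cell_at C v : part_cell C -> C v -> exists p A,
  [/\ adm p, clique4 A, {in A, forall s, enabled (left_ p) s}, C = cell p A &
      v = vertex p].
Proof.
move=> [p [A [ap cA eA ->]]] [q qA ->].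
have [p' [ap' mp' ep']] := adm_move ap cA eA qA.
exists p', A; split=> //; last exact/vertex_eq.
by rewrite (cell_eq _ _ mp') cell_move.
Qed.

Lemma hypercube_cell C : hypercube C <-> exists p A, clique4 A /\ C = cell p A.
Proof.
rewrite /hypercube face_cell //; split=> [[p [A [cA A4 ->]]]|[p [A [/andP[cA /eqP A4] ->]]]].
  by exists p, A; rewrite /clique4 cA A4.
by exists p, A.
Qed.

Lemma hypercube_at C p : hypercube C -> C (vertex p) ->
  exists2 A, clique4 A & C = cell p A.
Proof.
move=> /hypercube_cell[p' [A [cA ->]]] [q qA /vertex_eq pE].
by exists A; rewrite // (cell_eq _ _ pE) cell_move.
Qed.

Lemma in_part_cell C : in_part C -> part_cell C.
Proof.
have c4 A : clique4 A -> clique A /\ (1 < #|A|)%N by case/andP => -> /eqP ->.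
elim=> {C} [|C C' v _ [p [A [ap cA eA ->]]] top hC' C'v
  |S C1 C2 C3 C sqS _ Q1 _ Q2 _ Q3 C12 C13 C23 S1 S2 S3 hC SC].
- exists [::], (initial 4); split=> //.
    by rewrite /clique4 initial_clique ?card_initial.
  move=> s s4; apply/enabledP => j; rewrite remaining_nil => j4 js.
  by apply: (cliqueP _ (initial_clique (leqnn 4))).
- have [[q qA vq] _] := top; have [cliqueA A2] := c4 A cA.
  have [r [rr vr Ar _]] := largest_in_top cliqueA A2 top.
  have [p' [ap' mp' _]] := adm_move ap cA eA qA.
  have vp' : v = vertex p' by rewrite vq; apply/vertex_eq.
  have [A' cA' C'E] := hypercube_at hC' (eq_ind _ C' C'v _ vp').
  exists p', A'; split=> // s _.
  have rr' := admissible_reduced ap'.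
  have dE : descents p' = descents r.
    by apply: (descents_eq isoG rr' rr); apply/mat_eqG/vertex_eq; rewrite -vp'.
  have [cp dp] := admissible_clique ap'.
  have : (#|left_ p'| + #|descents p'| <= 4)%N.
    by have := clique_card cp; rewrite cardsU disjoint_setI0 // cards0 subn0.
  have : (4 <= #|descents p'|)%N.
    case/andP: cA => _ /eqP A4; apply: (@leq_trans #|A|); first by rewrite A4.
    by rewrite dE subset_leq_card.
  move=> d4 le4; have : #|left_ p'| = 0%N.
    by apply/eqP; rewrite -leqn0 -(leq_add2r 4) add0n (leq_trans _ le4) ?leq_add2l.
  by move/cards0_eq ->; apply: enabled0.
have [p [B [cB B2 SE]]] : exists p B, [/\ clique B, #|B| = 2%N & S = cell p B].
  by apply/face_cell.
have Sp : S (vertex p) by rewrite SE; apply: cell_mem.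
have [p1 [A1 [ap1 cA1 eA1 C1E vp1]]] := part_cell_at Q1 (S1 _ Sp).
have [p2 [A2 [ap2 cA2 eA2 C2E vp2]]] := part_cell_at Q2 (S2 _ Sp).
have [p3 [A3 [ap3 cA3 eA3 C3E vp3]]] := part_cell_at Q3 (S3 _ Sp).
have [A cA CE] := hypercube_at hC (SC _ Sp).
(* The three hypercubes come with different words of one vertex, which share their letters and hence
   their remaining set. *)
have same p' : adm p' -> vertex p = vertex p' ->
    left_ p' = left_ p1 /\ forall B, cell p' B = cell p B.
  move=> ap' vp'; split; last by move=> D; apply/esym/cell_eq/vertex_eq.
  apply/remaining_perm/(admissible_perm isoG ap' ap1)/mat_eqG/vertex_eq.
  by rewrite -vp' vp1.
have [_ e1] := same p1 ap1 vp1; have [r2 e2] := same p2 ap2 vp2.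
have [r3 e3] := same p3 ap3 vp3.
have memB C' D : (S `<=` C')%classic -> C' = cell p D -> B \subset D.
  move=> SC' C'E; apply/subsetP => s sB; apply: (cell_gen (R := R) (g := g) (p := p)).
  by rewrite -C'E; apply: SC'; rewrite SE; apply: cell_gen_mem.
have [x [y [xy BE]]] : exists x y, x != y /\ B = [set x; y].
  by move: B2 => /eqP/cards2P[x [y [xy ->]]]; exists x, y.
have xB : x \in B by rewrite BE !inE eqxx.
have yB : y \in B by rewrite BE !inE eqxx orbT.
rewrite e1 in C1E; rewrite e2 in C2E; rewrite e3 in C3E.
exists p1, A; split=> //; last by rewrite e1.
apply: (@three_tetrahedra (left_ p1) x y A1 A2 A3 A).
- exact: (cliqueP _ cB).
- by apply/eqP => A12; apply: C12; rewrite C1E C2E A12.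
- by apply/eqP => A13; apply: C13; rewrite C1E C3E A13.
- by apply/eqP => A23; apply: C23; rewrite C2E C3E A23.
- move=> D; rewrite !inE => /or4P[]/eqP ->; split=> //;
    first [exact: (subsetP (memB _ _ S1 C1E)) | exact: (subsetP (memB _ _ S2 C2E))
          |exact: (subsetP (memB _ _ S3 C3E)) | exact: (subsetP (memB _ _ SC CE))].
- move=> D; rewrite !inE => /or3P[]/eqP -> //.
    by move=> s sA; rewrite -r2; apply: eA2.
  by move=> s sA; rewrite -r3; apply: eA3.
Qed.

Lemma cell_in_part p (A : {set 'I_120}) : adm p -> clique4 A ->
  {in A, forall s, enabled (left_ p) s} -> in_part (cell p A).
Proof.
elim: p A => [|s p IH] A ap cA eA.
  (* At [V0] all four generators remain, and a tetrahedron is the only one in its own star because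
     cliques have at most four elements. *)
  suff -> : A = initial 4 by apply: part_start.
  apply/eqP; rewrite eqEcard; case/andP: cA => cA /eqP ->.
  rewrite card_initial // andbT; apply/subsetP => s sA; apply/negPn/negP => s4.
  have : (#|s |: initial 4| <= 4)%N.
    apply: clique_card; apply/cliqueP => t u; rewrite !in_setU1.
    have st v : v \in initial 4 -> adj v s.
      move=> v4; apply: (enabledP _ _ (eA s sA)); first by rewrite remaining_nil.
      by apply: contraNneq s4 => <-.
    case/predU1P => [->|t4]; case/predU1P => [->|u4]; rewrite ?eqxx // => tu.
    - by rewrite adjC st.
    - exact: st.
    - exact: (cliqueP _ (initial_clique (leqnn 4))).
  by rewrite cardsU1 s4 card_initial.
have [/= sp es ap'] := and3P ap.
have [cp dp] := admissible_clique ap.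
have sD : s \in descents (s :: p) by apply: head_descent.
pose K (B : {set 'I_120}) := in_part (cell (s :: p) B).
have K_edge : edge_closed K.
  move=> x y A1 A2 A3 B xy A12 A13 A23 HB K1 K2 K3.
  have face_sub D : D \in [:: A1; A2; A3; B] ->
      (cell (s :: p) [set x; y] `<=` cell (s :: p) D)%classic.
    move=> /HB[_ xD yD] v [q qxy ->]; exists q => // t /qxy.
    by rewrite !inE => /orP[]/eqP ->.
  have neq (D E : {set 'I_120}) : D != E -> cell (s :: p) D <> cell (s :: p) E.
    by move=> DE /cell_inj/eqP; rewrite (negbTE DE).
  apply: (@part_convex R V0 C0 (cell (s :: p) [set x; y])
    (cell (s :: p) A1) (cell (s :: p) A2) (cell (s :: p) A3)) => //.
  - apply/face_cell => //; exists (s :: p), [set x; y]; rewrite clique2 //.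
    rewrite cards2; split=> //.
    by have -> : x != y by apply: contraTneq xy => ->; rewrite adj_irr.
  - exact: neq.
  - exact: neq.
  - exact: neq.
  - by apply: face_sub; rewrite !inE eqxx.
  - by apply: face_sub; rewrite !inE eqxx orbT.
  - by apply: face_sub; rewrite !inE eqxx !orbT.
  - apply/hypercube_cell; exists (s :: p), B; split=> //.
    by have [] := HB B; rewrite ?inE ?eqxx ?orbT.
  - by apply: face_sub; rewrite !inE eqxx !orbT.
(* A hypercube through the incoming edge [s] is also a hypercube at the vertex of [p], where the
   induction hypothesis applies. *)
have K_in B : clique4 B -> {in B, forall t, enabled (left_ (s :: p)) t} -> s \in B -> K B.
  move=> cB eB sB; rewrite /K.
  have -> : cell (s :: p) B = cell p B.
    by apply: (@cell_move R g p [:: s]) => t; rewrite inE => /eqP ->.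
  apply: IH => // t tB; have [->//|ts] := eqVneq t s.
  apply: (@enabled_D1 _ s); last by rewrite -remaining_cons eB.
  by case/andP: cB => /cliqueP cB _; apply: cB; rewrite // eq_sym.
have K_near B D : clique4 B -> {in B, forall t, enabled (left_ (s :: p)) t} ->
    s \in B -> clique4 D -> B :\ s \subset D -> K D.
  move=> cB eB sB cD BD; have [cliqueB B4] := andP cB.
  have B2 : (1 < #|B|)%N by rewrite (eqP B4).
  (* Since [s] is already a descent, the climb to the farthest vertex of [B] stays within [B :\ s],
     hence within [D]; so [D] contains that vertex and enters by [part_step]. *)
  have [w [wB aw Bw _]] := @climb R g _ B (s :: p) cliqueB B2 ap eB.
  have wBs : {subset w <= B :\ s}.
    move=> t /wB; rewrite in_setD in_setD1 => /andP[td ->]; rewrite andbT.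
    by apply: contraNneq td => ->.
  have KB := K_in B cB eB sB.
  have wsub : {subset w <= B} by move=> t /wBs; rewrite inE => /andP[].
  rewrite /K -(@cell_move R g (s :: p) w B wsub) in KB.
  rewrite /K -(@cell_move R g (s :: p) w D); last first.
    by move=> t /wBs /(subsetP BD).
  apply: (part_step KB (v := vertex (w ++ s :: p))); last exact: cell_mem.
    by apply: top_largest_in => //; apply: admissible_reduced aw.
  by apply/hypercube_cell; exists (w ++ s :: p), D.
have [J0|J0] := eqVneq (left_ (s :: p)) set0.
  apply: (@interior_known K s) => //.
    by move=> B cB sB; apply: K_in => // t _; rewrite J0 enabled0.
  by move=> B D cB sB cD; apply: K_near => // t _; rewrite J0 enabled0.
apply: (@star_known K (left_ (s :: p)) s) => //.
- by apply: clique_sub cp; rewrite subUset sub1set inE sD orbT subsetUl.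
- by have /pred0P/(_ s) := dp; rewrite /= sD andbT => ->.
- by move=> B D cB eB sB cD _; apply: K_near.
Qed.

(** * Edges, levels, degrees and incoming edges of the part *)

Lemma remaining_eq p q : adm p -> adm q -> vertex p = vertex q -> left_ p = left_ q.
Proof.
move=> ap aq /vertex_eq pq.
exact/remaining_perm/(admissible_perm (@isometry1 R) ap aq).
Qed.

Lemma part_edgeP p v : adm p ->
  part_edge (vertex p) v <-> exists2 s, enabled (left_ p) s & v = vertex (s :: p).
Proof.
move=> ap; split.
  move=> [/mosaic_edgeP[s ->] [C [/in_part_cell QC Cu Cv]]]; exists s => //.
  have [p' [A [ap' cA eA CE pp']]] := part_cell_at QC Cu.
  rewrite (remaining_eq ap ap') //; apply: eA.
  apply: (cell_gen (R := R) (g := g) (p := p)).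
  have -> : cell p A = cell p' A by apply: cell_eq; apply/vertex_eq.
  by rewrite -CE.
move=> [s es ->]; split; first by apply/mosaic_edgeP; exists s.
(* Any tetrahedron containing this simplex lies in the star and gives a hypercube of the part that
   carries the edge. *)
have cJ : clique (s |: left_ p).
  have [cp _] := admissible_clique ap.
  apply/cliqueP => t u; rewrite !in_setU1.
  case/predU1P => [->|tJ]; case/predU1P => [->|uJ]; rewrite ?eqxx // => tu.
  - by rewrite adjC; apply: (enabledP _ _ es); rewrite // eq_sym.
  - exact: (enabledP _ _ es).
  - by apply: (cliqueP _ cp); rewrite // in_setU ?tJ ?uJ.
have [A [JA cA A4]] := clique_extends cJ.
exists (cell p A); split; last 2 first.
- exact: cell_mem.
- by apply: cell_gen_mem; apply: (subsetP JA); rewrite setU11.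
apply: cell_in_part => //; first by rewrite /clique4 cA A4.
move=> t tA; apply/enabledP => j jJ jt; apply: (cliqueP _ cA) => //.
by apply: (subsetP JA); rewrite in_setU1 jJ orbT.
Qed.

Lemma part_edge_admissible u v :
  part_edge u v -> exists2 p, adm p & v = vertex p.
Proof.
move=> [_ [C [/in_part_cell QC _ Cv]]].
by have [p [A [ap _ _ _ ->]]] := part_cell_at QC Cv; exists p.
Qed.

Lemma admissible_catrev w p : adm (catrev w p) -> adm p.
Proof. by elim: w p => //= s w IH p /IH /and3P[]. Qed.

Lemma path_part_trace w p : adm (catrev w p) ->
  path (fun u v => `[< part_edge u v >]) (vertex p) (trace R g p w).
Proof.
elim: w p => //= s w IH p aw; rewrite IH // andbT; apply/asboolP.
have /and3P[_ es ap] := admissible_catrev aw.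
by apply/part_edgeP => //; exists s.
Qed.

Lemma part_walk_size p l : adm p -> walk part_edge V0 (vertex p) l ->
  (size p <= size l)%N.
Proof.
move=> /admissible_reduced rp [pl ll]; apply: (@walk_size R g p l rp); split=> //.
by apply: sub_path pl => u v /asboolP[uv _]; apply/asboolP.
Qed.

Lemma part_walk_trace p : adm p ->
  walk part_edge V0 (vertex p) (trace R g [::] (rev p)).
Proof.
move=> ap; split; last by rewrite last_trace catrevE revK cats0.
by apply: path_part_trace; rewrite catrevE revK cats0.
Qed.

Lemma levelP n v : level V0 C0 n v <->
  exists p, [/\ adm p, size p = n & v = vertex p].
Proof.
split=> [[l [[pl ll] minl] <-]|[p [ap <- ->]]]; last first.
  exists (trace R g [::] (rev p)); last by rewrite size_trace size_rev.
  split; first exact: part_walk_trace.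
  by move=> q /(part_walk_size ap); rewrite size_trace size_rev.
have [p ap vp] : exists2 p, adm p & v = vertex p.
  move: pl ll {minl}; case/lastP: l => [_ <-|l u]; first by exists [::].
  rewrite rcons_path last_rcons => /andP[_ /asboolP/part_edge_admissible].
  by move=> [p ap ->] <-; exists p.
exists p; split=> //; apply/eqP; rewrite eqn_leq part_walk_size //=; last first.
  by rewrite -vp.
rewrite -[size p]size_rev -(size_trace R g [::]); apply: minl; rewrite vp.
exact: part_walk_trace.
Qed.

Lemma vertex_gen_inj p : injective (fun s => vertex (s :: p)).
Proof.
move=> s t /vertex_eq st; apply/set1P; apply: (cell_gen (R := R) (g := g) (p := p)).
have -> : vertex (s :: p) = vertex (t :: p) by apply/vertex_eq.
by apply: cell_gen_mem; rewrite inE.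
Qed.

Lemma degreeE p : adm p -> degree V0 C0 (vertex p) = star_size #|left_ p|.
Proof.
move=> ap; have [cp _] := admissible_clique ap.
rewrite -card_enabled; last by apply: clique_sub cp; apply: subsetUl.
rewrite -(card_of_finset _ (@vertex_gen_inj p)); congr card_of.
apply/seteqP; split=> v.
  by move=> /part_edgeP -/(_ ap)[s es ->]; exists s; rewrite ?inE.
by case=> s; rewrite inE => es ->; apply/part_edgeP => //; exists s.
Qed.

Lemma incomingE p : adm p -> incoming V0 C0 (vertex p) = #|descents p|.
Proof.
move=> ap; rewrite -(card_of_finset _ (@vertex_gen_inj p)); congr card_of.
apply/seteqP; split=> u /=.
  move=> [uv [m [/levelP[q [aq qm uq]] /levelP[p' [ap' p'm vp']]]]].
  move: uv; rewrite uq => /part_edgeP -/(_ aq)[s es vs].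
  have szp : size p = m.+1.
    rewrite -p'm; apply/perm_size/(admissible_perm isoG ap ap')/mat_eqG.
    exact/vertex_eq.
  (* Otherwise the step would shorten the word and lead to the level below [q]. *)
  have sq : s \notin descents q.
    apply/negP => sd; have [r [asr psr msr]] := exchange R aq sd.
    have ar : adm r by case/and3P: asr.
    have pr : perm_eq p r.
      apply: (admissible_perm isoG ap ar); apply/mat_eqG/vertex_eq.
      rewrite vs; apply/vertex_eq.
      by rewrite mat_cons -msr -mat_cons mat1_cons2.
    have := perm_size psr; rewrite /= qm -(perm_size pr) szp.
    by move/eqP; rewrite -addn2 -[X in _ == X]addn0 eqn_add2l.
  have asq : adm (s :: q) by rewrite /= sq es.
  exists s.
    rewrite (_ : descents p = descents (s :: q)) ?head_descent //.
    apply: (descents_eq isoG (admissible_reduced ap) (admissible_reduced asq)).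
    by apply/mat_eqG/vertex_eq.
  apply/vertex_eq; have /vertex_eq e := vs.
  by rewrite mat_cons e -mat_cons mat1_cons2.
case=> d dp ->; have [q [adq pdq mdq]] := exchange R ap dp.
have /and3P[_ ed aq] := adq.
have vq : vertex (d :: p) = vertex q.
  by apply/vertex_eq; rewrite mat_cons -mdq -mat_cons mat1_cons2.
have vp : vertex p = vertex (d :: q) by apply/vertex_eq.
split.
  by rewrite vq; apply/part_edgeP => //; exists d.
exists (size q); split; apply/levelP; first by exists q.
by exists (d :: q).
Qed.

End Part.

(** * Counting the vertices of each type *)

Lemma card_of_sum (T : choiceType) (A : set T) (P : pred T) :
  finite_set A ->
  card_of [set x | A x /\ P x]%classic = \sum_(x <- fset_set A | P x) 1%N.
Proof.
move=> fA; rewrite sum1_count -size_filter /card_of.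
have fP : finite_set [set x | A x /\ P x]%classic.
  by apply: sub_finite_set fA => x [].
apply/perm_size/uniq_perm; rewrite ?fset_uniq ?filter_uniq ?fset_uniq // => x.
rewrite mem_filter !in_fset_set //.
by apply/idP/andP; rewrite !inE => -[].
Qed.

Section Counting.
Import mathcomp.boot.fintype mathcomp.boot.finset.
Variables (R : realType) (g : seq 'I_5).
Let G : 'M[R]_5 := word_mx R g.
Let isoG : isometry G := word_isometry g.
Local Notation vertex := (vertex_of G).
Local Notation V0 := (vertex [::]).
Local Notation C0 := (@cell R g [::] (initial 4)).
Local Notation adm := (admissible (initial 4)).
Local Notation left_ := (remaining (initial 4)).
Local Notation part_edge := (part_edge V0 C0).
Local Notation mat1 := (@mat R 1%:M%R).
Local Notation vertex_eq := (vertex_eq R g).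

Lemma finite_level n : finite_set (level V0 C0 n).
Proof.
apply: (@sub_finite_set _ _ (vertex @` [set p : seq 'I_120 | size p = n])%classic).
  by move=> v /levelP[p [_ pn ->]]; exists p.
exact/finite_image/finite_words.
Qed.

Definition all_types : seq (nat * nat) := (4, 0)%N :: vertex_types.

Lemma admissible_type p : adm p ->
  (#|left_ p|, #|descents p|) \in
    if p is [::] then [:: (4, 0)%N] else vertex_types.
Proof.
move=> ap; have [cp dp] := admissible_clique ap.
have := clique_card cp; rewrite cardsU disjoint_setI0 // cards0 subn0.
case: p ap {cp dp} => [_|s p ap] le4.
  by rewrite remaining_nil card_initial // cards0.
have : (0 < #|descents (s :: p)|)%N.
  by apply/card_gt0P; exists s; apply: head_descent.
move: le4; move: #|left_ _| #|descents _| => j i.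
by case: j => [|[|[|[|[|j]]]]]; case: i => [|[|[|[|[|i]]]]].
Qed.

Lemma star_size_inj (j j' : nat) : (j <= 4)%N -> (j' <= 4)%N ->
  star_size j = star_size j' -> j = j'.
Proof.
by case: j => [|[|[|[|[|j]]]]] //; case: j' => [|[|[|[|[|j']]]]].
Qed.

Lemma card_remaining p : (#|left_ p| <= 4)%N.
Proof.
apply: (@leq_trans #|initial 4|); last by rewrite card_initial.
by apply/subset_leq_card/subsetP => s; rewrite inE => /andP[].
Qed.

Lemma of_typeP j i n v : (j <= 4)%N ->
  of_type V0 C0 (star_size j) i n v <->
  exists p, [/\ adm p, size p = n, v = vertex p, #|left_ p| = j & #|descents p| = i].
Proof.
move=> j4; split=> [[/levelP[p [ap pn ->]]]|[p [ap pn -> pj pi]]].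
  rewrite degreeE // incomingE // => dj di; exists p; split=> //.
  by apply: star_size_inj; rewrite ?card_remaining.
split; first by apply/levelP; exists p.
  by rewrite degreeE // pj.
by rewrite incomingE.
Qed.

Definition number (t : nat * nat) (n : nat) : nat :=
  card_of (of_type V0 C0 (star_size t.1) t.2 n).

Lemma numberE t n :
  number t n = \sum_(v <- fset_set (level V0 C0 n) |
    `[< of_type V0 C0 (star_size t.1) t.2 n v >]) 1%N.
Proof.
rewrite -card_of_sum; last exact: finite_level.
congr card_of; apply/seteqP; split=> v.
  by move=> tv; split; [case: tv|apply/asboolP].
by case=> _ /asboolP.
Qed.

Lemma vertex_type_le t : t \in all_types -> (t.1 <= 4)%N.
Proof. by move: t; apply/allP. Qed.

(** A vertex has exactly one of the listed types, so a sum over types collapses to one term. *)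
Lemma sum_types (F : nat * nat -> nat) n p : adm p -> size p = n ->
  \sum_(t <- all_types | `[< of_type V0 C0 (star_size t.1) t.2 n (vertex p) >]) F t
  = F (#|left_ p|, #|descents p|).
Proof.
move=> ap pn; rewrite big_seq_cond.
rewrite (eq_bigl (fun t => (t \in all_types) && (t == (#|left_ p|, #|descents p|)))).
  rewrite -big_seq_cond -big_filter filter_pred1_uniq ?big_seq1 //.
  have := admissible_type ap; case: (p) => [|s q].
    by rewrite mem_seq1 => /eqP ->; apply: mem_head.
  by move=> tT; rewrite /all_types in_cons tT orbT.
move=> t; apply: andb_id2l => /vertex_type_le t4.
apply/asboolP/eqP => [/(of_typeP _ _ _ t4)[q [aq qn pq]]|->].
  have e := admissible_perm isoG ap aq (mat_eqG G (proj1 (vertex_eq _ _) pq)).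
  rewrite (remaining_perm _ e).
  rewrite (descents_eq isoG (admissible_reduced ap) (admissible_reduced aq)).
    by case: t {t4} => j i /= -> ->.
  exact/mat_eqG/vertex_eq.
by apply/of_typeP; [exact: card_remaining|exists p].
Qed.

Lemma number_transitions t n p : t \in vertex_types -> adm p -> size p = n ->
  card_of [set v | level V0 C0 n.+1 v /\
    `[< of_type V0 C0 (star_size t.1) t.2 n.+1 v /\ part_edge (vertex p) v >]]%classic
  = transition_number #|left_ p| #|descents p| t.1 t.2.
Proof.
move=> tt ap pn; have [cp dp] := admissible_clique ap.
have t4 : (t.1 <= 4)%N by apply: vertex_type_le; rewrite inE tt orbT.
have tt' : (t.1, t.2) \in vertex_types by rewrite -surjective_pairing.
rewrite -(card_transitions cp dp tt').
rewrite -(card_of_finset _ (@vertex_gen_inj R g p)); congr card_of.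
apply/seteqP; split=> v.
  move=> [_ /asboolP[/(of_typeP _ _ _ t4)[q [aq qn vq qj qi]]]].
  move=> /part_edgeP -/(_ ap)[s es vs].
  have mq : mat1 q = mat1 (s :: p) by apply/vertex_eq; rewrite -vq.
  have sp : s \notin descents p.
    apply/negP => sd; have [r [/and3P[_ _ ar] psr msr]] := exchange R ap sd.
    have : perm_eq q r.
      apply: (admissible_perm isoG aq ar); apply/mat_eqG.
      by rewrite mq mat_cons -msr -mat_cons mat1_cons2.
    move/perm_size; have /= := perm_size psr; rewrite qn pn => <- /eqP.
    by rewrite -addn2 -[X in _ == X]addn0 eqn_add2l.
  have asp : adm (s :: p) by rewrite /= sp es.
  exists s => //; rewrite inE es sp /=.
  have pq := admissible_perm isoG aq asp (mat_eqG G mq).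
  rewrite -remaining_cons -(remaining_perm _ pq) qj eqxx /=.
  rewrite -[_ |: _]/(descents (s :: p)).
  rewrite -(descents_eq isoG (admissible_reduced aq) (admissible_reduced asp)) ?qi //.
  exact: mat_eqG.
case=> s; rewrite inE => /and4P[es sp /eqP sj /eqP si] ->.
have asp : adm (s :: p) by rewrite /= sp es.
split; first by apply/levelP; exists (s :: p); rewrite /= pn.
apply/asboolP; split; last by apply/part_edgeP => //; exists s.
apply/of_typeP => //; exists (s :: p); split=> //=; first by rewrite pn.
by rewrite remaining_cons.
Qed.

(* Both sides count the edges from level [n] to the vertices of type [t] on level
   [n.+1]. *)
Lemma count_step t n : t \in vertex_types ->
  (t.2 * number t n.+1 =
   \sum_(u <- all_types) number u n * transition_number u.1 u.2 t.1 t.2)%N.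
Proof.
move=> tt; have t4 : (t.1 <= 4)%N by apply: vertex_type_le; rewrite inE tt orbT.
pose L m := fset_set (level V0 C0 m).
have memL m v : v \in L m -> level V0 C0 m v.
  by rewrite in_fset_set; [move/set_mem|exact: finite_level].
transitivity (\sum_(v <- L n.+1 | `[< of_type V0 C0 (star_size t.1) t.2 n.+1 v >])
    \sum_(u <- L n | `[< part_edge u v >]) 1%N)%N.
  rewrite numberE big_distrr /= big_seq_cond [RHS]big_seq_cond.
  apply: eq_bigr => v /andP[/memL lv /asboolP tv]; rewrite muln1.
  rewrite -card_of_sum; last exact: finite_level.
  case: tv => _ _ <-; congr card_of; apply/seteqP; split=> u.
    move=> [uv [m [lu lv']]]; split; last exact/asboolP.
    have [p [ap pm vp]] := (proj1 (levelP _ _ _) lv).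
    have [p' [ap' pm' vp']] := (proj1 (levelP _ _ _) lv').
    have pp' : perm_eq p p'.
      by apply: (admissible_perm isoG ap ap'); apply/mat_eqG/vertex_eq; rewrite -vp.
    by move: lu; have := perm_size pp'; rewrite pm pm' => -[->].
  by move=> [lu /asboolP uv]; split=> //; exists n.
rewrite (exchange_big_dep predT) //=.
transitivity (\sum_(v <- L n) \sum_(u <- all_types |
    `[< of_type V0 C0 (star_size u.1) u.2 n v >])
      transition_number u.1 u.2 t.1 t.2)%N.
  rewrite big_seq [RHS]big_seq; apply: eq_bigr => u /memL /levelP[p [ap pn ->]].
  rewrite (sum_types (fun u => transition_number u.1 u.2 t.1 t.2) ap pn) /=.
  rewrite -(number_transitions tt ap pn) card_of_sum; last exact: finite_level.
  by apply: eq_bigl => v; apply/andP/asboolP => [[/asboolP ? /asboolP]|[? ?]];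
    split=> //; apply/asboolP.
rewrite (exchange_big_dep predT) //=; apply: eq_bigr => u _.
by rewrite numberE big_distrl /=; apply: eq_bigr => v _; rewrite mul1n.
Qed.

Lemma card_level n :
  card_of (level V0 C0 n) = (\sum_(u <- all_types) number u n)%N.
Proof.
have -> : card_of (level V0 C0 n) =
    card_of [set v | level V0 C0 n v /\ (@predT 'rV[R]_5 v)]%classic.
  by congr card_of; apply/seteqP; split=> v //= [].
rewrite card_of_sum; last exact: finite_level.
under [RHS]eq_bigr do rewrite numberE.
rewrite (exchange_big_dep predT) //=; rewrite big_seq [RHS]big_seq.
apply: eq_bigr => v; rewrite in_fset_set; last exact: finite_level.
by move=> /set_mem/levelP[p [ap pn ->]]; rewrite (sum_types (fun=> 1%N) ap pn).
Qed.

Lemma number_level0 t : t \in vertex_types -> number t 0 = 0%N.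
Proof.
move=> tt; have t4 : (t.1 <= 4)%N by apply: vertex_type_le; rewrite inE tt orbT.
rewrite /number (_ : of_type _ _ _ _ _ = classical_sets.set0).
  by rewrite /card_of fset_set0 cardfs0.
apply/seteqP; split=> v // /(of_typeP _ _ _ t4)[p [_ /size0nil -> _ _ t2]].
have : (0 < t.2)%N by move: t tt {t4 t2}; apply/allP.
by rewrite -t2 cards0.
Qed.

Lemma number_apex n : number (4, 0)%N n = (n == 0%N).
Proof.
case: n => [|n]; rewrite /number /=; last first.
  rewrite (_ : of_type _ _ _ _ _ = classical_sets.set0).
    by rewrite /card_of fset_set0 cardfs0.
  apply/seteqP; split=> v //; rewrite -[4%N]/(star_size 4).
  move=> /(of_typeP _ _ _ (leqnn 4))[p [_ pn _ _]].
  case: p pn => // s p _ /eqP.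
  by rewrite cards_eq0 => /eqP e; have := head_descent s p; rewrite e inE.
rewrite (_ : of_type _ _ _ _ _ = [set V0]%classic).
  by rewrite /card_of fset_set1 cardfs1.
rewrite -[4%N]/(star_size 4); apply/seteqP; split=> v.
  by move=> /(of_typeP _ _ _ (leqnn 4))[p [_ /size0nil -> -> _ _]].
move=> ->; apply/of_typeP => //; exists [::]; split=> //.
  by rewrite remaining_nil card_initial.
by rewrite cards0.
Qed.

End Counting.

(** * The linear recurrences *)

Section Recurrence.
Local Open Scope Z_scope.
Variables a b c d e f g h k : nat -> Z.
Hypothesis a_step : forall n, 2 * a n.+1 = 12 + 2 * a n + 2 * b n.
Hypothesis b_step : forall n, b n.+1 = a n + 2 * b n.
Hypothesis c_step : forall n, 3 * c n.+1 = 2 * a n + 2 * d n + 3 * c n.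
Hypothesis d_step : forall n,
  2 * d n.+1 = 2 * b n + 5 * e n + 4 * d n + 3 * c n.
Hypothesis e_step : forall n, e n.+1 = 6 * e n + 4 * d n + 3 * c n.
Hypothesis f_step : forall n, 4 * f n.+1 = c n + 2 * g n + 4 * f n.
Hypothesis g_step : forall n, 3 * g n.+1 = d n + 5 * h n + 6 * g n + 6 * f n.
Hypothesis h_step : forall n,
  2 * h n.+1 = e n + 12 * k n + 12 * h n + 12 * g n + 12 * f n.
Hypothesis k_step : forall n,
  k n.+1 = 107 * k n + 101 * h n + 97 * g n + 94 * f n.

Definition shift3 (x : nat -> Z) (n : nat) : Z :=
  x n.+3 - 4 * x n.+2 + 4 * x n.+1 - x n.

Definition shift5 (x : nat -> Z) (n : nat) : Z :=
  x n.+4.+1 - 12 * x n.+4 + 37 * x n.+3 - 37 * x n.+2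
  + 12 * x n.+1 - x n.

Definition shift9 (x : nat -> Z) (n : nat) : Z :=
  x n.+4.+4.+1 - 128 * x n.+4.+4 + 1795 * x n.+4.+3 - 8837 * x n.+4.+2
  + 19239 * x n.+4.+1 - 19239 * x n.+4 + 8837 * x n.+3
  - 1795 * x n.+2 + 128 * x n.+1 - x n.

(** The matrix of (a, b) has characteristic polynomial x^2 - 3 x + 1; the constant inflow from the
    rays adds the factor x - 1. *)
Lemma shift3_a n : shift3 a n = 0.
Proof.
unfold shift3.
generalize (a_step n) (a_step n.+1) (a_step n.+2).
generalize (b_step n) (b_step n.+1). intros; lia.
Qed.

Lemma shift3_b n : shift3 b n = 0.
Proof.
unfold shift3.
generalize (a_step n) (a_step n.+1) (b_step n) (b_step n.+1) (b_step n.+2).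
intros; lia.
Qed.

(** The additional factor is x^2 - 8 x + 1, from the block of c, d, e. *)
Lemma shift5_of_shift3 x : (forall n, shift3 x n = 0) -> forall n, shift5 x n = 0.
Proof.
intros H n; generalize (H n) (H n.+1) (H n.+2).
unfold shift3, shift5; intros; lia.
Qed.

(** The additional factor is x^4 - 116 x^3 + 366 x^2 - 116 x + 1, from the block of f, g, h, k. *)
Lemma shift9_of_shift5 x : (forall n, shift5 x n = 0) -> forall n, shift9 x n = 0.
Proof.
intros H n.
generalize (H n) (H n.+1) (H n.+2) (H n.+3) (H n.+4).
unfold shift5, shift9; intros; lia.
Qed.

(* [shift3] annihilates the forcing terms, so it maps (c, d, e) to a solution of
   the homogeneous system; the linear form 3 c + 2 d - e belongs to its
   eigenvalue 1. *)
Lemma shift5_cde n : shift5 c n = 0 /\ shift5 d n = 0 /\ shift5 e n = 0.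
Proof.
assert (HC : forall m, 3 * shift3 c m.+1 = 2 * shift3 d m + 3 * shift3 c m).
  intro m; generalize (shift3_a m); unfold shift3.
  generalize (c_step m) (c_step m.+1) (c_step m.+2) (c_step m.+3).
  intros; lia.
assert (HD : forall m,
  2 * shift3 d m.+1 = 5 * shift3 e m + 4 * shift3 d m + 3 * shift3 c m).
  intro m; generalize (shift3_b m); unfold shift3.
  generalize (d_step m) (d_step m.+1) (d_step m.+2) (d_step m.+3).
  intros; lia.
assert (HE : forall m,
  shift3 e m.+1 = 6 * shift3 e m + 4 * shift3 d m + 3 * shift3 c m).
  intro m; unfold shift3.
  generalize (e_step m) (e_step m.+1) (e_step m.+2) (e_step m.+3).
  intros; lia.
(* The form grows by 2 (a + b) at each step, and a + b is annihilated by x^2 - 3 x + 1, so [shift3]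
   kills the form. This removes the eigenvalue 1 of the block and leaves x^2 - 8 x + 1. *)
assert (H1 : forall m, 3 * shift3 c m + 2 * shift3 d m - shift3 e m = 0).
  intro m.
  assert (HI : forall i, 3 * c i.+1 + 2 * d i.+1 - e i.+1 =
    3 * c i + 2 * d i - e i + 2 * (a i + b i)).
    intro i; generalize (c_step i) (d_step i) (e_step i); intros; lia.
  generalize (HI m) (HI m.+1) (HI m.+2).
  generalize (a_step m) (a_step m.+1) (b_step m) (b_step m.+1).
  unfold shift3; intros; lia.
assert (E5 : forall x m, shift5 x m =
  shift3 x m.+2 - 8 * shift3 x m.+1 + shift3 x m).
  intros x m; unfold shift5, shift3; lia.
rewrite !E5.
generalize (HC n) (HC n.+1) (HD n) (HD n.+1) (HE n) (HE n.+1).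
generalize (H1 n) (H1 n.+1) (H1 n.+2); intros; lia.
Qed.

(** [shift5] removes the inflow from c, d, e. In the homogeneous system that remains, g, h and k are
    successively expressed through shifts of f, and the equation for k becomes a recurrence of order
    four for f. *)
Lemma shift9_fghk n :
  shift9 f n = 0 /\ shift9 g n = 0 /\ shift9 h n = 0 /\ shift9 k n = 0.
Proof.
assert (HF : forall m, 4 * shift5 f m.+1 = 2 * shift5 g m + 4 * shift5 f m).
  intro m; generalize (proj1 (shift5_cde m)); unfold shift5.
  generalize (f_step m) (f_step m.+1) (f_step m.+2) (f_step m.+3)
    (f_step m.+4) (f_step m.+4.+1).
  intros; lia.
assert (HG : forall m,
  3 * shift5 g m.+1 = 5 * shift5 h m + 6 * shift5 g m + 6 * shift5 f m).
  intro m; generalize (proj1 (proj2 (shift5_cde m))); unfold shift5.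
  generalize (g_step m) (g_step m.+1) (g_step m.+2) (g_step m.+3)
    (g_step m.+4) (g_step m.+4.+1).
  intros; lia.
assert (HH : forall m, 2 * shift5 h m.+1 =
  12 * shift5 k m + 12 * shift5 h m + 12 * shift5 g m + 12 * shift5 f m).
  intro m; generalize (proj2 (proj2 (shift5_cde m))); unfold shift5.
  generalize (h_step m) (h_step m.+1) (h_step m.+2) (h_step m.+3)
    (h_step m.+4) (h_step m.+4.+1).
  intros; lia.
assert (HK : forall m, shift5 k m.+1 =
  107 * shift5 k m + 101 * shift5 h m + 97 * shift5 g m + 94 * shift5 f m).
  intro m; unfold shift5.
  generalize (k_step m) (k_step m.+1) (k_step m.+2) (k_step m.+3)
    (k_step m.+4) (k_step m.+4.+1).
  intros; lia.
assert (E9 : forall x m, shift9 x m =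
  shift5 x m.+4 - 116 * shift5 x m.+3
  + 366 * shift5 x m.+2 - 116 * shift5 x m.+1 + shift5 x m).
  intros x m; unfold shift9, shift5; lia.
assert (EG : forall m, shift5 g m = 2 * shift5 f m.+1 - 2 * shift5 f m).
  intro m; generalize (HF m); intros; lia.
assert (EH : forall m, 5 * shift5 h m =
  6 * shift5 f m.+2 - 18 * shift5 f m.+1 + 6 * shift5 f m).
  intro m; generalize (HG m) (EG m) (EG m.+1); intros; lia.
assert (EK : forall m, 5 * shift5 k m = shift5 f m.+3
  - 9 * shift5 f m.+2 + 9 * shift5 f m.+1 - shift5 f m).
  intro m; generalize (HH m) (EG m) (EH m) (EH m.+1); intros; lia.
assert (PF : forall m, shift5 f m.+4 - 116 * shift5 f m.+3
  + 366 * shift5 f m.+2 - 116 * shift5 f m.+1 + shift5 f m = 0).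
  intro m; generalize (HK m) (EG m) (EH m) (EK m) (EK m.+1); intros; lia.
rewrite !E9; repeat split.
- apply PF.
- rewrite !EG; generalize (PF n) (PF n.+1); intros; lia.
- generalize (PF n) (PF n.+1) (PF n.+2) (EH n) (EH n.+1) (EH n.+2)
    (EH n.+3) (EH n.+4); intros; lia.
- generalize (PF n) (PF n.+1) (PF n.+2) (PF n.+3) (EK n) (EK n.+1)
    (EK n.+2) (EK n.+3) (EK n.+4); intros; lia.
Qed.

(** The divisors are the numbers of incoming edges; on true counts the step equations make these
    divisions exact. *)
Definition next_level (x : seq Z) : seq Z :=
  match x with
  | a :: b :: c :: d :: e :: f :: g :: h :: k :: nil =>
    6 + a + b :: a + 2 * b
    :: (2 * a + 2 * d + 3 * c) / 3
    :: (2 * b + 5 * e + 4 * d + 3 * c) / 2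
    :: 6 * e + 4 * d + 3 * c
    :: (c + 2 * g + 4 * f) / 4
    :: (d + 5 * h + 6 * g + 6 * f) / 3
    :: (e + 12 * k + 12 * h + 12 * g + 12 * f) / 2
    :: 107 * k + 101 * h + 97 * g + 94 * f :: nil
  | _ => nil
  end.

Definition level_counts (n : nat) : seq Z :=
  a n :: b n :: c n :: d n :: e n :: f n :: g n :: h n :: k n :: nil.

Lemma level_countsE n :
  level_counts 0 = 0 :: 0 :: 0 :: 0 :: 0 :: 0 :: 0 :: 0 :: 0 :: nil ->
  level_counts n =
  Nat.iter n next_level (0 :: 0 :: 0 :: 0 :: 0 :: 0 :: 0 :: 0 :: 0 :: nil).
Proof.
intro H0; induction n as [|n IH]; [exact H0|].
transitivity (next_level (level_counts n)); last by rewrite IH.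
rewrite /level_counts /next_level.
rewrite -(Z.div_unique_exact _ 3 (c n.+1)) ?c_step //.
rewrite -(Z.div_unique_exact _ 2 (d n.+1)) ?d_step //.
rewrite -(Z.div_unique_exact _ 4 (f n.+1)) ?f_step //.
rewrite -(Z.div_unique_exact _ 3 (g n.+1)) ?g_step //.
rewrite -(Z.div_unique_exact _ 2 (h n.+1)) ?h_step //.
rewrite -b_step -e_step -k_step (_ : 6 + a n + b n = a n.+1) //.
by have := a_step n; lia.
Qed.

End Recurrence.

(* Rows are indexed by [vertex_types], columns by [all_types]. *)
Definition transition_table : seq (seq nat) :=
  [:: [:: 4; 1; 0; 0; 0; 0; 0; 0; 0; 0; 0];
      [:: 0; 3; 2; 2; 0; 0; 0; 0; 0; 0; 0];
      [:: 0; 0; 1; 2; 0; 0; 0; 0; 0; 0; 0];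
      [:: 0; 0; 2; 0; 3; 2; 0; 0; 0; 0; 0];
      [:: 0; 0; 0; 2; 3; 4; 5; 0; 0; 0; 0];
      [:: 0; 0; 0; 0; 3; 4; 6; 0; 0; 0; 0];
      [:: 0; 0; 0; 0; 1; 0; 0; 4; 2; 0; 0];
      [:: 0; 0; 0; 0; 0; 1; 0; 6; 6; 5; 0];
      [:: 0; 0; 0; 0; 0; 0; 1; 12; 12; 12; 12];
      [:: 0; 0; 0; 0; 0; 0; 0; 94; 97; 101; 107]]%N.

Lemma transition_tableE :
  [seq [seq transition_number u.1 u.2 t.1 t.2 | u <- all_types] |
    t <- vertex_types] = transition_table.
Proof. by vm_compute. Qed.

(** * The step equations for the numbers of vertices *)

Section Equations.
Variables (R : realType) (g : seq 'I_5).
Local Notation number := (@number R g).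

Lemma count_table i n : (i < 10)%N ->
  ((nth (0, 0) vertex_types i).2 * number (nth (0, 0) vertex_types i) n.+1 =
   \sum_(j < 11) number (nth (0, 0) all_types j) n *
     nth 0 (nth [::] transition_table i) j)%N.
Proof.
move=> i10; have it : nth (0%N, 0%N) vertex_types i \in vertex_types by apply: mem_nth.
rewrite count_step // (big_nth (0%N, 0%N)) big_mkord; apply: eq_bigr => j _.
by rewrite -transition_tableE (nth_map (0%N, 0%N)) // (nth_map (0%N, 0%N)).
Qed.

Definition counts (t : nat * nat) (n : nat) : Z := Z.of_nat (number t n).

Local Open Scope Z_scope.

Lemma count_equation i n : (i < 10)%N ->
  Z.of_nat (nth (0, 0)%N vertex_types i).2 * counts (nth (0, 0)%N vertex_types i) n.+1
  = foldr (fun j z => counts (nth (0, 0)%N all_types j) n *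
             Z.of_nat (nth 0%N (nth [::] transition_table i) j) + z) 0 (iota 0 11).
Proof.
move=> /(count_table n); rewrite /counts.
move: (nth [::] transition_table i) (nth _ vertex_types i) => row t e.
rewrite -Nat2Z.inj_mul multE e -(big_mkord predT (fun j =>
  number (nth (0, 0)%N all_types j) n * nth 0 row j)%N) /index_iota subn0 unlock.
elim: (iota 0 11) => //= j l <-.
by rewrite Nat2Z.inj_add Nat2Z.inj_mul.
Qed.

Lemma counts_apex n : counts (4, 0)%N n.+1 = 0.
Proof. by rewrite /counts number_apex. Qed.

Lemma counts_level0 t : t \in vertex_types -> counts t 0 = 0.
Proof. by move=> tt; rewrite /counts number_level0. Qed.

Lemma counts_ray n : counts (3, 1)%N n.+1 = 4.
Proof.
have apex0 : counts (4, 0)%N 0 = 1 by rewrite /counts number_apex.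
elim: n => [|n IH].
  have := @count_equation 0 0 isT; cbn -[Z.mul Z.add counts]; rewrite apex0 !counts_level0 //; intros; lia.
have := @count_equation 0 n.+1 isT; cbn -[Z.mul Z.add counts]; rewrite counts_apex IH; intros; lia.
Qed.

Lemma counts_level1 t : t \in behead vertex_types -> counts t 1 = 0.
Proof.
have apex0 : counts (4, 0)%N 0 = 1 by rewrite /counts number_apex.
have eq0 i : (0 < i < 10)%N -> counts (nth (0, 0)%N vertex_types i) 1 = 0.
  move=> /andP[i0 i10]; have := @count_equation i 0 i10.
  have z u : u \in vertex_types -> counts u 0 = 0 by apply: counts_level0.
  case: i i0 i10 => [|[|[|[|[|[|[|[|[|[|i]]]]]]]]]] // _ _;
    cbn -[Z.mul Z.add counts]; rewrite apex0 !z //; intros; lia.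
move=> tt; have i9 : (index t (behead vertex_types) < 9)%N by rewrite index_mem.
by rewrite -(nth_index (0, 0)%N tt) nth_behead; apply: eq0.
Qed.

Lemma counts_level n : (1 <= n)%N ->
  number_of (level (vertex_of (word_mx R g) [::]) (@cell R g [::] (initial 4)) n) =
  counts (2, 2)%N n + counts (2, 1)%N n + counts (1, 3)%N n + counts (1, 2)%N n
  + counts (1, 1)%N n + counts (0, 4)%N n + counts (0, 3)%N n + counts (0, 2)%N n
  + counts (0, 1)%N n + 4.
Proof.
case: n => // n _; rewrite /number_of card_level /all_types !big_cons big_nil.
have := counts_ray n; have := counts_apex n; rewrite /counts; intros; lia.
Qed.

(** Index 0 stands for level 1: from there on the apex contributes nothing and the rays contribute
    the constant 4. *)
Local Notation A' n := (counts (2, 2)%N n.+1).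
Local Notation B' n := (counts (2, 1)%N n.+1).
Local Notation C' n := (counts (1, 3)%N n.+1).
Local Notation D' n := (counts (1, 2)%N n.+1).
Local Notation E' n := (counts (1, 1)%N n.+1).
Local Notation F' n := (counts (0, 4)%N n.+1).
Local Notation G' n := (counts (0, 3)%N n.+1).
Local Notation H' n := (counts (0, 2)%N n.+1).
Local Notation K' n := (counts (0, 1)%N n.+1).

Ltac count_step_tac i n :=
  have := @count_equation i n.+1 isT; cbn -[Z.mul Z.add counts];
  rewrite counts_ray counts_apex; intros; lia.

Lemma counts_a n : 2 * A' n.+1 = 12 + 2 * A' n + 2 * B' n.
Proof. count_step_tac 1%N n. Qed.

Lemma counts_b n : B' n.+1 = A' n + 2 * B' n.
Proof. count_step_tac 2%N n. Qed.

Lemma counts_c n : 3 * C' n.+1 = 2 * A' n + 2 * D' n + 3 * C' n.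
Proof. count_step_tac 3%N n. Qed.

Lemma counts_d n : 2 * D' n.+1 = 2 * B' n + 5 * E' n + 4 * D' n + 3 * C' n.
Proof. count_step_tac 4%N n. Qed.

Lemma counts_e n : E' n.+1 = 6 * E' n + 4 * D' n + 3 * C' n.
Proof. count_step_tac 5%N n. Qed.

Lemma counts_f n : 4 * F' n.+1 = C' n + 2 * G' n + 4 * F' n.
Proof. count_step_tac 6%N n. Qed.

Lemma counts_g n : 3 * G' n.+1 = D' n + 5 * H' n + 6 * G' n + 6 * F' n.
Proof. count_step_tac 7%N n. Qed.

Lemma counts_h n :
  2 * H' n.+1 = E' n + 12 * K' n + 12 * H' n + 12 * G' n + 12 * F' n.
Proof. count_step_tac 8%N n. Qed.

Lemma counts_k n : K' n.+1 = 107 * K' n + 101 * H' n + 97 * G' n + 94 * F' n.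
Proof. count_step_tac 9%N n. Qed.

End Equations.

(** * Recurrences and initial values indexed by levels *)

Section Shifts.
Local Open Scope Z_scope.
Variable x : nat -> Z.

Lemma shift9_rec : (forall n, shift9 (fun m => x m.+1) n = 0) ->
  forall n, (10 <= n)%N ->
  x n = 128 * x (n - 1)%N - 1795 * x (n - 2)%N + 8837 * x (n - 3)%N
        - 19239 * x (n - 4)%N + 19239 * x (n - 5)%N - 8837 * x (n - 6)%N
        + 1795 * x (n - 7)%N - 128 * x (n - 8)%N + x (n - 9)%N.
Proof.
move=> H n n10; have [m ->] : exists m, n = m.+4.+4.+2 by exists (n - 10)%N; lia.
by rewrite !subSS !subn0; have := H m; rewrite /shift9; intros; lia.
Qed.

Lemma shift5_rec : (forall n, shift5 (fun m => x m.+1) n = 0) ->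
  forall n, (6 <= n)%N ->
  x n = 12 * x (n - 1)%N - 37 * x (n - 2)%N + 37 * x (n - 3)%N
        - 12 * x (n - 4)%N + x (n - 5)%N.
Proof.
move=> H n n6; have [m ->] : exists m, n = m.+4.+2 by exists (n - 6)%N; intros; lia.
by rewrite !subSS !subn0; have := H m; rewrite /shift5; intros; lia.
Qed.

Lemma shift3_rec : (forall n, shift3 (fun m => x m.+1) n = 0) ->
  forall n, (4 <= n)%N ->
  x n = 4 * x (n - 1)%N - 4 * x (n - 2)%N + x (n - 3)%N.
Proof.
move=> H n n4; have [m ->] : exists m, n = m.+4 by exists (n - 4)%N; intros; lia.
by rewrite !subSS !subn0; have := H m; rewrite /shift3; intros; lia.
Qed.

Lemma initial_values (F : seq Z -> Z) (init : seq Z) :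
  (forall n, x n.+1 = F (Nat.iter n next_level init)) ->
  [seq x n | n <- iota 1 9] =
  [seq F (Nat.iter n next_level init) | n <- iota 0 9].
Proof. by move=> H; rewrite (iotaDl 1 0 9) -map_comp; apply: eq_map => n /=. Qed.

End Shifts.

(** The word [t] in the walls 0 to 3 that reaches [V0] maps the standard hypercube to itself, so
    prefixing it to [w] moves the base vertex to [V0] and keeps [C0]. *)
Lemma frame (R : realType) (V0 : 'rV[R]_5) (C0 : set 'rV[R]_5) :
  hypercube C0 -> C0 V0 ->
  exists g, V0 = vertex_of (word_mx R g) [::] /\ C0 = @cell R g [::] (initial 4).
Proof.
case=> w -> [t /= t4 <-]; exists (t ++ w); split.
  by rewrite !isometry_ofE /vertex_of /= word_mx_cat mulmxA.
have rt : letters_below 4 (rev t) by rewrite /letters_below all_rev.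
apply/seteqP; split=> v.
  case=> u /= u4 <-; have [] := initial_orbit (base_vertex R *m word_mx R (u ++ rev t))
    (isT : (0 < 4 <= 4)%N).
  move=> /(_ _)[|q q4 qE _]; first by exists (u ++ rev t); rewrite // /letters_below all_cat u4.
  exists q => //; rewrite cats0 /vertex_of matE mulmxA -qE !isometry_ofE !word_mx_cat.
  by rewrite -!mulmxA (mulmxA (word_mx R (rev t))) word_mx_Krev mul1mx.
case=> q q4 ->; rewrite cats0.
have [_] := initial_orbit (base_vertex R *m mat 1%:M q) (isT : (0 < 4 <= 4)%N).
move=> /(_ _)[|u u4 uE]; first by exists q.
exists (u ++ t); first by rewrite /= all_cat; apply/andP.
by rewrite !isometry_ofE /vertex_of matE !mulmxA uE !word_mx_cat !mulmxA.
Qed.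

Local Open Scope Z_scope.

Theorem theorem2 (R : realType) (V0 : 'rV[R]_5) (C0 : set 'rV[R]_5)
    (hC0 : hypercube C0) (hV0 : C0 V0) :
  let a n := number_of (of_type V0 C0 7 2 n) in
  let b n := number_of (of_type V0 C0 7 1 n) in
  let c n := number_of (of_type V0 C0 13 3 n) in
  let d n := number_of (of_type V0 C0 13 2 n) in
  let e n := number_of (of_type V0 C0 13 1 n) in
  let f n := number_of (of_type V0 C0 120 4 n) in
  let g n := number_of (of_type V0 C0 120 3 n) in
  let h n := number_of (of_type V0 C0 120 2 n) in
  let k n := number_of (of_type V0 C0 120 1 n) in
  let s n := number_of (level V0 C0 n) in
  (forall n : nat, finite_set (level V0 C0 n)) /\
  (forall n : nat, (1 <= n)%N ->
    s n = a n + b n + c n + d n + e n + f n + g n + h n + k n + 4) /\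
  ((forall x : nat -> Z, List.In x [:: a; b; c; d; e; f; g; h; k; s] ->
    forall n : nat, (10 <= n)%N ->
      x n = 128 * x (n - 1)%N - 1795 * x (n - 2)%N + 8837 * x (n - 3)%N
            - 19239 * x (n - 4)%N + 19239 * x (n - 5)%N - 8837 * x (n - 6)%N
            + 1795 * x (n - 7)%N - 128 * x (n - 8)%N + x (n - 9)%N) /\
   [seq a n | n <- iota 1 9] = [:: 0; 6; 12; 24; 54; 132; 336; 870; 2268] /\
   [seq b n | n <- iota 1 9] = [:: 0; 0; 6; 24; 72; 198; 528; 1392; 3654] /\
   [seq c n | n <- iota 1 9] = [:: 0; 0; 4; 12; 36; 136; 696; 4512; 33004] /\
   [seq d n | n <- iota 1 9]
     = [:: 0; 0; 0; 12; 96; 708; 5388; 41868; 328116] /\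
   [seq e n | n <- iota 1 9]
     = [:: 0; 0; 0; 12; 156; 1428; 11808; 94488; 747936] /\
   [seq f n | n <- iota 1 9] = [:: 0; 0; 0; 1; 4; 16; 86; 1111; 70970] /\
   [seq g n | n <- iota 1 9]
     = [:: 0; 0; 0; 0; 6; 72; 1702; 137462; 15061942] /\
   [seq h n | n <- iota 1 9]
     = [:: 0; 0; 0; 0; 12; 774; 79254; 8862504; 998747934] /\
   [seq k n | n <- iota 1 9]
     = [:: 0; 0; 0; 0; 94; 12228; 1395058; 157449038; 17755598218] /\
   [seq s n | n <- iota 1 9]
     = [:: 4; 10; 26; 89; 534; 15696; 1494860; 166593249; 18770594046]) /\
  (forall x : nat -> Z, List.In x [:: a; b; c; d; e] ->
    forall n : nat, (6 <= n)%N ->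
      x n = 12 * x (n - 1)%N - 37 * x (n - 2)%N + 37 * x (n - 3)%N
            - 12 * x (n - 4)%N + x (n - 5)%N) /\
  (forall x : nat -> Z, List.In x [:: a; b] ->
    forall n : nat, (4 <= n)%N ->
      x n = 4 * x (n - 1)%N - 4 * x (n - 2)%N + x (n - 3)%N).
Proof.
have [g [-> ->]] := frame hC0 hV0.
move=> a b c d e f g' h k s.
pose cnt := @counts R g.
have aE : a = cnt (2, 2)%N by [].
have bE : b = cnt (2, 1)%N by [].
have cE : c = cnt (1, 3)%N by [].
have dE : d = cnt (1, 2)%N by [].
have eE : e = cnt (1, 1)%N by [].
have fE : f = cnt (0, 4)%N by [].
have gE : g' = cnt (0, 3)%N by [].
have hE : h = cnt (0, 2)%N by [].
have kE : k = cnt (0, 1)%N by [].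
have sE n : (1 <= n)%N ->
    s n = a n + b n + c n + d n + e n + f n + g' n + h n + k n + 4.
  by move=> n1; rewrite aE bE cE dE eE fE gE hE kE -counts_level.
split; first exact: finite_level.
split; first exact: sE.
have Ha n : 2 * a n.+2 = 12 + 2 * a n.+1 + 2 * b n.+1 by apply: counts_a.
have Hb n : b n.+2 = a n.+1 + 2 * b n.+1 by apply: counts_b.
have Hc n : 3 * c n.+2 = 2 * a n.+1 + 2 * d n.+1 + 3 * c n.+1.
  exact: counts_c.
have Hd n : 2 * d n.+2 = 2 * b n.+1 + 5 * e n.+1 + 4 * d n.+1 + 3 * c n.+1.
  exact: counts_d.
have He n : e n.+2 = 6 * e n.+1 + 4 * d n.+1 + 3 * c n.+1 by apply: counts_e.
have Hf n : 4 * f n.+2 = c n.+1 + 2 * g' n.+1 + 4 * f n.+1 by apply: counts_f.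
have Hg n : 3 * g' n.+2 = d n.+1 + 5 * h n.+1 + 6 * g' n.+1 + 6 * f n.+1.
  exact: counts_g.
have Hh n : 2 * h n.+2 =
    e n.+1 + 12 * k n.+1 + 12 * h n.+1 + 12 * g' n.+1 + 12 * f n.+1.
  exact: counts_h.
have Hk n : k n.+2 = 107 * k n.+1 + 101 * h n.+1 + 97 * g' n.+1 + 94 * f n.+1.
  exact: counts_k.
have zeros : [:: a 1; b 1; c 1; d 1; e 1; f 1; g' 1; h 1; k 1]%N = nseq 9 0.
  by rewrite aE bE cE dE eE fE gE hE kE /cnt !counts_level1.
clearbody a b c d e f g' h k s => {aE bE cE dE eE fE gE hE kE}.
have values n : [:: a n.+1; b n.+1; c n.+1; d n.+1; e n.+1; f n.+1; g' n.+1;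
    h n.+1; k n.+1] = Nat.iter n next_level (nseq 9 0).
  exact: (@level_countsE (fun n => a n.+1) (fun n => b n.+1) (fun n => c n.+1)
    (fun n => d n.+1) (fun n => e n.+1) (fun n => f n.+1) (fun n => g' n.+1)
    (fun n => h n.+1) (fun n => k n.+1)).
have s3a := shift3_a Ha Hb; have s3b := shift3_b Ha Hb.
have s5a := shift5_of_shift3 s3a; have s5b := shift5_of_shift3 s3b.
have s5 := shift5_cde Ha Hb Hc Hd He.
have s5c n := proj1 (s5 n); have s5d n := proj1 (proj2 (s5 n)).
have s5e n := proj2 (proj2 (s5 n)).
have s9 := shift9_fghk Ha Hb Hc Hd He Hf Hg Hh Hk.
have s9f n := proj1 (s9 n); have s9g n := proj1 (proj2 (s9 n)).
have s9h n := proj1 (proj2 (proj2 (s9 n))).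
have s9k n := proj2 (proj2 (proj2 (s9 n))).
have s9a := shift9_of_shift5 s5a; have s9b := shift9_of_shift5 s5b.
have s9c := shift9_of_shift5 s5c; have s9d := shift9_of_shift5 s5d.
have s9e := shift9_of_shift5 s5e.
(* The constant 4 disappears because 1 is a root of the characteristic polynomial. *)
have s9s n : shift9 (fun m => s m.+1) n = 0.
  have := s9a n; have := s9b n; have := s9c n; have := s9d n; have := s9e n.
  have := s9f n; have := s9g n; have := s9h n; have := s9k n.
  rewrite /shift9 !sE //; intros; lia.
split; [split|split].
- by move=> x; do 10 (case=> [<-|]; first exact: shift9_rec); case.
- have val j (x : nat -> Z) : (forall n, x n.+1 = nth 0 [:: a n.+1; b n.+1; c n.+1;
      d n.+1; e n.+1; f n.+1; g' n.+1; h n.+1; k n.+1] j) ->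
    [seq x n | n <- iota 1 9] =
    [seq nth 0 (Nat.iter n next_level (nseq 9 0)) j | n <- iota 0 9].
    by move=> xE; apply: (initial_values (F := fun l => nth 0 l j)) => n;
       rewrite -values.
  split; first by rewrite (val 0%N a (fun=> erefl)); vm_compute.
  split; first by rewrite (val 1%N b (fun=> erefl)); vm_compute.
  split; first by rewrite (val 2%N c (fun=> erefl)); vm_compute.
  split; first by rewrite (val 3%N d (fun=> erefl)); vm_compute.
  split; first by rewrite (val 4%N e (fun=> erefl)); vm_compute.
  split; first by rewrite (val 5%N f (fun=> erefl)); vm_compute.
  split; first by rewrite (val 6%N g' (fun=> erefl)); vm_compute.
  split; first by rewrite (val 7%N h (fun=> erefl)); vm_compute.
  split; first by rewrite (val 8%N k (fun=> erefl)); vm_compute.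
  (* The seed 4 counts the vertices on the boundary rays. *)
  rewrite (initial_values (F := foldr Z.add 4) (init := nseq 9 0)).
    by vm_compute.
  by move=> n; rewrite -values sE //=; lia.
- by move=> x; do 5 (case=> [<-|]; first exact: shift5_rec); case.
- by move=> x; do 2 (case=> [<-|]; first exact: shift3_rec); case.
Qed.
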